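(* Let $n$ be a positive integer. The quotient $\widetilde{\mathcal{P}(n)}$ of the set $\mathcal{P}(n)$ of polytopes in $\mathbb{R}^n$ (other than single points) by translations and positive scaling has a natural structure of regular CW complex in which closed cells of dimension $m$ correspond to secondary cones of dimension $m+n+1$, and the face poset structure of the CW complex is that of refinement of normal fans: writing $\bar e_{\mathcal{N}}$ for the closed cell of the fan $\mathcal{N}$, $\bar e_{\mathcal{N}}\subseteq\bar e_{\mathcal{N}'}$ if and only if $\mathcal{N}'$ refines $\mathcal{N}$. In this structure (the image of) $\mathcal{P}_{\mathbb{Q}}(n)$ is a subcomplex with countably many cells, and (the image of) $\mathcal{D}(n)$ is a union of open cells, but not a subcomplex.
   Context: A polytope in $\mathbb{R}^n$ is the convex hull of a nonempty finite set of points, not necessarily full-dimensional. Its normal fan $\mathcal{N}(P)$ consists of the cones $\{\alpha\in(\mathbb{R}^n)^*:\langle\alpha,p-q\rangle\ge0\ \forall p\in F,q\in P\}$ for all nonempty faces $F$ of $P$; it is a complete fan (finite complex of polyhedral cones covering $(\mathbb{R}^n)^*$). A complete fan is polytopal if it is the normal fan of some polytope; the fan $\{(\mathbb{R}^n)^*\}$ is the normal fan of a single point. A complete fan $\Sigma'$ refines $\Sigma$ if every cone of $\Sigma'$ is contained in a cone of $\Sigma$. For a polytopal complete fan $\mathcal{N}$, the (closed) secondary cone of $\mathcal{N}$ is the set $\mathcal{P}(\mathcal{N})$ of polytopes $P$ such that $\mathcal{N}$ refines $\mathcal{N}(P)$. Identifying $P$ with its support function $h_P(\alpha)=\max_{x\in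 P}\langle\alpha,x\rangle$, it is a closed polyhedral cone in the finite-dimensional vector space of functions on $(\mathbb{R}^n)^*$ that are linear on each cone of $\mathcal{N}$ (equivalently, one records the values of $h_P$ on a fixed finite set of vectors containing generators of all cones of $\mathcal{N}$). Its relative interior consists of the polytopes with normal fan exactly $\mathcal{N}$, and its lineality space is the $n$-dimensional space of support functions of points; adding an element of the lineality space is translating the polytope. Minkowski addition and scaling of polytopes correspond to addition and scaling of support functions. The closed cells are indexed by the polytopal complete fans $\mathcal{N}\neq\{(\mathbb{R}^n)^*\}$ in $(\mathbb{R}^n)^*$: $\bar e_{\mathcal{N}}$ is the image in $\widetilde{\mathcal{P}(n)}$ of $\mathcal{P}(\mathcal{N})$ minus the single points, with the quotient topology from the finite-dimensional cone; the open cell is the image of the polytopes with normal fan exactly $\mathcal{N}$. The CW topology is the one in which a set is closed if and only if its intersection with each $\bar e_{\mathcal{N}}$ is closed. $\mathcal{P}_{\mathbb{Q}}(n)\subset\mathcal{P}(n)$ is the set of polytopes with rational edge directions. $\mathcal{D}(n)$ is the set of Delzant polytopes: full-dimensional polytopes such that every vertex lies in exactly $n$ edges, all edge directions are rational, and at each vertex the primitive integer edge vectors form a basis of $\mathbb{Z}^n$.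
   Formalization: The final claim, that the image of D(n) is not a subcomplex, is stated only for n > 1: for n = 1 every polytope other than a point is a Delzant segment, so the image of D(1) is the whole one-point complex. *)

(* Defs.v *)
From HB Require Import structures.
From mathcomp Require Export all_boot all_order all_algebra.
From mathcomp Require Export all_classical all_reals all_analysis.

Set Implicit Arguments.
Unset Strict Implicit.
Unset Printing Implicit Defensive.

Import Order.TTheory GRing.Theory Num.Theory.
Import numFieldNormedType.Exports.

Local Open Scope classical_set_scope.
Local Open Scope quotient_scope.
Local Open Scope ring_scope.

(* [span_dim S d]: the linear span of S has dimension d (S contains a basis of
   its span, of cardinality d).  The ambient space may be infinite-dimensional.
   For a convex cone this is the dimension of the cone. *)
Definition span_dim (R : realType) (V : lmodType R) (S : set V) (d : nat) :=
  exists b : 'I_d -> V,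
    [/\ forall i, S (b i),
        forall c : 'I_d -> R, \sum_i c i *: b i = 0 -> forall i, c i = 0 &
        forall x, S x -> exists c : 'I_d -> R, x = \sum_i c i *: b i].

Section CWComplex.
Variable R : realType.

(* The norm of MathComp-Analysis on row vectors is the sup norm, so the
   Euclidean balls are written out; both norms induce the same topology. *)
Definition closed_disk m : set 'rV[R]_m := [set x | \sum_i x 0 i ^+ 2 <= 1].
Definition open_disk m : set 'rV[R]_m := [set x | \sum_i x 0 i ^+ 2 < 1].
Arguments closed_disk : clear implicits.
Arguments open_disk : clear implicits.

Definition homeo_on (X Y : topologicalType) (A : set X) (B : set Y)
    (f : X -> Y) := f @` A = B /\
  exists g : Y -> X, [/\ {within A, continuous f}, {within B, continuous g} &
                         {in A, cancel f g}].

Variables (X : topologicalType) (I : Type).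
(* The open cells are the sets [cell i] for [D i]. *)
Variables (D : set I) (dim : I -> nat) (cell : I -> set X).

Record regular_CW : Prop := RegularCW {
  CW_hausdorff : hausdorff_space X;
  CW_cover : \bigcup_(i in D) cell i = setT;
  CW_disjoint : trivIset D cell;
  CW_regular : forall i, D i ->
    exists2 f : 'rV[R]_(dim i) -> X,
      homeo_on (closed_disk (dim i)) (closure (cell i)) f &
      f @` open_disk (dim i) = cell i;
  CW_closure_finite : forall i, D i ->
    exists J : set I, [/\ finite_set J, J `<=` D,
      forall j, J j -> (dim j < dim i)%N &
      closure (cell i) `\` cell i `<=` \bigcup_(j in J) cell j];
  CW_weak : forall C : set X,
    closed C <-> forall i, D i -> closed (C `&` closure (cell i)) }.

Definition union_of_cells (A : set X) :=
  exists2 J : set I, J `<=` D & A = \bigcup_(j in J) cell j.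

Definition cells_in (A : set X) : set I := [set i | D i /\ cell i `<=` A].

Definition subcomplex (A : set X) :=
  union_of_cells A /\ forall i, cells_in A i -> closure (cell i) `<=` A.

End CWComplex.

Section Polytopes.
Variables (R : realType) (n : nat).

(* Points of R^n are row vectors, elements of its dual are column vectors. *)
Definition pairing (a : 'cV[R]_n) (x : 'rV[R]_n) : R := (x *m a) 0 0.

Definition convex_hull (S : set 'rV[R]_n) : set 'rV[R]_n :=
  smallest (fun A : set 'rV[R]_n => convex_set A) S.

Definition is_polytope (P : set 'rV[R]_n) :=
  exists S : set 'rV[R]_n, [/\ finite_set S, S !=set0 & P = convex_hull S].

Definition is_point (P : set 'rV[R]_n) := exists x, P = [set x].

(* a = 0 gives F = P *)
Definition is_face (P F : set 'rV[R]_n) := F !=set0 /\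
  exists a, F = [set p | P p /\ forall q, P q -> pairing a q <= pairing a p].

Definition polytope_dim (P : set 'rV[R]_n) (d : nat) :=
  span_dim [set z | exists x y, [/\ P x, P y & z = x - y]] d.

Definition is_edge (P E : set 'rV[R]_n) := is_face P E /\ polytope_dim E 1.

Definition is_vertex (P : set 'rV[R]_n) (v : 'rV[R]_n) := is_face P [set v].

Definition fan := set (set 'cV[R]_n).

Definition normal_cone (P F : set 'rV[R]_n) : set 'cV[R]_n :=
  [set a | forall p q, F p -> P q -> 0 <= pairing a (p - q)].

Definition normal_fan (P : set 'rV[R]_n) : fan :=
  [set C | exists2 F, is_face P F & C = normal_cone P F].

Definition polyhedral_cone (C : set 'cV[R]_n) :=
  exists k (x : 'I_k -> 'rV[R]_n), C = [set a | forall i, 0 <= pairing a (x i)].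

Definition cone_face (C F : set 'cV[R]_n) :=
  exists2 x, (forall a, C a -> 0 <= pairing a x) &
             F = [set a | C a /\ pairing a x = 0].

Record complete_fan (N : fan) : Prop := CompleteFan {
  fan_finite : finite_set N;
  fan_cone : forall C, N C -> polyhedral_cone C;
  fan_face : forall C F, N C -> cone_face C F -> N F;
  fan_meet : forall C C', N C -> N C' -> cone_face C (C `&` C');
  fan_cover : \bigcup_(C in N) C = setT }.

Definition polytopal (N : fan) :=
  complete_fan N /\ exists2 P, is_polytope P & N = normal_fan P.

Definition refines (N' N : fan) :=
  forall C, N' C -> exists2 C', N C' & C `<=` C'.

Definition secondary_cone (N : fan) : set (set 'rV[R]_n) :=
  [set P | is_polytope P /\ refines N (normal_fan P)].

(* h_P(a) = max_(x in P) <a, x>, as an element of the R-vector space of all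
   functions on the dual *)
Definition support_fun (P : set 'rV[R]_n) : 'cV[R]_n -> R^o :=
  fun a => sup [set pairing a x | x in P].

Definition rational_direction (E : set 'rV[R]_n) :=
  exists v : 'rV[rat]_n, v != 0 /\
    forall x y, E x -> E y -> exists t : R, x - y = t *: map_mx ratr v.

Definition rational_edges (P : set 'rV[R]_n) :=
  forall E, is_edge P E -> rational_direction E.

Definition edges_at (P : set 'rV[R]_n) (v : 'rV[R]_n) : set (set 'rV[R]_n) :=
  [set E | is_edge P E /\ E v].

Definition primitive (u : 'rV[int]_n) := \big[gcdz/0]_i u 0 i = 1.

Definition primitive_edge_vectors (P : set 'rV[R]_n) (v : 'rV[R]_n) :
    set 'rV[int]_n :=
  [set u | primitive u /\ exists E, edges_at P v E /\
             exists2 t : R, 0 < t & E (v + t *: map_mx intr u)].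

(* b enumerates B, and is a Z-basis of Z^n *)
Definition Zbasis (B : set 'rV[int]_n) :=
  exists2 b : 'I_n -> 'rV[int]_n, range b = B &
    forall w, exists! c : 'rV[int]_n, w = \sum_i c 0 i *: b i.

Definition is_delzant (P : set 'rV[R]_n) :=
  [/\ is_polytope P, polytope_dim P n,
      forall v, is_vertex P v -> (edges_at P v #= `I_n)%card,
      rational_edges P &
      forall v, is_vertex P v -> Zbasis (primitive_edge_vectors P v)].

(* the polytopes other than single points *)
Definition polytopes : Type :=
  set_type [set P : set 'rV[R]_n | is_polytope P /\ ~ is_point P].
HB.instance Definition _ := SubChoice.on polytopes.

(* Polytopes carry the topology of pointwise convergence of support functions.
   It is used only on secondary cones, whose support functions lie in a
   finite-dimensional space, where it is the usual topology. *)
HB.instance Definition _ := Topological.copy polytopes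
  (initial_topology
     ((fun P => support_fun (\val P)) : polytopes -> {ptws 'cV[R]_n -> R})).

Definition homothetic (P Q : polytopes) : bool :=
  `[< exists2 c : R, 0 < c &
      exists v, \val Q = [set c *: x + v | x in \val P] >].

Lemma homothetic_refl : reflexive homothetic.
Proof.
move=> P; apply/asboolP; exists 1 => //; exists 0; apply/seteqP.
by split=> x /= => [Px|[y Py <-]]; [exists x|]; rewrite ?scale1r ?addr0.
Qed.

Lemma homothetic_sym : symmetric homothetic.
Proof.
suff h P Q : homothetic P Q -> homothetic Q P.
  by move=> P Q; apply/idP/idP; exact: h.
move=> /asboolP[c c0 [v QE]]; apply/asboolP; exists c^-1; rewrite ?invr_gt0//.
exists (- (c^-1 *: v)).
rewrite QE; apply/seteqP; split=> x /=.
  move=> Px; exists (c *: x + v); first by exists x.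
  by rewrite scalerDr addrK scalerA mulVf ?gt_eqF// scale1r.
move=> [_ [y Py <-] <-].
by rewrite scalerDr addrK scalerA mulVf ?gt_eqF// scale1r.
Qed.

Lemma homothetic_trans : transitive homothetic.
Proof.
move=> Q P T /asboolP[c c0 [v QE]] /asboolP[d d0 [w TE]].
apply/asboolP; exists (d * c); rewrite ?mulr_gt0//; exists (d *: v + w).
rewrite TE QE; apply/seteqP; split=> x /=.
  by move=> [_ [y Py <-] <-]; exists y; rewrite // scalerDr scalerA addrA.
move=> [y Py <-]; exists (c *: y + v); first by exists y.
by rewrite scalerDr scalerA addrA.
Qed.

Canonical homothetic_equiv := EquivRel homothetic
  homothetic_refl homothetic_sym homothetic_trans.

(* polytopes up to translation and positive scaling *)
Definition Ptilde : Type := {eq_quot homothetic_equiv}.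
HB.instance Definition _ := Choice.on Ptilde.

Definition homothety_class (P : polytopes) : Ptilde := \pi_{eq_quot homothetic_equiv} P.

(* single points in A are discarded *)
Definition homothety_image (A : set (set 'rV[R]_n)) : set Ptilde :=
  homothety_class @` [set P | A (\val P)].

Definition cell_fans : set fan :=
  [set N | polytopal N /\ N <> [set setT]].

Definition closed_cell (N : fan) : set Ptilde :=
  homothety_image (secondary_cone N).

Definition open_cell (N : fan) : set Ptilde :=
  homothety_image [set P | is_polytope P /\ normal_fan P = N].

Definition punctured_cone (N : fan) : set polytopes :=
  [set P | secondary_cone N (\val P)].

(* C is a closed subset of the closed cell of N, for the quotient topology of
   the subspace topology of the punctured secondary cone *)
Definition closed_in_cell (N : fan) (C : set Ptilde) :=
  C `<=` closed_cell N /\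
  closed (homothety_class @^-1` C : set (subspace (punctured_cone N))).

Lemma closed_in_cellI N C :
  closed_in_cell N (C `&` closed_cell N) <->
  closed (homothety_class @^-1` C : set (subspace (punctured_cone N))).
Proof.
have sub : punctured_cone N `<=` homothety_class @^-1` closed_cell N.
  by move=> P NP; exists P.
have E : homothety_class @^-1` (C `&` closed_cell N) `&` punctured_cone N =
         homothety_class @^-1` C `&` punctured_cone N.
  by rewrite preimage_setI -setIA (setIidr sub).
split=> [[_ /closed_subspaceP[V cV VE]]|/closed_subspaceP[V cV VE]].
  by apply/closed_subspaceP; exists V; rewrite // VE.
split; first by move=> x [].
by apply/closed_subspaceP; exists V; rewrite // VE.
Qed.

(* A set is closed iff its intersection with each closed cell is closed in that
   cell; see CW_closedE. *)
Definition CW_open (U : set Ptilde) :=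
  forall N, cell_fans N -> closed_in_cell N (~` U `&` closed_cell N).

Lemma CW_openE U : CW_open U <-> forall N, cell_fans N ->
  open (homothety_class @^-1` U : set (subspace (punctured_cone N))).
Proof.
split=> oU N /oU; rewrite closed_in_cellI preimage_setC.
  by move/closed_openC; rewrite setCK.
exact: open_closedC.
Qed.

Lemma CW_openT : CW_open setT.
Proof. by apply/CW_openE => N _; exact: openT. Qed.

Lemma CW_openI : setI_closed CW_open.
Proof.
move=> A B /CW_openE oA /CW_openE oB; apply/CW_openE => N fN.
by rewrite preimage_setI; apply: openI; [exact: oA|exact: oB].
Qed.

Lemma CW_open_bigU (I : Type) (f : I -> set Ptilde) :
  (forall i, CW_open (f i)) -> CW_open (\bigcup_i f i).
Proof.
move=> of_; apply/CW_openE => N fN; rewrite preimage_bigcup.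
by apply: bigcup_open => i _; move/CW_openE: (of_ i); exact.
Qed.

HB.instance Definition _ := isOpenTopological.Build Ptilde
  CW_openT CW_openI CW_open_bigU.

Lemma CW_closedE (C : set Ptilde) : closed C <->
  forall N, cell_fans N -> closed_in_cell N (C `&` closed_cell N).
Proof.
rewrite -openC; have -> : open (~` C) = CW_open (~` C) by [].
by rewrite /CW_open setCK.
Qed.

End Polytopes.

(* Main.v *)
From mathcomp Require Import ring lra.
Require Import Defs.

Set Implicit Arguments.
Unset Strict Implicit.
Unset Printing Implicit Defensive.

Import Order.TTheory GRing.Theory Num.Theory.
Import numFieldNormedType.Exports.

Local Open Scope classical_set_scope.
Local Open Scope ring_scope.

(** Two polytopes are compared through the preorder [fle P] on directions: [a] is
    below [b] when every point of [P] maximizing [a] also maximizes [b].  The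
    normal cones of [P] are its principal up-sets, so refinement of normal fans
    is inclusion of preorders.  It is also inclusion of additivity relations:
    the support function [h] of [P] satisfies [h (a + b) = h a + h b] exactly
    when [a] and [b] lie in a common normal cone ([fleP], [additive_fle],
    [refinesP]).  Everything about the fan of [P] is thus encoded in the pairs
    where the defect [h a + h b - h (a + b) >= 0] vanishes.

    A secondary cone consists of the functions linear on the maximal cones of
    the fan with nonnegative defects.  By Weyl's theorem ([weyl]) finitely many
    defects suffice ([secondary_cone_inequalities]), and strictness of the
    inequalities that are strict for one polytope with the given fan forces the
    fan to be the same ([secondary_cone_interior]).

    Each homothety class has a unique representative whose bounding box has the
    origin as lowest corner and sides of total length 1.  The support function
    of this representative depends continuously on the polytope, so the
    quotient, with the CW topology, is Hausdorff ([Ptilde_hausdorff]).  The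
    normalized members of a secondary cone form a compact polyhedral body of
    dimension [m] when the cone has dimension [m + n + 1], with boundary the
    polytopes of strictly coarser fan ([cell_chart]).  Rescaling rays turns the
    body into a disk, and the resulting continuous injection from a compact
    space to a Hausdorff space is the characteristic map
    ([compact_homeo_on], [characteristic_map]).  Closure finiteness holds since
    a fan has finitely many coarsenings ([finite_normal_fans]); a proper one has
    a secondary cone of smaller dimension, because some defect vanishes
    identically on it ([span_dim_coarsening]).

    A coarser normal fan has no new edge directions ([edge_refines]), so the
    rational polytopes form a subcomplex.  If two directions have no common
    maximizer on [P], their values at some edge direction of [P] have opposite
    signs ([separating_edge]); hence a finite set containing the edge directions
    of [P] leaves only finitely many possibilities for its normal fan, and there
    are countably many rational cells.  Being Delzant only depends on the normal
    fan ([delzant_same_fan]).  The cube is Delzant and its closed cell contains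
    a polytope that is not: a segment when [n >= 2]. *)

(** * Pairing and small parameters *)

Section Pairing.
Variables (R : realType) (n : nat).
Implicit Types (a b : 'cV[R]_n) (x y : 'rV[R]_n) (t : R).

Lemma pairingDl a b x : pairing (a + b) x = pairing a x + pairing b x.
Proof. by rewrite /pairing mulmxDr mxE. Qed.

Lemma pairingDr a x y : pairing a (x + y) = pairing a x + pairing a y.
Proof. by rewrite /pairing mulmxDl mxE. Qed.

Lemma pairingZl t a x : pairing (t *: a) x = t * pairing a x.
Proof. by rewrite /pairing -scalemxAr mxE. Qed.

Lemma pairingZr t a x : pairing a (t *: x) = t * pairing a x.
Proof. by rewrite /pairing -scalemxAl mxE. Qed.

Lemma pairingNl a x : pairing (- a) x = - pairing a x.
Proof. by rewrite -scaleN1r pairingZl mulN1r. Qed.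

Lemma pairingNr a x : pairing a (- x) = - pairing a x.
Proof. by rewrite -scaleN1r pairingZr mulN1r. Qed.

Lemma pairingBl a b x : pairing (a - b) x = pairing a x - pairing b x.
Proof. by rewrite pairingDl pairingNl. Qed.

Lemma pairingBr a x y : pairing a (x - y) = pairing a x - pairing a y.
Proof. by rewrite pairingDr pairingNr. Qed.

Lemma pairing0l x : pairing 0 x = 0.
Proof. by rewrite /pairing mulmx0 mxE. Qed.

Lemma pairing0r a : pairing a 0 = 0.
Proof. by rewrite /pairing mul0mx mxE. Qed.

Definition pairingE :=
  (pairingBl, pairingBr, pairingDl, pairingDr, pairingZl, pairingZr,
   pairingNl, pairingNr, pairing0l, pairing0r).

Lemma pairing_sum a x : pairing a x = \sum_i x 0 i * a i 0.
Proof. by rewrite /pairing mxE. Qed.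

Definition coordv (i : 'I_n) : 'cV[R]_n := delta_mx i 0.

Lemma pairing_coordv i x : pairing (coordv i) x = x 0 i.
Proof.
rewrite pairing_sum (bigD1 i)//= mxE !eqxx mulr1 big1 ?addr0// => j ji.
by rewrite mxE (negbTE ji) mulr0.
Qed.

Lemma pairing_inj x y : (forall a, pairing a x = pairing a y) -> x = y.
Proof.
by move=> xy; apply/rowP => i; rewrite -2!pairing_coordv.
Qed.

Lemma pairing_trmx x : pairing x^T x = 0 -> x = 0.
Proof.
rewrite pairing_sum => /eqP; rewrite psumr_eq0; last first.
  by move=> i _; rewrite mxE -expr2 sqr_ge0.
move/allP => x0; apply/rowP => i; rewrite mxE.
by have := x0 i; rewrite mem_index_enum mxE mulf_eq0 orbb => /(_ isT)/eqP.
Qed.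

(** Only the functionals [u_i e_j - u_j e_i], for one [i] with [u_i != 0], are
    needed. *)
Lemma pairing_perp u x :
  (forall a, pairing a u = 0 -> pairing a x = 0) -> exists t, x = t *: u.
Proof.
have [->|u0] := eqVneq u 0.
  move=> h; exists 0; rewrite scaler0; apply: pairing_inj => a.
  by rewrite pairing0r h ?pairing0r.
move=> h; have [i ui] : exists i, u 0 i != 0.
  by apply/existsP; apply: contra_neqT u0; rewrite negb_exists => /forallP e;
    apply/rowP => i; rewrite mxE; apply/eqP; have := e i; rewrite negbK.
exists (x 0 i / u 0 i); apply/rowP => j; rewrite mxE.
have := h (u 0 i *: coordv j - u 0 j *: coordv i).
rewrite !pairingE !pairing_coordv mulrC subrr => /(_ erefl)/eqP.
by rewrite subr_eq0 => /eqP e; apply: (mulfI ui); rewrite e; field.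
Qed.

End Pairing.

(** Perturbation arguments only involve finitely many strict inequalities that
    are affine in the parameter; they are collected with the filter [0^'+]. *)
Section Small.
Variable R : realType.
Implicit Types t x y : R.

Lemma near_all (T : eqType) (s : seq T) (Q : T -> R -> Prop)
    (F : set_system R) : Filter F ->
  (forall z, z \in s -> \forall t \near F, Q z t) ->
  \forall t \near F, forall z, z \in s -> Q z t.
Proof.
move=> FF; elim: s => [|z s IH] h; first by near=> t.
have h1 := h z (mem_head _ _).
have h2 : \forall t \near F, forall w, w \in s -> Q w t.
  by apply: IH => w ws; apply: h; rewrite inE ws orbT.
near=> t => w; rewrite inE => /predU1P[->|]; first by near: t.
by move: w; near: t.
Unshelve. all: by end_near. Qed.

Lemma near_pos x y : 0 < x -> \forall t \near 0^'+, 0 < x + t * y.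
Proof.
move=> x0; near=> t.
have t0 : 0 < t by near: t; exact: nbhs_right_gt.
have y1 : 0 < `|y| + 1 by have := normr_ge0 y; lra.
have : t < x / (`|y| + 1).
  by near: t; apply: nbhs_right_lt; rewrite divr_gt0.
rewrite ltr_pdivlMr// => tx.
have := ler_norm (- y); rewrite normrN => ny.
have : t * - y <= t * `|y| by rewrite ler_pM2l.
by rewrite mulrDr mulr1 in tx; lra.
Unshelve. all: by end_near. Qed.

Lemma near_neq0 x y : (x != 0) || (y != 0) ->
  \forall t \near 0^'+, x + t * y != 0.
Proof.
have [x0 _|x0 _|->/= y0] := ltgtP x 0.
- near=> t; suff : 0 < - x + t * - y.
    by rewrite mulrN -opprD oppr_gt0 => /lt_eqF ->.
  by near: t; apply: near_pos; rewrite oppr_gt0.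
- by near=> t; rewrite gt_eqF//; near: t; exact: near_pos.
- by near=> t; rewrite add0r mulf_neq0// gt_eqF.
Unshelve. all: by end_near. Qed.

Lemma near_gt0 : \forall t \near 0^'+, 0 < t :> R.
Proof. exact: nbhs_right_gt. Qed.

Lemma near_exists (Q : R -> Prop) : (\forall t \near 0^'+, Q t) ->
  exists2 t : R, 0 < t & Q t.
Proof.
move=> nQ; have : \forall t \near 0^'+, 0 < t /\ Q t.
  by near=> t; split; near: t => //; exact: near_gt0.
by move=> /filter_ex[t [t0 Qt]]; exists t.
Unshelve. all: by end_near. Qed.

End Small.

(** * Weyl's theorem *)

Section Weyl.
Variable R : realType.

(** The convex cone generated by a list, in the recursive form used by
    Fourier-Motzkin elimination. *)
Fixpoint in_cone n (s : seq 'rV[R]_n) (y : 'rV[R]_n) : Prop :=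
  if s is x :: s' then exists2 t, 0 <= t & in_cone s' (y - t *: x) else y = 0.

Lemma in_cone_ge0 n (s : seq 'rV[R]_n) (a : 'cV[R]_n) y :
  (forall x, x \in s -> 0 <= pairing a x) -> in_cone s y -> 0 <= pairing a y.
Proof.
elim: s y => [|x s IH] y /= h; first by move->; rewrite pairing0r.
move=> [t t0 /IH]; rewrite !pairingE => /(_ _)/wrap[].
  by move=> z zs; apply: h; rewrite inE zs orbT.
have := mulr_ge0 t0 (h x (mem_head _ _)); lra.
Qed.

(** Fourier-Motzkin elimination: when the generator [x] is added, the inequality
    [g] survives if it holds at [x], and every pair of inequalities of opposite
    signs at [x] yields the combination that vanishes at [x]. *)
Lemma weyl n (s : seq 'rV[R]_n) : exists G : seq 'cV[R]_n,
  (forall g x, g \in G -> x \in s -> 0 <= pairing g x) /\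
  (forall y, (forall g, g \in G -> 0 <= pairing g y) -> in_cone s y).
Proof.
elim: s => [|x s [G [G1 G2]]].
  exists ([seq coordv R i | i <- enum 'I_n] ++
          [seq - coordv R i | i <- enum 'I_n]); split=> // y h.
  apply/rowP => i; rewrite mxE; apply/eqP; rewrite eq_le.
  have := h (coordv R i); rewrite mem_cat map_f ?mem_enum// => /(_ isT).
  rewrite pairing_coordv => ->; rewrite andbT.
  have := h (- coordv R i); rewrite mem_cat orbC.
  by rewrite (map_f (fun i => - coordv R i)) ?mem_enum// pairingNl
    pairing_coordv oppr_ge0 => ->.
pose cmb g g' := pairing g x *: g' - pairing g' x *: g.
pose Gp := [seq g <- G | 0 < pairing g x].
pose Gn := [seq g <- G | pairing g x < 0].
exists ([seq g <- G | 0 <= pairing g x] ++ [seq cmb g g' | g <- Gp, g' <- Gn]).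
split=> [g z|y h].
  rewrite mem_cat => /orP[|/allpairsP[[g1 g2]/=[]]].
    rewrite mem_filter => /andP[gx gG]; rewrite inE => /predU1P[->//|zs].
    exact: G1.
  rewrite !mem_filter => /andP[g1x g1G] /andP[g2x g2G] ->.
  rewrite inE /cmb !pairingE => /predU1P[->|zs]; first by rewrite mulrC subrr.
  have z1 := G1 _ _ g1G zs; have z2 := G1 _ _ g2G zs.
  by rewrite -mulNr addr_ge0// mulr_ge0// ?oppr_ge0 ltW.
(* [t] is the least coefficient of [x] allowed by the inequalities of [Gn];
   those of [Gp] bound it from above, compatibly thanks to the combinations *)
pose t := \big[Num.max/0]_(g <- Gn) (pairing g y / pairing g x).
have tge g : g \in Gn -> pairing g y / pairing g x <= t.
  move=> gG; rewrite /t.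
  exact: (le_bigmax_seq 0 g xpredT (fun g => pairing g y / pairing g x) gG).
have t0 : 0 <= t by rewrite /t; exact: bigmax_ge_id.
exists t => //; apply: G2 => g gG; rewrite !pairingE subr_ge0.
have [gx0|gx0|gx0] := ltgtP (pairing g x) 0; last first.
- by rewrite gx0 mulr0; apply: h; rewrite mem_cat mem_filter gx0 lexx gG.
- rewrite -ler_pdivlMr// /t big_seq; elim/big_ind: _.
  + rewrite divr_ge0 ?(ltW gx0)//; apply: h.
    by rewrite mem_cat mem_filter (ltW gx0) gG.
  + by move=> u v; rewrite ge_max => -> ->.
  move=> g' g'n; have := g'n; rewrite mem_filter => /andP[g'x g'G].
  have : 0 <= pairing (cmb g g') y.
    apply: h; rewrite mem_cat; apply/orP; right; apply/allpairsP.
    by exists (g, g'); rewrite /= mem_filter gx0 gG.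
  rewrite !pairingE subr_ge0 ler_pdivlMr// mulrAC ler_ndivrMr//.
  by rewrite [pairing g y * _]mulrC [pairing g' y * _]mulrC.
- rewrite -ler_ndivrMr//; apply: tge.
  by rewrite mem_filter gx0.
Qed.
End Weyl.

(** * Support functions and faces of polytopes *)

Lemma seq_argmax (R : realDomainType) (T : eqType) (r : seq T) (f : T -> R) :
  r != [::] ->
  exists2 x, x \in r & forall y : T, y \in r -> f y <= f x.
Proof.
elim: r => // x [|z r] IH _.
  by exists x; rewrite ?inE// => y; rewrite inE => /eqP ->.
have [//|y yr ymax] := IH.
have [xy|yx] := leP (f x) (f y).
  exists y; first by rewrite in_cons yr orbT.
  by move=> w; rewrite in_cons => /predU1P[->|/ymax].
exists x; first exact: mem_head.
move=> w; rewrite in_cons => /predU1P[->//|/ymax wy].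
exact: le_trans wy (ltW yx).
Qed.

Section Support.
Variables (R : realType) (n : nat).
Implicit Types (a b c : 'cV[R]_n) (x y p q : 'rV[R]_n) (t : R).
Implicit Types (P Q : set 'rV[R]_n) (s : seq 'rV[R]_n).

Lemma convex_setE (A : set 'rV[R]_n) : convex_set A <->
  forall x y t, A x -> A y -> 0 <= t -> t <= 1 -> A (t *: x + (1 - t) *: y).
Proof.
split=> [cA x y t Ax Ay t0 t1|cA x y l].
  have := cA x y (Itv01 t0 t1); rewrite !inE; exact.
by rewrite !inE => Ax Ay; apply: cA.
Qed.

Lemma convex_hull_le s a t : (forall x, x \in s -> pairing a x <= t) ->
  forall p, convex_hull [set` s] p -> pairing a p <= t.
Proof.
move=> sat; apply: smallest_sub; last by [].
apply/convex_setE => x y u /= xt yt u0 u1; rewrite !pairingE.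
have := ler_wpM2l u0 xt; have := @ler_wpM2l _ (1 - u) _ _ _ yt.
by rewrite subr_ge0 => /(_ u1); lra.
Qed.

Lemma sub_convex_hull s x : x \in s -> convex_hull [set` s] x.
Proof. by move=> xs; apply: sub_gen_smallest. Qed.

Lemma polytopeP P : is_polytope P <->
  exists2 s, s != [::] & P = convex_hull [set` s].
Proof.
split=> [[S [/finite_seqP[s ->] [x xs] ->]]|[s s0 ->]].
  by exists s => //; case: s xs.
exists [set` s]; split=> //; case: s s0 => // x s _.
by exists x => /=; rewrite inE eqxx.
Qed.

(** The sets that [is_face] quantifies over, as a function of the direction. *)
Definition face P a : set 'rV[R]_n :=
  [set p | P p /\ forall q, P q -> pairing a q <= pairing a p].

Lemma hull_face s a : s != [::] ->
  exists2 x, x \in s & face (convex_hull [set` s]) a x.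
Proof.
move=> /(seq_argmax (pairing a))[x xs xmax]; exists x => //; split.
  exact: sub_convex_hull.
exact: convex_hull_le.
Qed.

Lemma face_neq0 P a : is_polytope P -> face P a !=set0.
Proof. by move=> /polytopeP[s s0 ->]; have [x _ ?] := hull_face a s0;
  exists x. Qed.

Lemma polytope_neq0 P : is_polytope P -> P !=set0.
Proof. by move=> /(face_neq0 0)[x [Px _]]; exists x. Qed.

Lemma support_faceE P a p : face P a p -> support_fun P a = pairing a p.
Proof.
move=> [Pp pmax]; apply/eqP; rewrite eq_le; apply/andP; split.
  by apply: ge_sup => [|_ [q Pq <-]]; [exists (pairing a p), p|exact: pmax].
apply: ub_le_sup; last by exists p.
by exists (pairing a p) => _ [q Pq <-]; exact: pmax.
Qed.

Lemma support_ge P a q : is_polytope P -> P q -> pairing a q <= support_fun P a.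
Proof.
by move=> /(face_neq0 a)[p pP] Pq; rewrite (support_faceE pP); apply: pP.2.
Qed.

Lemma faceP P a p : is_polytope P ->
  face P a p <-> P p /\ pairing a p = support_fun P a.
Proof.
move=> PP; split=> [pa|[Pp pa]]; first by rewrite (support_faceE pa); case: pa.
by split=> // q Pq; rewrite pa; exact: support_ge.
Qed.

Lemma support_le P a t : is_polytope P ->
  (forall q, P q -> pairing a q <= t) -> support_fun P a <= t.
Proof.
by move=> /(face_neq0 a)[p pP] h; rewrite (support_faceE pP) h//; case: pP.
Qed.

(** Homogenization: at a positive height [t], the slice of the cone over
    [{1} x s] is [t] times the hull of [s].  The set [A] stands for an arbitrary
    convex set containing [s], since the hull is the intersection of those. *)
Lemma in_cone_hull s (A : set 'rV[R]_n) : convex_set A -> [set` s] `<=` A ->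
  forall t y,
    in_cone [seq row_mx (1%:M : 'rV_1) x | x <- s] (row_mx (t%:M) y) ->
    0 <= t /\ (t = 0 -> y = 0) /\ (0 < t -> A (t^-1 *: y)).
Proof.
move=> cA; elim: s => [|x s IH] sA t y /=.
  rewrite -[0]row_mx0 => /eq_row_mx[/matrixP/(_ 0 0)]; rewrite !mxE eqxx mulr1n.
  by move=> -> ->; rewrite lexx ltxx.
have sA' : [set` s] `<=` A.
  by move=> z zs; apply: sA; rewrite /= inE; apply/orP; right.
have Ax : A x by apply: sA; rewrite /= inE eqxx.
move=> [u u0]; rewrite scale_row_mx opp_row_mx add_row_mx.
rewrite scale_scalar_mx mulr1 -raddfB => /(IH sA')[tu0 [tu0E tu1]].
split; first by lra.
split=> [t0|t0].
  have uE : u = 0 by lra.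
  by have := tu0E; rewrite uE scale0r !subr0; exact.
have [tu|ut] := eqVneq t u.
  move: tu0E; rewrite tu subrr => /(_ erefl)/subr0_eq ->.
  by rewrite scalerA mulVf ?scale1r// -tu gt_eqF.
have tu' : 0 < t - u by rewrite lt_neqAle tu0 eq_sym subr_eq0 ut.
have -> : t^-1 *: y =
    (u / t) *: x + (1 - u / t) *: ((t - u)^-1 *: (y - u *: x)).
  have -> : 1 - u / t = (t - u) / t by field; rewrite gt_eqF.
  rewrite scalerA mulrAC mulfV ?gt_eqF// mul1r scalerBr scalerA.
  by rewrite [_^-1 * _]mulrC addrC subrK.
move/convex_setE: cA; apply=> //; first exact: tu1.
  by rewrite divr_ge0// ltW.
by rewrite ler_pdivrMr// mul1r; lra.
Qed.

(** Each of the finitely many inequalities of the cone over [{1} x P] given by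
    Weyl's theorem is a supporting half-space of [P], so the supporting
    half-spaces cut out [P].  Hence a polytope is determined by its support
    function. *)
Lemma polytope_sep P x : is_polytope P ->
  (forall a, pairing a x <= support_fun P a) -> P x.
Proof.
move=> PP; have /polytopeP[s s0 PE] := PP; move=> h.
have [G [G1 G2]] := weyl [seq row_mx (1%:M : 'rV_1) x | x <- s].
have gE (g : 'cV[R]_(1 + n)) t z : pairing g (row_mx (t%:M) z) =
    t * usubmx g 0 0 + pairing (dsubmx g) z.
  rewrite -{1}[g]vsubmxK /pairing mul_row_col mxE; congr (_ + _).
  by rewrite mxE big_ord1 mxE eqxx mulr1n.
have : in_cone [seq row_mx (1%:M : 'rV_1) x | x <- s] (row_mx (1%:M) x).
  apply: G2 => g gG; rewrite gE mul1r.
  suff : support_fun P (- dsubmx g) <= usubmx g 0 0.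
    by have := h (- dsubmx g); rewrite pairingE; lra.
  apply: support_le => // q; rewrite PE; apply: convex_hull_le => z zs.
  have := G1 g (row_mx (1%:M : 'rV_1) z) gG.
  by rewrite map_f// gE pairingE => /(_ isT); lra.
move=> xs; rewrite PE => A [cA sA].
have [_ [_ /(_ ltr01)]] := in_cone_hull cA sA xs.
by rewrite invr1 scale1r.
Qed.

Lemma support_inj P Q : is_polytope P -> is_polytope Q ->
  support_fun P = support_fun Q -> P = Q.
Proof.
move=> PP QP PQ; apply/seteqP; split=> x xP; apply: polytope_sep => // a.
  by rewrite -PQ; exact: support_ge.
by rewrite PQ; exact: support_ge.
Qed.

Section SupportTheory.
Variables (P : set 'rV[R]_n) (PP : is_polytope P).
Local Notation h := (support_fun P).

Lemma support_leD a b : h (a + b) <= h a + h b.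
Proof.
apply: support_le => // q Pq; rewrite pairingE; apply: lerD; exact: support_ge.
Qed.

Lemma supportZ t a : 0 <= t -> h (t *: a) = t * h a.
Proof.
move=> t0; have [p [Pp pmax]] := face_neq0 a PP.
rewrite (@support_faceE P a p)//; rewrite -pairingZl; apply: support_faceE.
by split=> // q /pmax; rewrite !pairingZl; exact: ler_wpM2l.
Qed.

Lemma support0 : h 0 = 0.
Proof. by rewrite -(scale0r 0) supportZ// mul0r. Qed.

Lemma supportD_faceP a b :
  h (a + b) = h a + h b <-> exists p, face P a p /\ face P b p.
Proof.
split=> [hab|[p [pa pb]]].
  have [p /faceP[//|Pp]] := face_neq0 (a + b) PP; rewrite hab pairingE => e.
  have pa := support_ge a PP Pp; have pb := support_ge b PP Pp.
  by exists p; split; apply/faceP => //; split=> //; lra.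
rewrite (support_faceE pa) (support_faceE pb) -pairingDl.
apply: support_faceE; split=> [|q Pq]; first by case: pa.
by rewrite !pairingE; apply: lerD; [apply: pa.2|apply: pb.2].
Qed.

End SupportTheory.

(** * Face order and normal fans *)

(** The normal cone of [face P a] is the principal up-set of [a] for this
    preorder on directions, so statements on normal fans become statements on
    preorders. *)
Definition fle P a b := face P a `<=` face P b.

Lemma fle_refl P a : fle P a a. Proof. by []. Qed.

Lemma fle_trans P b a c : fle P a b -> fle P b c -> fle P a c.
Proof. exact: subset_trans. Qed.

Lemma fle0 P a : fle P a 0.
Proof. by move=> x [Px _]; split=> // q; rewrite !pairing0l. Qed.

Lemma normal_coneE P a : is_polytope P ->
  normal_cone P (face P a) = [set b | fle P a b].
Proof.
move=> PP; apply/seteqP; split=> b /=.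
  move=> h p pa; split=> [|q Pq]; first by case: pa.
  by have := h p q pa Pq; rewrite pairingE subr_ge0.
by move=> ab p q /ab[_ pmax] /pmax; rewrite pairingE subr_ge0.
Qed.

Lemma normal_fanE P : is_polytope P ->
  normal_fan P = [set C | exists a, C = [set b | fle P a b]].
Proof.
move=> PP; apply/seteqP; split=> C.
  by move=> [_ [_ [a ->]] ->]; exists a; rewrite -normal_coneE.
move=> [a ->]; exists (face P a); rewrite ?normal_coneE//.
by split; [exact: face_neq0|exists a].
Qed.

(** A generator that does not maximize [a] stays strictly below a maximizer of
    [a] for small [e], so that the generator maximizing [a + e b] maximizes
    [a]. *)
Lemma near_common_generator P s a b : s != [::] -> P = convex_hull [set` s] ->
  \forall e \near 0^'+,
    exists2 p, p \in s & face P a p /\ face P (a + e *: b) p.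
Proof.
move=> s0 PE; have PP : is_polytope P by apply/polytopeP; exists s.
have : \forall e \near 0^'+, forall x, x \in s ->
    face P a x \/ pairing (a + e *: b) x < support_fun P (a + e *: b).
  apply: near_all => x xs; have Px : P x by rewrite PE; exact: sub_convex_hull.
  have [xa|xa] := pselect (face P a x); first by near=> e; left.
  have [p pa] := face_neq0 a PP.
  have xp : pairing a x < pairing a p.
    rewrite lt_neqAle (pa.2 _ Px) andbT; apply: contra_notN xa => /eqP xp.
    by split=> // q; rewrite xp; exact: pa.2.
  near=> e; right.
  apply: lt_le_trans (support_ge (a + e *: b) PP pa.1).
  rewrite -subr_gt0 -pairingBr pairingDl pairingZl.
  by near: e; apply: near_pos; rewrite pairingE subr_gt0.
apply: filterS => e h; have [x xs] := hull_face (a + e *: b) s0.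
rewrite -PE => xe; have [//|xa] := h _ xs; first by exists x.
by move: xa; rewrite (support_faceE xe) ltxx.
Unshelve. all: by end_near. Qed.

Lemma near_common_face P a b : is_polytope P ->
  \forall e \near 0^'+, exists p, face P a p /\ face P (a + e *: b) p.
Proof.
move=> /polytopeP[s s0 PE].
by apply: filterS (near_common_generator a b s0 PE) => e [p _ ?]; exists p.
Qed.

(** If [a] and [a + d b] have a common maximizer, then for [e < d] the direction
    [a + e b] is a positive combination of them and its maximizers maximize
    both. *)
Lemma near_fle P a b : is_polytope P ->
  \forall e \near 0^'+, fle P (a + e *: b) a.
Proof.
move=> PP; have /near_exists[d d0 [p [pa pd]]] := near_common_face a b PP.
near=> e; have e0 : 0 < e by near: e; exact: near_gt0.
have ed : e < d by near: e; exact: nbhs_right_lt.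
move=> q [Pq qmax]; split=> // r Pr.
have := qmax p pa.1; have := pd.2 q Pq; have := pa.2 q Pq; have := pa.2 r Pr.
rewrite !pairingE => h1 h2 h3 h4.
have {}h3 : e * (pairing a q + d * pairing b q) <=
  e * (pairing a p + d * pairing b p) by rewrite ler_pM2l.
have {}h4 : d * (pairing a p + e * pairing b p) <=
  d * (pairing a q + e * pairing b q) by rewrite ler_pM2l.
suff : (d - e) * pairing a p <= (d - e) * pairing a q.
  by rewrite ler_pM2l ?subr_gt0// => h5; exact: le_trans h1 h5.
by lra.
Unshelve. all: by end_near. Qed.

(** When [F] is a face, the functionals constant on [F] form the annihilator of
    its direction space, that is, the span of its normal cone. *)
Definition const_on (F : set 'rV[R]_n) c :=
  forall x y, F x -> F y -> pairing c x = pairing c y.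

Lemma const_onN F c : const_on F c -> const_on F (- c).
Proof. by move=> h x y xF yF; rewrite !pairingNl (h x y). Qed.

Lemma near_fle_const P a c : is_polytope P -> const_on (face P a) c ->
  \forall e \near 0^'+, fle P a (a + e *: c).
Proof.
move=> PP ac; apply: filterS (near_common_face a c PP) => e [x [xa xe]] p pa.
split=> [|q Pq]; first by case: pa.
apply: le_trans (xe.2 q Pq) _; rewrite !pairingE (ac _ _ pa xa) lerD2r.
by apply: pa.2; case: xa.
Qed.

Lemma fle_const P a b : fle P a b -> const_on (face P a) b.
Proof.
move=> ab x y /ab[Px xm] /ab[Py ym]; apply/eqP; rewrite eq_le.
by rewrite xm// ym.
Qed.

(** The right-hand side only involves the preorder: the direction space of a
    face is determined by the normal fan. *)
Lemma const_faceP P a c : is_polytope P ->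
  const_on (face P a) c <->
  exists2 e, 0 < e & fle P a (a + e *: c) /\ fle P a (a - e *: c).
Proof.
move=> PP; split=> [ac|[e e0 [h1 h2]] x y xa ya].
  apply: near_exists; near=> e; split; first by near: e; exact: near_fle_const.
  rewrite -scalerN; near: e; apply: near_fle_const => //; exact: const_onN.
have /(_ _ _ xa ya) := fle_const h1; have /(_ _ _ xa ya) := fle_const h2.
rewrite !pairingE => h3 h4; apply: (mulfI (lt0r_neq0 e0)); lra.
Unshelve. all: by end_near. Qed.

(** In the direction from left to right, [a - e b] still lies in the relative
    interior of the normal cone of [face P a] for small [e]; conversely, a common
    maximizer of [a - e b] and [b] forces all maximizers of [a] to be common
    ones.  Thus the preorder can be read off from the additivity of the support
    function. *)
Lemma fleP P a b : is_polytope P -> fle P a b <->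
  exists2 e, 0 < e &
    support_fun P a = support_fun P (a - e *: b) + e * support_fun P b.
Proof.
move=> PP; split=> [ab|[e e0]].
  have /near_exists[e e0 ae] := near_fle_const PP (const_onN (fle_const ab)).
  exists e => //; rewrite -supportZ ?ltW//.
  rewrite -[in LHS](subrK (e *: b) a); apply/supportD_faceP => //.
  have [p pa] := face_neq0 a PP; exists p; split.
    by rewrite -scalerN; exact: ae.
  have [Pp pm] := ab _ pa; split=> // q Pq.
  by rewrite !pairingZl ler_pM2l// pm.
rewrite -supportZ ?ltW// -[in X in X = _](subrK (e *: b) a).
move=> /supportD_faceP[//|p [p1 p2]] q qa; split=> [|r Pr]; first by case: qa.
have := qa.2 p p1.1; have := p1.2 q qa.1; have := p2.2 r Pr.
have := p2.2 q qa.1; rewrite !pairingE !ler_pM2l// => h1 h2 h3 h4.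
suff : pairing b q = pairing b p by move=> ->.
by apply: (mulfI (lt0r_neq0 e0)); have := h1; rewrite -(ler_pM2l e0); lra.
Qed.

Definition additive_at P a b :=
  support_fun P (a + b) = support_fun P a + support_fun P b.

(** The support function is additive at [(a, b)] exactly when [a] and [b] lie in
    a common cone of the normal fan. *)
Lemma additive_fle P Q : is_polytope P -> is_polytope Q ->
  (forall a b, additive_at P a b -> additive_at Q a b) <->
  (forall a b, fle P a b -> fle Q a b).
Proof.
move=> PP QP; split=> h a b.
  move=> /(fleP a b PP)[e e0 ab]; apply/fleP => //; exists e => //.
  have := h (a - e *: b) (e *: b).
  by rewrite /additive_at subrK !supportZ ?ltW//; apply.
move=> /supportD_faceP[//|p [pa pb]]; apply/supportD_faceP => //.
have sub q : face P (a + b) q -> face P a q /\ face P b q.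
  move=> [Pq qm]; have := qm p pa.1; have := pa.2 q Pq; have := pb.2 q Pq.
  rewrite !pairingE => h1 h2 h3; split; split=> // r Pr.
    by have := pa.2 r Pr; lra.
  by have := pb.2 r Pr; lra.
have [q qab] := face_neq0 (a + b) QP.
by exists q; split; move: qab; apply: h => r /sub[].
Qed.

(** A cone of [Q] containing [fle P a] contains [a - e b] and [b] for every [b]
    above [a], which gives additivity for [Q]. *)
Lemma refinesP P Q : is_polytope P -> is_polytope Q ->
  refines (normal_fan P) (normal_fan Q) <->
  (forall a b, fle P a b -> fle Q a b).
Proof.
move=> PP QP; rewrite !normal_fanE//; split=> h; last first.
  by move=> C [a ->]; exists [set b | fle Q a b]; [exists a|exact: h].
move=> a b ab; have [_ [a2 ->] sub] := h _ (ex_intro _ a erefl).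
have /near_exists[e e0 ae] := near_fle_const PP (const_onN (fle_const ab)).
apply/fleP => //; exists e => //; rewrite -supportZ ?ltW//.
rewrite -[in LHS](subrK (e *: b) a); apply/supportD_faceP => //.
have [p pa2] := face_neq0 a2 QP; exists p; split.
  by rewrite -scalerN; apply: sub pa2.
have [Pp pm] : face Q b p by apply: sub pa2.
by split=> // q Pq; rewrite !pairingZl ler_pM2l// pm.
Qed.

Lemma normal_fan_eqP P Q : is_polytope P -> is_polytope Q ->
  normal_fan P = normal_fan Q <-> (forall a b, fle P a b <-> fle Q a b).
Proof.
move=> PP QP; split=> [PQ a b|h].
  have r : refines (normal_fan Q) (normal_fan Q) by move=> C CN; exists C.
  by split; move: a b; apply/refinesP; rewrite ?PQ.
by rewrite !normal_fanE//; apply/seteqP; split=> C [a ->]; exists a;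
  apply/seteqP; split=> b /= /h.
Qed.

End Support.

(** * Normal fans are complete fans *)

Section CompleteFan.
Variables (R : realType) (n : nat).
Implicit Types (a b c d : 'cV[R]_n) (x y p q u : 'rV[R]_n) (t : R).
Implicit Types (P Q : set 'rV[R]_n).

Lemma pairing_sumr a (I : Type) (r : seq I) (D : pred I) (f : I -> 'rV[R]_n) :
  pairing a (\sum_(i <- r | D i) f i) = \sum_(i <- r | D i) pairing a (f i).
Proof.
by elim/big_rec2: _ => [|i x y _ <-]; rewrite ?pairing0r ?pairingDr.
Qed.

Section Generators.
Variables (P : set 'rV[R]_n) (s : seq 'rV[R]_n).
Hypotheses (s0 : s != [::]) (PE : P = convex_hull [set` s]).

Lemma generated_polytope : is_polytope P.
Proof. by apply/polytopeP; exists s. Qed.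
Let PP := generated_polytope.

Lemma generators_sub x : x \in s -> P x.
Proof. by rewrite PE; exact: sub_convex_hull. Qed.

(** By [near_common_generator] for [a - e b], some generator maximizing [a]
    maximizes [a - e b] too, so only the generators need to be compared. *)
Lemma fle_generators a b :
  (forall x, x \in s -> face P a x -> face P b x) -> fle P a b.
Proof.
move=> ab; have /near_exists[e e0 [x xs [xa xe]]] :=
  near_common_generator a (- b) s0 PE.
apply/fleP => //; exists e => //; rewrite -supportZ ?ltW//.
rewrite -[in LHS](subrK (e *: b) a); apply/supportD_faceP => //.
exists x; split; first by rewrite -scalerN.
have [Px xm] := ab _ xs xa.
by split=> // q Pq; rewrite !pairingZl ler_pM2l// xm.
Qed.

Lemma const_on_generators a c :
  (forall x y, x \in s -> y \in s -> face P a x -> face P a y ->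
    pairing c x = pairing c y) -> const_on (face P a) c.
Proof.
move=> ac; apply/const_faceP => //.
suff h d : (forall x y, x \in s -> y \in s -> face P a x -> face P a y ->
    pairing d x = pairing d y) -> \forall e \near 0^'+, fle P a (a + e *: d).
  apply: near_exists; near=> e; split; first by near: e; exact: h.
  rewrite -scalerN; near: e; apply: h => x y xs ys xa ya.
  by rewrite !pairingNl (ac x y).
move=> ad; apply: filterS (near_common_generator a d s0 PE).
move=> e [x xs [xa xe]]; apply: fle_generators => y ys ya.
split=> [|q Pq]; first by case: ya.
apply: le_trans (xe.2 q Pq) _; rewrite !pairingE (ad x y)// lerD2r.
by apply: ya.2; case: xa.
Unshelve. all: by end_near. Qed.

Definition generator_pattern a : {set 'I_(size s)} :=
  [set i : 'I_(size s) | `[< face P a (nth 0 s i) >]].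

Lemma generator_pattern_sub a b :
  generator_pattern a \subset generator_pattern b <-> fle P a b.
Proof.
split=> [/fintype.subsetP ab|ab].
  apply: fle_generators => x /(nthP 0)[i si <-] xa.
  by have := ab (Ordinal si); rewrite !inE; exact.
by apply/fintype.subsetP => i; rewrite !inE; exact: ab.
Qed.

Lemma generator_pattern_face a b :
  generator_pattern a = generator_pattern b -> face P a = face P b.
Proof.
by move=> ab; apply/seteqP; split; apply/generator_pattern_sub; rewrite ab.
Qed.

(** The hull of the generators lying in the face has the right support function:
    in the direction [d] it is at least the value at a common maximizer of [a]
    and [a + e d]. *)
Lemma face_polytope a : is_polytope (face P a).
Proof.
apply/polytopeP; pose r := [seq x <- s | `[< face P a x >]].
have [x0 x0s] := hull_face a s0; rewrite -PE => x0a.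
have rx x : x \in r -> face P a x.
  by rewrite mem_filter => /andP[/asboolP].
have r0 : r != [::].
  suff : x0 \in r by case: r {rx}.
  by rewrite mem_filter x0s andbT; apply/asboolP.
exists r => //; apply/seteqP; split=> [p pa|]; last first.
  apply: smallest_sub => //; apply/convex_setE => x y t [Px xm] [Py ym] t0 t1.
  split=> [|q Pq].
    rewrite PE => A [cA sA]; move/convex_setE: (cA); apply=> //.
      by move: Px; rewrite PE; apply.
    by move: Py; rewrite PE; apply.
  have := ler_wpM2l t0 (xm q Pq); have := @ler_wpM2l _ (1 - t) _ _ _ (ym q Pq).
  by rewrite subr_ge0 !pairingE => /(_ t1); lra.
apply: polytope_sep => [|d]; first by apply/polytopeP; exists r.
have /near_exists[e e0 [x xs [xa xe]]] := near_common_generator a d s0 PE.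
apply: (@le_trans _ _ (pairing d x)).
  have := xe.2 p pa.1; have := pa.2 x xa.1; have := xa.2 p pa.1.
  rewrite !pairingE => h1 h2 h3; rewrite -(ler_pM2l e0); lra.
apply: support_ge; first by apply/polytopeP; exists r.
by apply: sub_convex_hull; rewrite mem_filter xs andbT; apply/asboolP.
Qed.

End Generators.

Lemma polytope_generators P : is_polytope P -> 
  exists s : seq 'rV[R]_n, s != [::] /\ P = convex_hull [set` s].
Proof. by move=> /polytopeP[s s0 ->]; exists s. Qed.

Lemma is_polytope_face P a : is_polytope P -> is_polytope (face P a).
Proof. by move=> /polytope_generators[s [s0 PE]];
  exact: face_polytope PE a. Qed.

(** Such a fan is determined by the relation that its preorder induces on the
    finite type [T]. *)
Lemma finite_normal_fans (T : finType) (k : 'cV[R]_n -> T)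
    (A : set (set 'rV[R]_n)) :
  (forall P, A P -> is_polytope P /\
    forall a b, k a = k b -> face P a = face P b) ->
  finite_set (@normal_fan R n @` A).
Proof.
move=> Ak; pose F (r : {ffun T * T -> bool}) : fan R n :=
  [set C | exists a, C = [set b | r (k a, k b)]].
suff : @normal_fan R n @` A `<=` F @` setT.
  by move=> /sub_finite_set; apply; exact: finite_image.
move=> _ [P AP <-]; have [PP kP] := Ak _ AP.
pose r := [ffun st : T * T =>
  `[< exists a b, [/\ k a = st.1, k b = st.2 & fle P a b] >]].
have rE a : [set b | fle P a b] = [set b | r (k a, k b)].
  apply/seteqP; split=> b /=; rewrite ffunE.
    by move=> ab; apply/asboolP; exists a, b.
  move=> /asboolP[a' [b' [/= /kP aa' /kP bb']]].
  by rewrite /fle aa' bb'.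
exists r => //; rewrite normal_fanE//; apply/seteqP.
by split=> C [a ->]; exists a; rewrite rE.
Qed.

Lemma finite_normal_fan P : is_polytope P -> finite_set (normal_fan P).
Proof.
move=> PP; have [s [s0 PE]] := polytope_generators PP.
pose F f : set 'cV[R]_n :=
  [set b | exists2 a, generator_pattern P s a = f & fle P a b].
suff : normal_fan P `<=` F @` setT.
  by move=> /sub_finite_set; apply; exact: finite_image.
rewrite normal_fanE// => _ [a ->]; exists (generator_pattern P s a) => //.
apply/seteqP; split=> b /=; last by move=> ab; exists a.
move=> [c ca]; apply: fle_trans; apply/(generator_pattern_sub s0 PE).
by rewrite ca.
Qed.

Lemma finite_coarsenings P : is_polytope P ->
  finite_set (@normal_fan R n @`
    [set Q | is_polytope Q /\ refines (normal_fan P) (normal_fan Q)]).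
Proof.
move=> PP; have [s [s0 PE]] := polytope_generators PP.
apply: (@finite_normal_fans _ (generator_pattern P s)) => Q [QP].
move=> /(refinesP PP QP) PQ; split=> // a b ab; apply/seteqP.
by split; apply: PQ; apply/(generator_pattern_sub s0 PE); rewrite ab.
Qed.

Lemma normal_cone_polyhedral P a : is_polytope P ->
  polyhedral_cone [set b | fle P a b].
Proof.
move=> PP; have [s [s0 PE]] := polytope_generators PP.
pose X := [seq x - y | x <- [seq x <- s | `[< face P a x >]], y <- s].
exists (size X), (fun i => nth 0 X i); apply/seteqP; split=> b /= ab.
  move=> i; have /allpairsP[[x y] /=] := mem_nth 0 (ltn_ord i).
  rewrite mem_filter => -[/andP[/asboolP xa xs] ys ->].
  rewrite pairingE subr_ge0; apply: (ab _ xa).2; exact: generators_sub PE _ ys.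
apply: (fle_generators s0 PE) => x xs xa; split=> [|q]; first by case: xa.
rewrite PE; apply: convex_hull_le => y ys.
have xyX : x - y \in X.
  by apply: allpairs_f; rewrite // mem_filter xs andbT; apply/asboolP.
have /(nthP 0)[i iX ixy] := xyX.
by have := ab (Ordinal iX); rewrite /= ixy pairingE subr_ge0.
Qed.

(** Applied to a cone, this provides a direction in its relative interior. *)
Lemma minimal_face P (A : set 'cV[R]_n) : is_polytope P -> A !=set0 ->
  exists2 a, A a & forall b, A b -> fle P b a -> fle P a b.
Proof.
move=> PP [a0 Aa0]; have [s [s0 PE]] := polytope_generators PP.
pose cnt a := #|generator_pattern P s a|.
have ex : exists m, `[< exists2 a, A a & cnt a = m >].
  by exists (cnt a0); apply/asboolP; exists a0.
case: (ex_minnP ex) => m /asboolP[a Aa am] mmin; exists a => // b Ab.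
move=> /(generator_pattern_sub s0 PE) ba; apply/(generator_pattern_sub s0 PE).
suff /eqP <- : generator_pattern P s b == generator_pattern P s a by [].
rewrite eqEcard ba /=; have -> : #|generator_pattern P s a| = m by [].
by apply: mmin; apply/asboolP; exists b.
Qed.

(** A face of the cone above [a] is the up-set of a direction [d] in its
    relative interior.  Two cones, of the faces of [a] and [a'], meet in the face
    of the first one orthogonal to the sum of the [p - y], where [p] is in the
    face of [a] and [y] runs through the generators in the face of [a']. *)
Lemma complete_normal_fan P : is_polytope P -> complete_fan (normal_fan P).
Proof.
move=> PP; have NE := normal_fanE PP; split.
- exact: finite_normal_fan.
- by rewrite NE => _ [a ->]; exact: normal_cone_polyhedral.
- rewrite NE => _ _ [a ->] [x xpos ->].
  (* a direction in the relative interior of the given face of the cone *)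
  have [|d [/= ad dx] dmin] :=
      @minimal_face P [set b | fle P a b /\ pairing b x = 0] PP.
    by exists 0; split; [exact: fle0|rewrite pairing0l].
  exists d; apply/seteqP; split=> [b [/= ab bx]|b /= db]; last first.
    have ab := fle_trans ad db; split=> //.
    have /near_exists[e e0 de] := near_fle_const PP (const_onN (fle_const db)).
    have := xpos _ ab; have := xpos _ (fle_trans ad de).
    rewrite !pairingE dx add0r mulrN oppr_ge0 pmulr_rle0// => h1 h2.
    by apply/eqP; rewrite eq_le h1.
  have [p pa] := face_neq0 a PP.
  have sumP q : face P (d + b) q -> face P d q /\ face P b q.
    move=> [Pq qm]; have := qm p pa.1; have := (ad _ pa).2 q Pq.
    have := (ab _ pa).2 q Pq; rewrite !pairingE => h1 h2 h3.
    split; split=> // r Pr.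
      by have := (ad _ pa).2 r Pr; lra.
    by have := (ab _ pa).2 r Pr; lra.
  have : fle P d (d + b).
    apply: dmin => [|q /sumP[]//]; split; last by rewrite pairingE dx bx addr0.
    move=> q qa; split=> [|r Pr]; first by case: qa.
    by rewrite !pairingE lerD//; [apply: (ad _ qa).2|apply: (ab _ qa).2].
  by move=> h q /h/sumP[].
- rewrite NE => _ _ [a ->] [a' ->]; have [s [s0 PE]] := polytope_generators PP.
  have [p pa] := face_neq0 a PP.
  have py b y : fle P a b -> face P a' y -> 0 <= pairing b (p - y).
    by move=> ab ya; rewrite pairingE subr_ge0 (ab _ pa).2//; case: ya.
  exists (\sum_(y <- s | `[< face P a' y >]) (p - y)).
    move=> b /= ab; rewrite pairing_sumr sumr_ge0// => y /asboolP; exact: py.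
  apply/seteqP; split=> b /= [ab].
    move=> ab'; split=> //; rewrite pairing_sumr big1// => y /asboolP ya'.
    have := (ab _ pa).2 y ya'.1; have := (ab' _ ya').2 p pa.1.
    by rewrite pairingE; lra.
  rewrite pairing_sumr => /eqP; rewrite psumr_eq0; last first.
    by move=> y /asboolP; exact: py.
  move=> /allP h; split=> //; apply: (fle_generators s0 PE) => y ys ya'.
  have := h y ys; rewrite asboolT//= pairingE subr_eq0 => /eqP e.
  split=> [|q Pq]; first by case: ya'.
  by rewrite -e; apply: (ab _ pa).2.
- by rewrite NE; apply/seteqP; split=> // b _; exists [set c | fle P b c];
    [exists b|].
Qed.

End CompleteFan.

(** * Dimension of spans *)

Section SpanDim.
Variables (R : realType) (V : lmodType R).
Implicit Types (S : set V).

Definition independent d (b : 'I_d -> V) :=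
  forall c : 'I_d -> R, \sum_i c i *: b i = 0 -> forall i, c i = 0.

Definition in_span d (b : 'I_d -> V) (x : V) :=
  exists c : 'I_d -> R, x = \sum_i c i *: b i.

Lemma independent_le p q (b : 'I_p -> V) (f : 'I_q -> V) :
  independent b -> (forall i, in_span f (b i)) -> (p <= q)%N.
Proof.
move=> ib /choice[A bA]; pose M : 'M[R]_(p, q) := \matrix_(i, j) A i j.
suff : row_free M by move=> /eqP <-; exact: rank_leq_col.
apply: inj_row_free => v vM; apply/rowP => i; rewrite mxE.
apply: (ib (fun i => v 0 i)); transitivity (\sum_j (v *m M) 0 j *: f j).
  transitivity (\sum_i \sum_j (v 0 i * A i j) *: f j).
    apply: eq_bigr => k _; rewrite bA scaler_sumr; apply: eq_bigr => j _.
    by rewrite scalerA.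
  rewrite exchange_big; apply: eq_bigr => j _; rewrite -scaler_suml.
  by congr (_ *: _); rewrite mxE; apply: eq_bigr => k _; rewrite mxE.
by rewrite vM big1// => j _; rewrite mxE scale0r.
Qed.

Definition rcons_family d (b : 'I_d -> V) x (i : 'I_d.+1) : V :=
  if unlift ord_max i is Some j then b j else x.

Lemma sum_rcons_family d (b : 'I_d -> V) x (c : 'I_d.+1 -> R) :
  \sum_i c i *: rcons_family b x i =
  \sum_i c (lift ord_max i) *: b i + c ord_max *: x.
Proof.
rewrite big_ord_recr /=; congr (_ + _ *: _).
  apply: eq_bigr => i _.
  have -> : widen_ord (leqnSn d) i = lift ord_max i.
    by apply: val_inj; rewrite /= /bump leqNgt ltn_ord.
  by rewrite /rcons_family liftK.
by rewrite /rcons_family unlift_none.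
Qed.

Lemma independent_rcons d (b : 'I_d -> V) x : independent b ->
  ~ in_span b x -> independent (rcons_family b x).
Proof.
move=> ib xb c; rewrite sum_rcons_family => e.
have c0 : c ord_max = 0.
  apply: contrapT => /eqP c0; apply: xb.
  exists (fun i => - (c ord_max)^-1 * c (lift ord_max i)).
  move/eqP: e; rewrite addrC addr_eq0 => /eqP e.
  rewrite -[LHS]scale1r -(mulVf c0) -scalerA e scalerN scaler_sumr -sumrN.
  by apply: eq_bigr => i _; rewrite scalerA mulNr scaleNr.
move: e; rewrite c0 scale0r addr0 => /ib e i.
by case: (unliftP ord_max i) => [j ->|->//]; exact: e.
Qed.

(** A longest independent family in [S]; its length is bounded because [S] lies
    in the span of finitely many vectors. *)
Lemma span_dim_exists S q (f : 'I_q -> V) : (forall x, S x -> in_span f x) ->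
  exists2 d, (d <= q)%N & span_dim S d.
Proof.
move=> Sf; pose ok d := `[< exists b : 'I_d -> V, (forall i,
  S (b i)) /\ independent b >].
have ok0 : exists d, ok d.
  by exists 0%N; apply/asboolP; exists (fun=> 0); split=> [[]|c _ []].
have okq d : ok d -> (d <= q)%N.
  by move=> /asboolP[b [Sb ib]]; apply: (independent_le ib) => i; exact: Sf.
case: (ex_maxnP ok0 okq) => d /asboolP[b [Sb ib]] dmax.
exists d; first by apply: okq; apply/asboolP; exists b.
exists b; split=> // x Sx; apply: contrapT => xb.
suff : (d.+1 <= d)%N by rewrite ltnn.
apply: dmax; apply/asboolP; exists (rcons_family b x); split.
  by move=> i; rewrite /rcons_family; case: unliftP.
exact: independent_rcons.
Qed.

(** The linear form [f] shows that [x] is not in the span of [S']. *)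
Lemma span_dim_lt S S' d d' x (f : V -> R) :
  span_dim S d -> span_dim S' d' -> S' `<=` S -> S x ->
  (forall t u v, f (t *: u + v) = t * f u + f v) ->
  (forall y, S' y -> f y = 0) -> f x != 0 -> (d' < d)%N.
Proof.
move=> [b [Sb ib Sspan]] [b' [Sb' ib' _]] S'S Sx fl f0 fx.
have f00 : f 0 = 0 by have := fl 1 0 0; rewrite scaler0 addr0 mul1r; lra.
apply: (@independent_le _ _ (rcons_family b' x) b).
  apply: independent_rcons => // -[c xE]; move/eqP: fx; apply.
  rewrite xE; elim/big_ind: _ => // [u v fu fv|i _].
    by rewrite -[u]scale1r fl fu fv mulr0 addr0.
  by rewrite -[X in f X]addr0 fl f00 f0// mulr0 addr0.
move=> i; apply: Sspan; rewrite /rcons_family; case: unliftP => // j _.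
exact: S'S.
Qed.

End SpanDim.

(** * Edges *)

Section Edges.
Variables (R : realType) (n : nat).
Implicit Types (a b c d : 'cV[R]_n) (x y p q u : 'rV[R]_n) (t : R).
Implicit Types (P Q F : set 'rV[R]_n).

(** [u] may vanish and need not be a difference of points of [F]: this says
    that the direction space of [F] is contained in the line of [u]. *)
Definition along F u := forall x y, F x -> F y -> exists t, x - y = t *: u.

Lemma alongP F u : along F u <-> forall c, pairing c u = 0 -> const_on F c.
Proof.
split=> [Fu c cu x y xF yF|h x y xF yF].
  have [t /(congr1 (pairing c))] := Fu x y xF yF.
  by rewrite !pairingE cu mulr0 => /eqP; rewrite subr_eq0 => /eqP.
apply: pairing_perp => c /h/(_ x y xF yF); rewrite pairingE => ->.
by rewrite subrr.
Qed.

Lemma const_on_eq F x y : (forall c, const_on F c) -> F x -> F y -> x = y.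
Proof. by move=> h Fx Fy; apply: pairing_inj => c; exact: h. Qed.

Lemma edge_dimP F : polytope_dim F 1 <->
  exists x y, [/\ F x, F y, x <> y & along F (x - y)].
Proof.
split=> [[b [Sb ib span]]|[x [y [Fx Fy xy Fxy]]]].
  have [x [y [Fx Fy bE]]] := Sb ord0; exists x, y; split=> //.
    move=> xy; have := ib (fun=> 1); rewrite big_ord1 bE xy subrr scaler0.
    by move=> /(_ erefl ord0)/eqP; rewrite oner_eq0.
  move=> z w Fz Fw; have [|c ->] := span (z - w); first by exists z, w.
  by exists (c ord0); rewrite big_ord1 bE.
exists (fun=> x - y); split.
- by move=> _; exists x, y.
- move=> c; rewrite big_ord1 => /eqP; rewrite scaler_eq0 subr_eq0.
  by move=> /orP[/eqP c0 i|/eqP//]; rewrite ord1.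
- move=> _ [z [w [Fz Fw ->]]]; have [t ->] := Fxy z w Fz Fw.
  by exists (fun=> t); rewrite big_ord1.
Qed.

Lemma along_edge F u x y : F x -> F y -> x <> y -> along F u ->
  polytope_dim F 1.
Proof.
move=> Fx Fy xy Fu; apply/edge_dimP; exists x, y; split=> // z w Fz Fw.
have [t zw] := Fu z w Fz Fw; have [r xyE] := Fu x y Fx Fy.
have r0 : r != 0.
  by apply: contra_notN xy => /eqP r0; move/eqP: xyE;
    rewrite r0 scale0r subr_eq0 => /eqP.
by exists (t / r); rewrite zw xyE scalerA divfK.
Qed.

Lemma full_dimP F : polytope_dim F n <-> forall c, const_on F c -> c = 0.
Proof.
pose S := [set z | exists x y, [/\ F x, F y & z = x - y]].
have f_std x : in_span (fun i : 'I_n => (delta_mx 0 i : 'rV[R]_n)) x.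
  by exists (fun i => x 0 i); exact: row_sum_delta.
have FcP c : const_on F c <-> forall z, S z -> pairing c z = 0.
  split=> [Fc _ [x [y [Fx Fy ->]]]|h x y Fx Fy].
    by rewrite pairingE (Fc x y) ?subrr.
  by apply/eqP; rewrite -subr_eq0 -pairingBr h//; exists x, y.
split=> [[b [Sb ib _]] c /FcP Fc|h].
  apply: contrapT => c0; suff : (n.+1 <= n)%N by rewrite ltnn.
  apply: (@independent_le _ _ _ _ (rcons_family b c^T)) => [|i];
    last exact: f_std.
  apply: independent_rcons => // -[k ck]; apply: c0; apply: trmx_inj.
  rewrite trmx0; apply: pairing_trmx; rewrite trmxK ck pairing_sumr big1// => i
    _.
  by rewrite pairingZr (Fc _ (Sb i)) mulr0.
have [d dn [b [Sb ib span]]] := span_dim_exists (fun x (_ : S x) => f_std x).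
suff nd : (n <= d)%N.
  have dE : d = n by apply/eqP; rewrite eqn_leq dn.
  have Sd : span_dim S d by exists b.
  by rewrite dE in Sd.
pose M : 'M[R]_(n, d) := \matrix_(i, j) b j 0 i.
suff : row_free M by move=> /eqP <-; exact: rank_leq_col.
apply: inj_row_free => v vM; apply: trmx_inj; rewrite trmx0; apply: h.
apply/FcP => z /span[k ->]; rewrite pairing_sumr big1// => i _.
rewrite pairingZr pairing_sum; move/matrixP/(_ 0 i): vM; rewrite !mxE => vM.
suff -> : \sum_j b i 0 j * v^T j 0 = \sum_j v 0 j * M j i by rewrite vM mulr0.
by apply: eq_bigr => j _; rewrite !mxE mulrC.
Qed.

(** For each [x] some vector orthogonal to [u] is not orthogonal to [x]; adding
    small multiples of these vectors one after the other keeps the inequations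
    that already hold. *)
Lemma generic_orthogonal (s : seq 'rV[R]_n) u :
  (forall x, x \in s -> ~ exists t, x = t *: u) ->
  exists2 c, pairing c u = 0 & forall x, x \in s -> pairing c x != 0.
Proof.
elim: s => [|x s IH] h; first by exists 0; rewrite ?pairing0l.
have [y ys|c cu cs] := IH; first by apply: h; rewrite in_cons ys orbT.
have [d du dx] : exists2 d, pairing d u = 0 & pairing d x != 0.
  apply: contrapT => hd; apply: (h x (mem_head _ _));
    apply: pairing_perp => d du.
  by apply: contrapT => /eqP dx; apply: hd; exists d.
have : \forall e \near 0^'+, forall y, y \in x :: s ->
  pairing (c + e *: d) y != 0.
  apply: near_all => y ys; near=> e; rewrite !pairingE; near: e.
  apply: near_neq0; move: ys; rewrite in_cons => /predU1P[->|/cs ->//].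
  by rewrite dx orbT.
move=> /near_exists[e _ ce]; exists (c + e *: d) => //.
by rewrite !pairingE cu du mulr0 addr0.
Unshelve. all: by end_near. Qed.

Lemma generic_direction (s : seq 'rV[R]_n) : 0 \notin s ->
  exists c, forall x, x \in s -> pairing c x != 0.
Proof.
move=> s0; have [|c _ cs] := @generic_orthogonal s 0; last by exists c.
by move=> x xs [t]; rewrite scaler0 => x0; move: s0; rewrite -x0 xs.
Qed.

(** A small generic perturbation of [b] separates the generators. *)
Lemma face_vertex P b : is_polytope P ->
  exists a v, fle P a b /\ face P a = [set v].
Proof.
move=> PP; have [s [s0 PE]] := polytope_generators PP.
have [|c cs] := @generic_direction [seq x <- [seq x - y | x <- s,
  y <- s] | x != 0].
  by rewrite mem_filter eqxx.
have : \forall e \near 0^'+, forall x, x \in [seq x - y | x <- s, y <- s] ->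
    x != 0 -> pairing (b + e *: c) x != 0.
  apply: near_all => x xs; have [->|x0] := eqVneq x 0; first by near=> e.
  near=> e => _; rewrite !pairingE; near: e; apply: near_neq0.
  by rewrite [X in _ || X]cs ?orbT// mem_filter x0.
move=> gen; have [e _ [ge eb]] : exists2 e, 0 < e & (forall x,
    x \in [seq x - y | x <- s, y <- s] -> x != 0 -> pairing (b + e *: c) x != 0)
    /\ fle P (b + e *: c) b.
  apply: near_exists; near=> e; split; near: e => //; exact: near_fle.
exists (b + e *: c); have [v vb] := face_neq0 (b + e *: c) PP; exists v.
split=> //; apply/seteqP; split=> [x xb|_ ->//].
apply: const_on_eq xb vb => d; apply: (const_on_generators s0 PE) => y z ys zs.
move=> yb zb; suff -> : y = z by [].
apply/eqP; rewrite -subr_eq0; apply: contraT => yz.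
have := ge (y - z) (allpairs_f _ ys zs) yz.
by rewrite pairingE (fle_const (fle_refl (a:=b + e *: c)) yb zb) subrr eqxx.
Unshelve. all: by end_near. Qed.

Section Refinement.
Variables (P Q : set 'rV[R]_n).
Hypotheses (PP : is_polytope P) (QP : is_polytope Q).
Hypothesis PQ : forall a b, fle P a b -> fle Q a b.

Lemma const_on_refines a c : const_on (face P a) c -> const_on (face Q a) c.
Proof.
move=> /(const_faceP _ _ PP)[e e0 [h1 h2]]; apply/const_faceP => //.
by exists e => //; split; exact: PQ.
Qed.

Lemma along_refines a u : along (face P a) u -> along (face Q a) u.
Proof. by rewrite !alongP => h c /h; exact: const_on_refines. Qed.

(** A coarser fan has no new edge directions: the normal cone of an edge of
    [Q] contains a direction in general position, whose face of [P] is an edge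
    parallel to it. *)
Lemma edge_refines a : polytope_dim (face Q a) 1 ->
  exists b u, [/\ polytope_dim (face P b) 1, along (face P b) u &
                  along (face Q a) u].
Proof.
move=> /edge_dimP[x [y [xa ya xy axy]]].
have [s [s0 PE]] := polytope_generators PP.
pose D := [seq x - y | x <- s, y <- s].
have [|c cu cD] := @generic_orthogonal
    [seq z <- D | `[< ~ exists t, z = t *: (x - y) >]] (x - y).
  by move=> z; rewrite mem_filter => /andP[/asboolP].
have : \forall e \near 0^'+, forall z, z \in D ->
    ~ (exists t, z = t *: (x - y)) -> pairing (a + e *: c) z != 0.
  apply: near_all => z zD.
  have [?|zxy] := pselect (exists t, z = t *: (x - y)); first by near=> e.
  near=> e => _; rewrite !pairingE; near: e.
  apply: near_neq0; rewrite [X in _ || X]cD ?orbT//.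
  by rewrite mem_filter zD andbT; apply/asboolP.
move=> gen; have [e _ [ge eb]] : exists2 e, 0 < e & (forall z, z \in D ->
    ~ (exists t, z = t *: (x - y)) -> pairing (a + e *: c) z != 0)
    /\ fle Q a (a + e *: c).
  apply: near_exists; near=> e; split; near: e => //.
  by apply: near_fle_const => //; move/alongP: axy; apply.
have alongP' : along (face P (a + e *: c)) (x - y).
  apply/alongP => d dxy; apply: (const_on_generators s0 PE).
  move=> z w zs ws za wa; apply/eqP; rewrite -subr_eq0 -pairingBr.
  apply: contraT => dzw.
  have := ge (z - w) (allpairs_f _ zs ws).
  rewrite pairingE (fle_const (fle_refl (a:=a + e *: c)) za wa) subrr eqxx.
  have [[t zw] _|zw /(_ zw)//] :=
    pselect (exists t, z - w = t *: (x - y)).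
  by move: dzw; rewrite zw pairingZr dxy mulr0 eqxx.
exists (a + e *: c), (x - y); split=> //.
have [p pP] := face_neq0 (a + e *: c) PP.
have [[q [qP pq]]|npq] := pselect (exists q, face P (a + e *: c) q /\ p <> q).
  exact: along_edge pP qP pq alongP'.
exfalso; apply: xy; apply: (@const_on_eq (face Q (a + e *: c))); last 2 first.
- exact: eb.
- exact: eb.
move=> d; apply: const_on_refines => z w zP wP.
suff h v : face P (a + e *: c) v -> v = p by rewrite (h z zP) (h w wP).
by move=> vP; apply: contrapT => vp; apply: npq; exists v; split=> // /esym.
Unshelve. all: by end_near. Qed.

End Refinement.

(** Starting from the generator [p] that maximizes [a] and then [b], decrease
    [t] in [b + t a] until another generator [q], with a smaller value at [a],
    catches up with [p].  If this only happens for [t <= 0] then [p] maximizes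
    [b] as well. *)
Lemma face_breakpoint P s a b : s != [::] -> P = convex_hull [set` s] ->
  ~ const_on P a -> exists t p q, [/\ p \in s, q \in s,
    face P (b + t *: a) p, face P (b + t *: a) q & pairing a q < pairing a p] /\
    (0 < t \/ exists x, face P a x /\ face P b x).
Proof.
move=> s0 PE aP; have PP := generated_polytope s0 PE.
have /near_exists[e e0 [p ps [pa pe]]] := near_common_generator a b s0 PE.
have pb y : P y -> pairing a y = pairing a p -> pairing b y <= pairing b p.
  by move=> /pe.2; rewrite !pairingE => + yp; rewrite yp lerD2l ler_pM2l.
pose r := [seq z <- s | pairing a z < pairing a p].
have r0 : r != [::].
  apply: contra_notN aP => /eqP r0 x y Px Py.
  have : const_on (face P 0) a.
    suff h z : z \in s -> pairing a z = pairing a p.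
      apply: (const_on_generators s0 PE) => z w zs ws _ _.
      by rewrite (h z zs) (h w ws).
    move=> zs; apply: le_anti; rewrite (pa.2 _ (generators_sub PE zs)) /= leNgt.
    apply/negP => zp; have : z \in r by rewrite mem_filter zp.
    by rewrite r0.
  by apply; split=> // z; rewrite !pairing0l.
have [q] := seq_argmax (fun z => pairing b (z - p) / pairing a (p - z)) r0.
rewrite mem_filter => /andP[qp qs] qmax.
set t := (X in forall y, _ -> _ <= X) in qmax.
have pt : face P (b + t *: a) p.
  split=> [|x]; first by case: pa.
  rewrite PE; apply: convex_hull_le => y ys; have Py := generators_sub PE ys.
  have [yp|py|yp] := ltgtP (pairing a y) (pairing a p); last first.
  - by rewrite !pairingE yp lerD2r pb.
  - by move: py; rewrite ltNge pa.2.
  - have := qmax y; rewrite mem_filter yp ys => /(_ isT).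
    rewrite ler_pdivrMr ?pairingE ?subr_gt0//; lra.
have qt : face P (b + t *: a) q.
  split=> [|x Px]; first exact: generators_sub PE _ qs.
  apply: le_trans (pt.2 x Px) _; suff : t * pairing a (p - q) = pairing b (q -
    p).
    by rewrite !pairingE; lra.
  by rewrite /t divfK// pairingBr subr_eq0 gt_eqF.
exists t, p, q; split=> //; have [t0|t0] := ltP 0 t; [by left|right].
exists p; split=> //; split=> [|x Px]; first by case: pa.
have := pt.2 x Px; have := ler_wpM2l (_ : 0 <= - t) (pa.2 x Px).
by rewrite oppr_ge0 => /(_ t0); rewrite !pairingE; lra.
Qed.

(** The line of directions [b + t c] has a breakpoint, where the face contains
    points with different values at [c].  When [b] is generic, this face is an
    edge: two non-parallel differences [v] and [w] in it would make [b]
    orthogonal to the vector [<c, v> w - <c, w> v]. *)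
Lemma edge_not_orthogonal P c : is_polytope P -> ~ const_on P c ->
  exists b u, [/\ polytope_dim (face P b) 1, along (face P b) u &
                  pairing c u != 0].
Proof.
move=> PP cP; have [s [s0 PE]] := polytope_generators PP.
pose D := [seq x - y | x <- s, y <- s].
pose W := [seq pairing c v *: w - pairing c w *: v | v <- D, w <- D].
have [|b bW] := @generic_direction [seq z <- W | z != 0].
  by rewrite mem_filter eqxx.
have [t [p [q [[ps qs pt qt pq] _]]]] := face_breakpoint b s0 PE cP.
have cpq : pairing c (p - q) != 0 by rewrite pairingE subr_eq0 gt_eqF.
have tD x y : face P (b + t *: c) x -> face P (b + t *: c) y ->
    pairing b (x - y) = - t * pairing c (x - y).
  move=> xt yt; have := fle_const (fle_refl (a:=b + t *: c)) xt yt.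
  by rewrite !pairingE; lra.
have E : along (face P (b + t *: c)) (p - q).
  apply/alongP => d dpq; apply: (const_on_generators s0 PE) => x y xs ys xt yt.
  apply/eqP; rewrite -subr_eq0 -pairingBr.
  have : pairing c (p - q) *: (x - y) - pairing c (x - y) *: (p - q) = 0.
    apply: contrapT => /eqP z0; set z := (X in X != 0) in z0.
    have zW : z \in W.
      apply/allpairsP; exists (p - q, x - y).
      by split=> //=; apply: (allpairs_f (fun x y => x - y)).
    have : pairing b z != 0 by apply: bW; rewrite mem_filter z0.
    rewrite /z (pairingBr b (_ *: _)) !(pairingZr _ b) (tD x y)// (tD p q)//.
    by rewrite [X in X - _]mulrCA [X in _ - X]mulrCA
      [pairing c (x - y) * _]mulrC subrr eqxx.
  move=> /(congr1 (pairing d)).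
  rewrite (pairingBr d (_ *: _)) !(pairingZr _ d) dpq mulr0 subr0.
  by rewrite pairing0r => /eqP; rewrite mulf_eq0 (negbTE cpq).
exists (b + t *: c), (p - q); split=> //; apply: along_edge pt qt _ E.
by move=> pqE; move: pq; rewrite pqE ltxx.
Qed.

(** A face of a face is a face: maximize [a] first and then [b]. *)
Lemma face_face P a b : is_polytope P ->
  exists2 e, 0 < e & face (face P a) b = face P (a + e *: b).
Proof.
move=> PP; apply: near_exists; near=> e.
have e0 : 0 < e by near: e; exact: near_gt0.
have [p [pa pe]] : exists p, face P a p /\ face P (a + e *: b) p.
  by near: e; exact: near_common_face.
have ea : fle P (a + e *: b) a by near: e; exact: near_fle.
apply/seteqP; split=> q; last first.
  move=> qe; split=> [|r ra]; first exact: ea.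
  have := qe.2 r ra.1; rewrite !pairingE.
  by rewrite (fle_const (fle_refl (a:=a)) ra (ea _ qe)) lerD2l ler_pM2l.
move=> [qa qm]; split=> [|r Pr]; first by case: qa.
apply: le_trans (pe.2 r Pr) _; rewrite !pairingE.
by rewrite (fle_const (fle_refl (a:=a)) pa qa) lerD2l ler_pM2l// qm.
Unshelve. all: by end_near. Qed.

(** The face at the breakpoint [b + t a], with [t > 0], has an edge [u] that is
    not orthogonal to [a]; since [b + t a] is orthogonal to [u], the values of [a]
    and [b] at [u] have opposite signs. *)
Lemma separating_edge P a b : is_polytope P ->
  ~ (exists x, face P a x /\ face P b x) ->
  exists d u, [/\ polytope_dim (face P d) 1, along (face P d) u &
                  pairing a u * pairing b u < 0].
Proof.
move=> PP ab; have [s [s0 PE]] := polytope_generators PP.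
have [aP|aP] := pselect (const_on P a).
  exfalso; apply: ab; have [x [Px xb]] := face_neq0 b PP; exists x.
  by split=> //; split=> // q Pq; rewrite (aP q x).
have [t [p [q [[ps qs pt qt pq] [t0|//]]]]] := face_breakpoint b s0 PE aP.
have [|d' [u [E Eu au]]] := @edge_not_orthogonal _ a
    (is_polytope_face (b + t *: a) PP).
  by move=> /(_ p q pt qt) pqE; move: pq; rewrite pqE ltxx.
have [e e0 faceE] := face_face (b + t *: a) d' PP.
exists (b + t *: a + e *: d'), u; rewrite -faceE; split=> //.
have /edge_dimP[x [y [xE yE xy _]]] := E.
have [r xyE] := Eu x y xE yE.
have r0 : r != 0.
  by apply: contra_notN xy => /eqP r0; move/eqP: xyE;
    rewrite r0 scale0r subr_eq0 => /eqP.
have : pairing (b + t *: a) (x - y) = 0.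
  rewrite pairingBr (fle_const (fle_refl (a:=b + t *: a)) xE.1 yE.1).
  by rewrite subrr.
rewrite xyE pairingZr => /eqP; rewrite mulf_eq0 (negbTE r0)/= !pairingE.
rewrite addr_eq0 => /eqP ->.
by rewrite mulrN oppr_lt0 mulrCA -expr2 mulr_gt0// exprn_even_gt0.
Qed.

End Edges.

(** * Rational polytopes *)

Section Rational.
Variables (R : realType) (n : nat).
Implicit Types (a b c d : 'cV[R]_n) (x y p q u : 'rV[R]_n) (t : R).
Implicit Types (P Q F : set 'rV[R]_n).

Lemma edge_along_neq0 F u x y : along F u -> F x -> F y -> x <> y ->
  exists2 t, t != 0 & x - y = t *: u.
Proof.
move=> Fu Fx Fy xy; have [t xyE] := Fu x y Fx Fy; exists t => //.
apply: contra_notN xy => /eqP t0; move/eqP: xyE.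
by rewrite t0 scale0r subr_eq0 => /eqP.
Qed.

Lemma along_parallel F u v : polytope_dim F 1 -> along F u -> along F v ->
  exists2 k, k != 0 & u = k *: v.
Proof.
move=> /edge_dimP[x [y [Fx Fy xy _]]] Fu Fv.
have [t t0 tE] := edge_along_neq0 Fu Fx Fy xy.
have [r r0 rE] := edge_along_neq0 Fv Fx Fy xy.
exists (t^-1 * r); first by rewrite mulf_neq0 ?invr_eq0.
by rewrite -scalerA -rE tE scalerA mulVf ?scale1r.
Qed.

Lemma alongZ F u k : k != 0 -> along F (k *: u) <-> along F u.
Proof.
move=> k0; split=> Fu x y Fx Fy; have [t ->] := Fu x y Fx Fy.
  by exists (t * k); rewrite scalerA.
by exists (t / k); rewrite scalerA divfK.
Qed.

Lemma is_edgeP P E : is_polytope P ->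
  is_edge P E <-> exists2 a, E = face P a & polytope_dim (face P a) 1.
Proof.
move=> PP; split=> [[[_ [a ->]] E1]|[a -> a1]]; first by exists a.
by split=> //; split; [exact: face_neq0|exists a].
Qed.

(** Every edge of [Q] is parallel to an edge of [P]. *)
Lemma rational_edges_refines P Q : is_polytope P -> is_polytope Q ->
  (forall a b, fle P a b -> fle Q a b) -> rational_edges P -> rational_edges Q.
Proof.
move=> PP QP PQ Prat _ /(is_edgeP _ QP)[a -> /(edge_refines PP QP PQ)].
move=> [b [u [b1 bu au]]].
have [|v [v0 bv]] := Prat (face P b); first by apply/is_edgeP => //; exists b.
exists v; split=> //; have [k k0 uE] := along_parallel b1 bu bv.
by move: au; rewrite uE => /(alongZ _ _ k0).
Qed.

(** If [D] contains all edge directions of [P], then the signs on [D] of a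
    direction determine its face: otherwise two directions with the same signs
    would be separated by an edge. *)
Lemma finite_fans_along (D : seq 'rV[R]_n) :
  finite_set (@normal_fan R n @` [set P | is_polytope P /\
    forall a, polytope_dim (face P a) 1 ->
      exists2 v, v \in D & along (face P a) v]).
Proof.
pose k a := [ffun i : 'I_(size D) =>
  (0 < pairing a (nth 0 D i), pairing a (nth 0 D i) < 0)].
apply: (@finite_normal_fans _ _ _ k) => P [PP PD]; split=> //.
suff h a b : k a = k b -> fle P a b.
  by move=> a b ab; apply/seteqP; split; apply: h.
move=> /ffunP ab.
have : \forall e \near 0^'+, forall v, v \in D ->
    0 <= pairing (a - e *: b) v * pairing b v.
  apply: near_all => v /(nthP 0)[i iD <-]; have := ab (Ordinal iD).
  rewrite !ffunE /= => -[pos neg].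
  have [b0|b0|b0] := ltgtP (pairing b D`_i) 0.
  - near=> e; rewrite mulr_le0 ?(ltW b0)//.
    suff : 0 < pairing (- a) D`_i + e * pairing b D`_i.
      by rewrite !pairingE; lra.
    by near: e; apply: near_pos; rewrite pairingE oppr_gt0 neg.
  - near=> e; rewrite mulr_ge0 ?(ltW b0)//.
    suff : 0 < pairing a D`_i + e * - pairing b D`_i.
      by rewrite !pairingE; lra.
    by near: e; apply: near_pos; rewrite pos.
  - by near=> e; rewrite b0 mulr0.
move=> /near_exists[e e0 De]; apply/fleP => //; exists e => //.
rewrite -supportZ ?ltW// -[in LHS](subrK (e *: b) a);
  apply/supportD_faceP => //.
apply: contrapT => /(separating_edge PP)[d [u [d1 du abu]]].
have [v vD dv] := PD d d1; have [l l0 uE] := along_parallel d1 du dv.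
have := De v vD; move: abu; rewrite uE !(pairingZr, pairingZl) => abu.
rewrite leNgt => /negP; apply.
have l2 : 0 < e * (l * l) by rewrite mulr_gt0// -expr2 exprn_even_gt0.
by rewrite -(pmulr_rlt0 _ l2); apply: le_lt_trans abu; lra.
Unshelve. all: by end_near. Qed.

(** There are countably many finite lists of rational directions, and finitely
    many fans for each of them. *)
Lemma countable_rational_fans : countable (@normal_fan R n @`
  [set P | is_polytope P /\ rational_edges P]).
Proof.
pose A (D : seq 'rV[rat]_n) := @normal_fan R n @` [set P | is_polytope P /\
  forall a, polytope_dim (face P a) 1 ->
    exists2 v, v \in [seq map_mx ratr v | v <- D] & along (face P a) v].
suff sub : @normal_fan R n @` [set P | is_polytope P /\ rational_edges P] `<=`
    \bigcup_D A D.
  apply: sub_countable (subset_card_le sub) _;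
    apply: bigcup_countable => // D _.
  exact: finite_set_countable (finite_fans_along _).
move=> _ [P [PP Prat] <-]; have [s [s0 PE]] := polytope_generators PP.
pose dir f := xget (0 : 'rV[rat]_n) [set v | exists a,
  [/\ generator_pattern P s a = f, v != 0 & along (face P a) (map_mx ratr v)]].
exists [seq dir f | f <- enum {set 'I_(size s)}] => //; exists P => //.
split=> // a a1; have [|v [v0 av]] := Prat (face P a).
  by apply/is_edgeP => //; exists a.
have := @xgetPex _ (0 : 'rV[rat]_n) [set v | exists b,
  [/\ generator_pattern P s b = generator_pattern P s a, v != 0 &
      along (face P b) (map_mx ratr v)]].
move=> [|b [/(generator_pattern_face s0 PE) ab _ bv]]; first by exists v, a.
exists (map_mx ratr (dir (generator_pattern P s a))).
  by rewrite -map_comp; apply/mapP; exists (generator_pattern P s a);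
    rewrite ?mem_enum.
by rewrite -ab.
Qed.

End Rational.

(** * Delzant polytopes *)

Lemma card_eq_images (T : choiceType) (U V : Type) (z0 : T) (A : set T)
    (f : T -> U) (g : T -> V) :
  (forall z w, A z -> A w -> f z = f w <-> g z = g w) ->
  (f @` A #= g @` A)%card.
Proof.
suff le (U' V' : Type) (f' : T -> U') (g' : T -> V') :
    (forall z w, A z -> A w -> g' z = g' w -> f' z = f' w) ->
    (f' @` A #<= g' @` A)%card.
  by move=> fg; apply/card_eqPle; split; apply: le => z w Az Aw /fg; apply.
move=> gf; pose h v := f' (xget z0 [set z | A z /\ g' z = v]).
suff -> : f' @` A = h @` (g' @` A) by exact: card_image_le.
have hE z : A z -> h (g' z) = f' z.
  move=> Az; rewrite /h; have := @xgetPex _ z0 [set w | A w /\ g' w = g' z].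
  by move=> [|Aw gw]; [exists z|exact: gf].
apply/seteqP; split=> [_ [z Az <-]|_ [_ [z Az <-] <-]].
  by exists (g' z); [exists z|exact: hE].
by exists z; rewrite ?hE.
Qed.

Section Delzant.
Variables (R : realType) (n : nat).
Implicit Types (a b c d : 'cV[R]_n) (x y p q u : 'rV[R]_n) (t : R).
Implicit Types (P Q F : set 'rV[R]_n).

Lemma face0 P : face P 0 = P.
Proof.
apply/seteqP; split=> [x []//|x Px].
by split=> // q _; rewrite !pairing0l.
Qed.

(** Vertices, edges, their incidence and the directions of the edges can all be
    read off from the preorder [fle P]. *)
Section SameFan.
Variables (P Q : set 'rV[R]_n).
Hypotheses (PP : is_polytope P) (QP : is_polytope Q).
Hypothesis PQ : forall a b, fle P a b <-> fle Q a b.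

Let PQ1 a b : fle P a b -> fle Q a b. Proof. by move/PQ. Qed.
Let PQ2 a b : fle Q a b -> fle P a b. Proof. by move/PQ. Qed.

Lemma edge_same_fan a : polytope_dim (face P a) 1 -> polytope_dim (face Q a) 1.
Proof.
move=> /edge_dimP[x [y [xa ya xy axy]]].
have au := along_refines PP QP PQ1 axy.
have [p pa] := face_neq0 a QP.
have [[q [qa pq]]|npq] := pselect (exists q, face Q a q /\ p <> q).
  exact: along_edge pa qa pq au.
exfalso; apply: xy; apply: (@const_on_eq _ _ (face P a)) => // c.
apply: (const_on_refines QP PP PQ2) => z w za wa.
suff h v : face Q a v -> v = p by rewrite (h z za) (h w wa).
by move=> va; apply: contrapT => vp; apply: npq; exists v; split=> // /esym.
Qed.

Lemma vertex_same_fan a v : face P a = [set v] -> exists w, face Q a = [set w].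
Proof.
move=> av; have [w wa] := face_neq0 a QP; exists w.
apply/seteqP; split=> [x xa|_ ->//]; apply: const_on_eq xa wa => c.
by apply: (const_on_refines PP QP PQ1); rewrite av => y z -> ->.
Qed.

Lemma full_dim_same_fan : polytope_dim P n -> polytope_dim Q n.
Proof.
move=> /full_dimP h; apply/full_dimP => c; rewrite -[Q]face0 => Qc; apply: h.
by rewrite -[P]face0; exact: (const_on_refines QP PP PQ2).
Qed.

Lemma face_same_fan a b : face P a = face P b -> face Q a = face Q b.
Proof. by move=> ab; apply/seteqP; split; apply: PQ1; rewrite /fle ab. Qed.

Lemma edges_at_vertex a v : face P a = [set v] ->
  edges_at P v = face P @` [set b | polytope_dim (face P b) 1 /\ fle P a b].
Proof.
move=> av; apply/seteqP; split=> [E [/(is_edgeP _ PP)[b -> b1] vb]|E].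
  by exists b => //; split=> //; rewrite /fle av => _ ->.
move=> [b [b1 ab] <-]; split; first by apply/is_edgeP => //; exists b.
by apply: ab; rewrite av.
Qed.

(** The edge at [w] corresponding to the edge of [u] at [v] is parallel to [u];
    it points the same way because [a] is maximal at [v] and at [w] only. *)
Lemma primitive_edge_vectors_same_fan a v w : face P a = [set v] ->
  face Q a = [set w] -> primitive_edge_vectors P v `<=` primitive_edge_vectors
    Q w.
Proof.
move=> av aw u [pu [E [[/(is_edgeP _ PP)[b -> b1] vb] [t t0 ub]]]].
have ab : fle P a b by rewrite /fle av => _ ->.
set U := map_mx intr u in ub.
have U0 : U <> 0.
  move=> U0; have u0 i : u 0 i = 0.
    by apply: (@intr_inj R); have /matrixP/(_ 0 i) := U0; rewrite !mxE.
  move: pu; rewrite /primitive; under eq_bigr do rewrite u0.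
  have -> : \big[gcdz/0]_(i < n) (0 : int) = 0 by elim/big_ind: _ => // _ _ ->
    ->.
  by [].
have bU : along (face P b) U.
  have /edge_dimP[x [y [_ _ _ bxy]]] := b1.
  have [r /eqP] := bxy _ _ ub vb; rewrite [v + _]addrC addrK => /eqP tU.
  have r0 : r != 0.
    apply/eqP => r0; apply: U0; move/eqP: tU.
    by rewrite r0 scale0r scaler_eq0 gt_eqF//= => /eqP.
  have -> : U = (t^-1 * r) *: (x - y).
    by rewrite -scalerA -tU scalerA mulVf ?scale1r// gt_eqF.
  have k0 : t^-1 * r != 0 by rewrite mulf_neq0// invr_neq0// gt_eqF.
  exact: (alongZ _ _ k0).2.
have wb : face Q b w by apply: (PQ1 ab); rewrite aw.
have [z zb zw] : exists2 z, face Q b z & z <> w.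
  have /edge_dimP[x [y [xb yb xy _]]] := edge_same_fan b1.
  have [xw|xw] := pselect (x = w); last by exists x.
  by exists y => //; rewrite -xw => /esym.
have [r r0 zwE] := edge_along_neq0 (along_refines PP QP PQ1 bU) zb wb zw.
split=> //; exists (face Q b); split.
  by split=> //; apply/is_edgeP => //; exists b => //; exact: edge_same_fan.
have ltU : pairing a U < 0.
  have [Pv vmax] : face P a v by rewrite av.
  have := vmax _ ub.1; rewrite !pairingE gerDl pmulr_rle0// => le0.
  rewrite lt_neqAle le0 andbT; apply/eqP => aU.
  have : face P a (v + t *: U).
    split=> [|q Pq]; first by case: ub.
    by rewrite !pairingE aU mulr0 addr0 vmax.
  rewrite av /= => /eqP; rewrite addrC -subr_eq0 addrK scaler_eq0 gt_eqF//=.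
  by move/eqP.
exists r; last by rewrite -zwE addrC subrK.
have [Qw wmax] : face Q a w by rewrite aw.
have := wmax z zb.1; rewrite -subr_le0 -pairingBr zwE pairingZr nmulr_lle0//.
by rewrite le_eqVlt eq_sym (negbTE r0).
Qed.

End SameFan.

Lemma delzant_same_fan P Q : is_polytope Q ->
  normal_fan P = normal_fan Q -> is_delzant P -> is_delzant Q.
Proof.
move=> QP; move=> PQN [PP Pn Pcard Prat PZ].
have PQ := (normal_fan_eqP PP QP).1 PQN.
have QPle a b : fle Q a b <-> fle P a b by rewrite PQ.
have vert w : is_vertex Q w -> exists a v, face P a = [set v] /\ face Q a =
  [set w].
  move=> [_ [a aw]]; have [v av] := vertex_same_fan QP PP QPle (esym aw).
  by exists a, v.
have vertP v a : face P a = [set v] -> is_vertex P v.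
  by move=> av; split; [exists v|exists a].
split=> //.
- exact: (full_dim_same_fan PP QP PQ).
- move=> w /vert[a [v [av aw]]].
  apply: card_eq_trans (Pcard v (vertP _ _ av)).
  rewrite (edges_at_vertex PP av) (edges_at_vertex QP aw).
  rewrite (_ : [set b | _] = [set b | polytope_dim (face P b) 1 /\ fle P a b]).
    apply: card_eq_images => // b c _ _; split.
      exact: face_same_fan QPle _ _.
    exact: face_same_fan PQ _ _.
  apply/seteqP; split=> b [b1 ab]; split.
  + exact: edge_same_fan b1.
  + by apply/PQ.
  + exact: edge_same_fan b1.
  + by apply/PQ.
- by apply: rational_edges_refines Prat => // a b /PQ.
- move=> w /vert[a [v [av aw]]].
  rewrite (_ : primitive_edge_vectors Q w = primitive_edge_vectors P v).
    by apply: PZ; exact: vertP av.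
  by apply/seteqP; split; apply: primitive_edge_vectors_same_fan; eassumption.
Qed.

End Delzant.

(** * The cube *)

Section Cube.
Variables (R : realType) (n : nat).
Implicit Types (a b c d : 'cV[R]_n) (x y p q u v : 'rV[R]_n) (t : R).
Implicit Types (f g : {ffun 'I_n -> bool}).

Definition cube : set 'rV[R]_n := [set x | forall i, 0 <= x 0 i <= 1].

Definition cube_vertex f : 'rV[R]_n := \row_i (f i)%:R.

Definition pos_pattern a : {ffun 'I_n -> bool} := [ffun i => 0 < a i 0].

Lemma cube_vertex_in f : cube (cube_vertex f).
Proof. by move=> i; rewrite mxE; case: (f i); rewrite ?lexx ler01. Qed.

(** The functional [a] is maximized coordinate by coordinate: [cube_gap] writes
    the gap to the maximum as a sum of these nonnegative terms. *)
Lemma cube_term a x i : cube x ->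
  0 <= (cube_vertex (pos_pattern a) 0 i - x 0 i) * a i 0.
Proof.
move=> /(_ i)/andP[x0 x1]; rewrite mxE ffunE.
have [a0|a0] := ltP 0 (a i 0).
  by rewrite mulr_ge0 ?(ltW a0)// subr_ge0.
by rewrite mulr_le0// sub0r oppr_le0.
Qed.

Lemma cube_gap a x : pairing a (cube_vertex (pos_pattern a)) - pairing a x =
  \sum_i (cube_vertex (pos_pattern a) 0 i - x 0 i) * a i 0.
Proof.
by rewrite !pairing_sum -sumrB; apply: eq_bigr => i _; rewrite mulrBl.
Qed.

Lemma cube_generated :
  cube = convex_hull [set` [seq cube_vertex f | f <- enum {ffun 'I_n -> bool}]].
Proof.
set s := [seq _ | _ <- _]; have s0 : s != [::].
  suff : cube_vertex [ffun=> false] \in s by case: s.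
  by apply: map_f; rewrite mem_enum.
apply/seteqP; split=> [x xc|]; last first.
  apply: smallest_sub => [|_ /mapP[f _ ->]]; last exact: cube_vertex_in.
  apply/convex_setE => x y t xc yc t0 t1 i.
  have /andP[x0 x1] := xc i; have /andP[y0 y1] := yc i.
  have t1' : 0 <= 1 - t by rewrite subr_ge0.
  rewrite !mxE; apply/andP; split; first by rewrite addr_ge0// mulr_ge0.
  by have := ler_wpM2l t0 x1; have := ler_wpM2l t1' y1; lra.
have sP : is_polytope (convex_hull [set` s]) by apply/polytopeP; exists s.
apply: polytope_sep => // a.
apply: (@le_trans _ _ (pairing a (cube_vertex (pos_pattern a)))).
  by rewrite -subr_ge0 cube_gap sumr_ge0// => i _; exact: cube_term.
apply: support_ge => //; apply: sub_convex_hull; apply: map_f.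
by rewrite mem_enum.
Qed.

Lemma cube_polytope : is_polytope cube.
Proof.
apply/polytopeP; exists [seq cube_vertex f | f <- enum {ffun 'I_n -> bool}].
  suff : cube_vertex [ffun=> false] \in
      [seq cube_vertex f | f <- enum {ffun 'I_n -> bool}] by case: map.
  by apply: map_f; rewrite mem_enum.
exact: cube_generated.
Qed.

Lemma cube_faceP a x : face cube a x <->
  cube x /\ forall i, a i 0 != 0 -> x 0 i = (0 < a i 0)%R%:R.
Proof.
split=> [[xc xm]|[xc xa]].
  split=> // i ai; have := xm _ (cube_vertex_in (pos_pattern a)).
  rewrite -subr_le0 cube_gap => le0.
  have /eqP : \sum_i (cube_vertex (pos_pattern a) 0 i - x 0 i) * a i 0 = 0.
    by apply: le_anti; rewrite le0 sumr_ge0// => j _; exact: cube_term.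
  rewrite psumr_eq0 => [|j _]; last exact: cube_term.
  move=> /allP/(_ i); rewrite mem_index_enum => /(_ isT)/=.
  by rewrite mulf_eq0 (negbTE ai) orbF subr_eq0 !mxE ffunE => /eqP ->.
split=> // y yc; apply: (@le_trans _ _ (pairing a (cube_vertex (pos_pattern
  a)))).
  by rewrite -subr_ge0 cube_gap sumr_ge0// => i _; exact: cube_term.
rewrite -subr_le0 cube_gap big1// => i _.
have [->|ai] := eqVneq (a i 0) 0; first by rewrite mulr0.
by rewrite xa// !mxE ffunE subrr mul0r.
Qed.

Lemma cube_face_vertex a : face cube a (cube_vertex (pos_pattern a)).
Proof.
apply/cube_faceP; split=> [|i _]; first exact: cube_vertex_in.
by rewrite mxE ffunE.
Qed.

Definition cube_edge f (j : 'I_n) : set 'rV[R]_n :=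
  [set x | cube x /\ forall i, i != j -> x 0 i = (f i)%:R].

Definition flip f (j : 'I_n) : {ffun 'I_n -> bool} :=
  [ffun i => if i == j then ~~ f i else f i].

Lemma flip_in_edge f j : cube_edge f j (cube_vertex (flip f j)).
Proof.
by split=> [|i ij]; [exact: cube_vertex_in|rewrite mxE ffunE (negbTE ij)].
Qed.

Lemma vertex_in_edge f j : cube_edge f j (cube_vertex f).
Proof. by split=> [|i ij]; [exact: cube_vertex_in|rewrite mxE]. Qed.

Lemma flip_neq f j : cube_vertex (flip f j) <> cube_vertex f.
Proof.
move=> /matrixP/(_ 0 j); rewrite !mxE ffunE eqxx => /eqP.
by case: (f j); rewrite /= ?oner_eq0 // eq_sym oner_eq0.
Qed.

Lemma cube_edge_along f j : along (cube_edge f j) (delta_mx 0 j).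
Proof.
move=> x y [_ xf] [_ yf]; exists (x 0 j - y 0 j); apply/rowP => i.
rewrite !mxE eqxx /=; have [->|ij] := eqVneq i j; first by rewrite mulr1.
by rewrite mulr0 xf// yf// subrr.
Qed.

Lemma cube_edge_face f j : exists a, cube_edge f j = face cube a.
Proof.
exists (\col_i if i == j then 0 else if f i then 1 else -1).
apply/seteqP; split=> x.
  move=> [xc xf]; apply/cube_faceP; split=> // i; rewrite mxE.
  have [ij|ij] := eqVneq i j; first by rewrite eqxx.
  by rewrite xf//; case: (f i); rewrite ?ltr01// ltr0N1.
move=> /cube_faceP[xc xf]; split=> // i ij.
have := xf i; rewrite mxE (negbTE ij).
by case: (f i); rewrite ?oner_eq0 ?oppr_eq0 ?oner_eq0 ?ltr01 ?ltr0N1 => ->.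
Qed.

Lemma cube_is_edge f j : is_edge cube (cube_edge f j).
Proof.
have [a ae] := cube_edge_face f j; apply/(is_edgeP _ cube_polytope).
exists a; rewrite -ae//.
exact: along_edge (flip_in_edge f j) (vertex_in_edge f j) (@flip_neq f j)
  (@cube_edge_along f j).
Qed.

(** The face of [b] is obtained by freeing the coordinates where [b] vanishes;
    it is an edge when there is exactly one of them. *)
Lemma cube_edgeE E f : is_edge cube E -> E (cube_vertex f) ->
  exists j, E = cube_edge f j.
Proof.
move=> /(is_edgeP _ cube_polytope)[b -> b1] fb.
have /cube_faceP[_ fbE] := fb.
have flipE j : b j 0 = 0 -> face cube b (cube_vertex (flip f j)).
  move=> bj; apply/cube_faceP; split=> [|i bi]; first exact: cube_vertex_in.
  rewrite -fbE// !mxE ffunE; case: eqVneq => // ij.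
  by move: bi; rewrite ij bj eqxx.
have /edge_dimP[x [y [xb yb xy bxy]]] := b1.
have [j bj] : exists j, b j 0 = 0.
  apply: contrapT => nb; apply: xy; apply/rowP => i.
  have bi : b i 0 != 0 by apply/eqP => bi; apply: nb; exists i.
  move: xb yb => /cube_faceP[_ xE] /cube_faceP[_ yE].
  by rewrite xE// yE.
have bj' i : i != j -> b i 0 != 0.
  move=> ij; apply/eqP => bi.
  have [t tE] := bxy _ _ (flipE j bj) fb; have [r rE] :=
    bxy _ _ (flipE i bi) fb.
  have t0 : t != 0.
    apply: contra_not_neq (@flip_neq f j) => t0; apply/eqP.
    by rewrite -subr_eq0 tE t0 scale0r.
  have : (cube_vertex (flip f i) - cube_vertex f) =
         (r / t) *: (cube_vertex (flip f j) - cube_vertex f).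
    by rewrite rE tE scalerA divfK.
  move=> /matrixP/(_ 0 i) /eqP; rewrite !mxE !ffunE eqxx (negbTE ij).
  rewrite subrr mulr0.
  by case: (f i); rewrite /= ?subr0 ?sub0r ?oppr_eq0 oner_eq0.
exists j; apply/seteqP; split=> z.
  move=> /cube_faceP[zc zE]; split=> // i /bj' bi.
  by rewrite zE// -fbE// mxE.
move=> [zc zE]; apply/cube_faceP; split=> // i bi.
rewrite zE; first by rewrite -fbE// mxE.
by apply: contra_neq bi => ->.
Qed.

Lemma cube_edge_inj f : injective (cube_edge f).
Proof.
move=> i j ij; apply: contrapT => /eqP nij.
have := flip_in_edge f i; rewrite ij => -[_ /(_ i nij)].
rewrite mxE ffunE eqxx => /eqP.
by case: (f i); rewrite /= ?oner_eq0 // eq_sym oner_eq0.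
Qed.

Lemma cube_edges_at f : edges_at cube (cube_vertex f) = range (cube_edge f).
Proof.
apply/seteqP; split=> [E [/cube_edgeE h /h[j ->]]|_ [j _ <-]];
  first by exists j.
by split; [exact: cube_is_edge|exact: vertex_in_edge].
Qed.

Lemma cube_is_vertex v : is_vertex cube v -> exists f, v = cube_vertex f.
Proof.
move=> [_ [a ve]]; exists (pos_pattern a).
by have := cube_face_vertex a; rewrite /face -ve => ->.
Qed.

Lemma primitive_axis (u : 'rV[int]_n) j : (forall i, i != j -> u 0 i = 0) ->
  primitive u <-> `|u 0 j| = 1.
Proof.
move=> u0; rewrite /primitive; set g := \big[gcdz/0]_i _.
have g0 : 0 <= g by rewrite /g; elim/big_rec: _.
have gu : (g %| u 0%R j)%Z.
  have : j \in index_enum 'I_n by rewrite mem_index_enum.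
  rewrite /g; elim: index_enum => // i r IH; rewrite big_cons in_cons.
  by move=> /predU1P[->|/IH]; [exact: dvdz_gcdl|exact: dvdz_trans (dvdz_gcdr _
    _)].
have ug : (u 0%R j %| g)%Z.
  rewrite /g; elim/big_rec: _ => [|i x _ ux]; first exact: dvdz0.
  rewrite dvdz_gcd ux andbT; have [->|ij] := eqVneq i j; first exact: dvdzz.
  by rewrite u0// dvdz0.
suff -> : `|u 0 j| = g by [].
rewrite -[RHS]ger0_norm// -!abszE; congr Posz; apply/eqP.
by rewrite eqn_dvd -!dvdzE ug gu.
Qed.

Definition inward f (j : 'I_n) : int := if f j then -1 else 1.

Lemma inward_sq f j : inward f j * inward f j = 1.
Proof. by rewrite /inward; case: (f j). Qed.

Lemma cube_primitive f : primitive_edge_vectors cube (cube_vertex f) =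
  range (fun j => inward f j *: delta_mx 0 j).
Proof.
apply/seteqP; split=> [u [pu [E [Ef [t t0 uE]]]]|_ [j _ <-]].
  move: Ef uE; rewrite cube_edges_at => -[j _ <-] [uc uE]; exists j => //.
  have u0 i : i != j -> u 0 i = 0.
    move=> ij; apply: (@intr_inj R); have /eqP := uE i ij.
    rewrite !mxE -subr_eq0 addrAC subrr add0r mulf_eq0 gt_eqF//=.
    by move=> /eqP ->.
  have uj := (primitive_axis u0).1 pu; apply/rowP => i; rewrite !mxE eqxx /=.
  have [->|ij] := eqVneq i j; last by rewrite u0// mulr0.
  rewrite mulr1; have := uc j; rewrite !mxE /inward.
  have : u 0 j = 1 \/ u 0 j = -1.
    by move/eqP: uj; rewrite eqr_norml => /andP[/orP[]/eqP -> _]; [left|right].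
  move=> [] ->; case: (f j) => //.
    by rewrite mulr1 gerDl [t <= 0]leNgt t0 andbF.
  by rewrite add0r rmorphN1 mulrN1 oppr_ge0 [t <= 0]leNgt t0.
split.
  apply/(@primitive_axis _ j) => [i ij|]; rewrite !mxE ?(negbTE ij) ?mulr0//.
  by rewrite !eqxx mulr1 /inward; case: (f j); rewrite ?normrN normr1.
exists (cube_edge f j); split; first by rewrite cube_edges_at; exists j.
exists 1 => //; rewrite scale1r; split=> i; last first.
  by move=> ij; rewrite !mxE (negbTE ij) mulr0 addr0.
rewrite !mxE eqxx /=; have [->|ij] := eqVneq i j; last first.
  by rewrite mulr0 addr0; case: (f i); rewrite ?lexx ler01.
by rewrite mulr1 /inward; case: (f j); rewrite ?subrr ?add0r ?lexx ?ler01.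
Qed.

Lemma cube_delzant : is_delzant cube.
Proof.
split.
- exact: cube_polytope.
- apply/full_dimP => c cc; apply/colP => i; rewrite !mxE.
  have := cc _ _ (cube_vertex_in [ffun k => k == i])
                 (cube_vertex_in [ffun=> false]).
  rewrite !pairing_sum => h; transitivity (\sum_k
      cube_vertex [ffun k => k == i] 0 k * c k 0).
    rewrite (bigD1 i)//= big1 ?addr0 => [|k ki]; rewrite mxE ffunE.
      by rewrite eqxx mul1r.
    by rewrite (negbTE ki) mul0r.
  by rewrite h big1// => k _; rewrite mxE ffunE mul0r.
- move=> v /cube_is_vertex[f ->]; rewrite cube_edges_at.
  apply: card_eq_trans _ (card_esym card_II).
  by apply: inj_card_eq => i j _ _; exact: cube_edge_inj.
- move=> E Ee; have /(is_edgeP _ cube_polytope)[a aE a1] := Ee.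
  have [j ->] : exists j, E = cube_edge (pos_pattern a) j.
    by apply: cube_edgeE => //; rewrite aE; exact: cube_face_vertex.
  exists (delta_mx 0 j); split.
    by apply/eqP => /matrixP/(_ 0 j)/eqP; rewrite !mxE !eqxx oner_eq0.
  rewrite map_delta_mx; exact: cube_edge_along.
- move=> v /cube_is_vertex[f ->]; rewrite cube_primitive.
  exists (fun j => inward f j *: delta_mx 0 j) => // w.
  have sumE (c : 'rV[int]_n) : \sum_i c 0 i *: (inward f i *: delta_mx 0 i) =
      (\row_i (c 0 i * inward f i) : 'rV_n).
    rewrite [RHS]row_sum_delta; apply: eq_bigr => i _.
    by rewrite mxE scalerA.
  exists (\row_i (w 0 i * inward f i)); split=> [|c].
    by rewrite sumE; apply/rowP => i; rewrite !mxE -mulrA inward_sq mulr1.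
  rewrite sumE => wE; apply/rowP => i; rewrite mxE wE mxE -mulrA.
  by rewrite inward_sq mulr1.
Qed.

(** This segment is a Minkowski summand of the cube, which is why the normal fan
    of the cube refines its normal fan. *)
Definition axis_segment (j : 'I_n) : set 'rV[R]_n :=
  convex_hull [set` [:: 0; delta_mx 0 j]].

Lemma axis_segment_polytope j : is_polytope (axis_segment j).
Proof. by apply/polytopeP; exists [:: 0; delta_mx 0 j]. Qed.

Lemma axis_segment0 j : axis_segment j 0.
Proof. by apply: sub_convex_hull; rewrite mem_head. Qed.

Lemma axis_segment1 j : axis_segment j (delta_mx 0 j).
Proof. by apply: sub_convex_hull; rewrite !inE eqxx orbT. Qed.

Lemma axis_segment_const j i : i != j -> const_on (axis_segment j) (coordv R i).
Proof.
move=> ij; rewrite -[axis_segment j]face0.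
apply: (@const_on_generators _ _ _ [:: 0; delta_mx 0 j]) => // x y.
have h z : z \in [:: 0; delta_mx 0 j] -> pairing (coordv R i) z = 0.
  rewrite !inE => /orP[] /eqP ->; rewrite pairing_coordv mxE//.
  by rewrite (negbTE ij).
by move=> /h -> /h ->.
Qed.

Lemma pairing_delta a j : pairing a (delta_mx 0 j) = a j 0.
Proof.
rewrite pairing_sum (bigD1 j)//= mxE !eqxx mul1r big1 ?addr0// => i ij.
by rewrite mxE (negbTE ij) mul0r.
Qed.

Lemma cube_refines_axis_segment j a b : fle cube a b ->
  fle (axis_segment j) a b.
Proof.
move=> ab; apply: (@fle_generators _ _ _ [:: 0; delta_mx 0 j]) => // x.
rewrite !inE => /orP[] /eqP -> [_ xm].
  have := xm _ (@axis_segment1 j); rewrite pairing_delta pairing0r => aj.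
  have /cube_faceP[_ /(_ j)] := ab _ (cube_face_vertex a).
  rewrite mxE ffunE ltNge aj /= => bj; split; first exact: axis_segment0.
  apply: convex_hull_le => y; rewrite !inE => /orP[] /eqP -> //.
  rewrite pairing_delta pairing0r leNgt; apply/negP => b0.
  by move: bj; rewrite gt_eqF// b0 => /(_ isT)/eqP; rewrite eq_sym oner_eq0.
have := xm _ (@axis_segment0 j); rewrite pairing_delta pairing0r => aj.
pose f := [ffun i => 0 <= a i 0].
have af : face cube a (cube_vertex f).
  apply/cube_faceP; split=> [|i ai]; first exact: cube_vertex_in.
  by rewrite mxE ffunE lt_neqAle eq_sym ai.
have /cube_faceP[_ /(_ j)] := ab _ af.
rewrite mxE ffunE aj => bj; split; first exact: axis_segment1.
apply: convex_hull_le => y; rewrite !inE => /orP[] /eqP -> //.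
rewrite pairing_delta pairing0r leNgt; apply/negP => b0.
by move: bj; rewrite lt_eqF// ltNge (ltW b0) => /(_ isT)/eqP; rewrite oner_eq0.
Qed.

End Cube.

(** * Secondary cones *)

Section SecondaryCone.
Variables (R : realType) (n : nat).
Implicit Types (a b c d : 'cV[R]_n) (x y p q u v w : 'rV[R]_n) (t e : R).
Implicit Types (P Q : set 'rV[R]_n) (h k : 'cV[R]_n -> R^o).

(** The defects of a support function are nonnegative, and those that vanish
    determine its normal fan. *)
Definition defect (ab : 'cV[R]_n * 'cV[R]_n) h : R :=
  h ab.1 + h ab.2 - h (ab.1 + ab.2).

Lemma defect_linear ab t h k : defect ab (t *: h + k) = t * defect ab h +
  defect ab k.
Proof.
rewrite /defect !(fctE, scalrfctE) /GRing.scale/=.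
by ring.
Qed.

Lemma defect_ge0 ab P : is_polytope P -> 0 <= defect ab (support_fun P).
Proof. by move=> PP; rewrite subr_ge0 support_leD. Qed.

Lemma defect_eq0 a b P : defect (a, b) (support_fun P) = 0 <-> additive_at P a
  b.
Proof.
rewrite /defect /additive_at /=; split=> [/eqP|->]; last by rewrite subrr.
by rewrite subr_eq0 => /eqP ->.
Qed.

(** The maximal cones of the normal fan of [P] are those of its vertices; the
    linear form of [h] on the cone of [x] is given by the point [f x], which for a
    support function [h] is the vertex corresponding to [x]. *)
Definition linear_on P h := exists f : 'rV[R]_n -> 'rV[R]_n,
  forall x a, is_vertex P x -> face P a x -> h a = pairing a (f x).

Lemma linear_on_comb P t h k : linear_on P h -> linear_on P k ->
  linear_on P (t *: h + k).
Proof.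
move=> [f fh] [g gk]; exists (fun x => t *: f x + g x) => x a Px ax.
by rewrite !pairingE -(fh x a)// -(gk x a).
Qed.

Lemma support_linear_on P Q : is_polytope Q ->
  (forall a b, fle P a b -> fle Q a b) -> linear_on P (support_fun Q).
Proof.
move=> QP PQ; have : forall x, exists w, is_vertex P x -> forall a,
  face P a x ->
    support_fun Q a = pairing a w.
  move=> x; have [[_ [d xd]]|nx] := pselect (is_vertex P x); last by exists 0.
  have [w dw] := face_neq0 d QP; exists w => _ a ax.
  apply: support_faceE; apply: (PQ d) dw => y.
  by rewrite /face -xd => ->.
by move=> /choice[f fP]; exists f => x a /fP; exact.
Qed.

Lemma vertex_list P : is_polytope P -> exists vs : seq 'rV[R]_n,
  (forall x, x \in vs -> is_vertex P x) /\
  (forall a, exists2 x, x \in vs & face P a x).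
Proof.
move=> PP; have [s [s0 PE]] := polytope_generators PP.
exists [seq x <- s | `[< is_vertex P x >]]; split=> [x|a].
  by rewrite mem_filter => /andP[/asboolP].
have [b [v [ba bv]]] := face_vertex a PP.
have [x xs xb] := hull_face b s0; rewrite -PE bv in xb.
exists v; last by apply: ba; rewrite bv.
rewrite mem_filter -{2}xb xs andbT; apply/asboolP.
by split; [exists v|exists b].
Qed.

(** The functions linear on the maximal cones form a finite-dimensional space:
    choosing a vertex for every direction, they are determined by the coordinates
    of the points [f x]. *)
Lemma linear_on_span P : is_polytope P ->
  exists m (f : 'I_m -> 'cV[R]_n -> R^o), forall h, linear_on P h ->
    in_span f h.
Proof.
move=> PP; have [vs [vsP vsa]] := vertex_list PP.
have /choice[r rP] : forall a, exists i : 'I_(size vs), face P a (nth 0 vs i).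
  move=> a; have [x /(nthP 0)[i iv <-] ax] := vsa a.
  by exists (Ordinal iv).
pose T := ('I_(size vs) * 'I_n)%type.
pose ev : 'I_#|{: T}| -> T := enum_val.
pose F (il : T) : 'cV[R]_n -> R^o := fun a => (r a == il.1)%:R * a il.2 0.
exists #|{: T}|, (fun i => F (ev i)) => h [f fh].
exists (fun i => f (nth 0 vs (ev i).1) 0 (ev i).2).
have -> : \sum_i f (nth 0 vs (ev i).1) 0 (ev i).2 *: F (ev i) =
    \sum_(il : T) f (nth 0 vs il.1) 0 il.2 *: F il.
  rewrite [RHS](reindex ev)//=.
  by apply: onW_bij; exact: enum_val_bij.
apply/funext => a; rewrite fct_sumE.
rewrite (fh _ a (vsP _ (mem_nth 0 (ltn_ord (r a)))) (rP a)) pairing_sum.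
rewrite -(pair_bigA _ (fun (i : 'I_(size vs)) (l :
  'I_n) => (f (nth 0 vs i) 0 l *: F (i, l)) a))/=.
rewrite (bigD1 (r a))//= [X in _ = _ + X]big1 ?addr0 => [|i ir].
  by apply: eq_bigr => l _; rewrite scalrfctE /F /= eqxx mul1r.
by apply: big1 => l _; rewrite scalrfctE /F /= eq_sym (negbTE ir) mul0r scaler0.
Qed.

(** The secondary cone is polyhedral.  For vertices [x] and [x'], take an
    interior direction of the normal cone of [x'] and a small multiple of an
    element [g] of the normal cone of [x], so small that their sum is still in the
    cone of [x'].  If [h] is given by the points [f x], the defect at this pair is
    a positive multiple of [<g, f x - f x'>].  By Weyl's theorem it is enough to
    let [g] run through a finite set for these numbers to be nonnegative on the
    whole normal cone of [x]; then [h] is the support function of the hull of the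
    points [f x]. *)
Lemma secondary_cone_inequalities P : is_polytope P ->
  exists Cs : seq ('cV[R]_n * 'cV[R]_n), forall h, linear_on P h ->
    (forall ab, ab \in Cs -> 0 <= defect ab h) ->
    exists Q, [/\ is_polytope Q, forall a b, fle P a b -> fle Q a b &
                  support_fun Q = h].
Proof.
move=> PP; have [vs [vsP vsa]] := vertex_list PP.
have [s [s0 PE]] := polytope_generators PP.
have /choice[dir dirP] : forall x, exists d, x \in vs -> face P d = [set x].
  move=> x; have [/vsP[_ [d xd]]|_] := boolP (x \in vs); last by exists 0.
  by exists d.
have /choice[G GP] : forall x, exists G : seq 'cV[R]_n,
    (forall g z, g \in G -> z \in [seq x - y | y <- s] -> 0 <= pairing g z) /\
    (forall y, (forall g, g \in G -> 0 <= pairing g y) ->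
      in_cone [seq x - y | y <- s] y) by move=> x; exact: weyl.
have : \forall e \near 0^'+, forall x', x' \in vs -> forall x, x \in vs ->
    forall g, g \in G x -> face P (dir x' + e *: g) x'.
  apply: near_all => x' x'vs; apply: near_all => x xvs.
  apply: near_all => g gG; apply: filterS (near_common_face (dir x') g PP).
  by move=> e [p []]; rewrite dirP// => ->.
move=> /near_exists[e e0 interior].
exists [seq (dir x', e *: xg.2) | xg <- [seq (x, g) | x <- vs, g <- G x],
  x' <- vs].
move=> h [f fh] Cs.
have Gface x g : x \in vs -> g \in G x -> face P g x.
  move=> xvs gG; split=> [|q].
    by have [_ [d xd]] := vsP x xvs; have : [set x] x by []; rewrite xd => -[].
  rewrite PE; apply: convex_hull_le => y ys.
  by have := (GP x).1 g (x - y) gG (map_f _ ys); rewrite pairingE subr_ge0.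
have dirx x : x \in vs -> face P (dir x) x by move=> xvs; rewrite dirP.
have faceZ t a x : 0 <= t -> face P a x -> face P (t *: a) x.
  move=> t0 [Px xm]; split=> // q Pq; rewrite !pairingZl.
  by rewrite ler_wpM2l// xm.
have fmax x x' a : x \in vs -> x' \in vs -> face P a x ->
    pairing a (f x') <= pairing a (f x).
  move=> xvs x'vs ax; rewrite -subr_ge0 -pairingBr.
  apply: (@in_cone_ge0 _ _ [seq x - y | y <- s]) => [_ /mapP[y ys ->]|].
    by rewrite pairingBr subr_ge0; apply: ax.2; exact: generators_sub PE _ ys.
  apply: (GP x).2 => g gG.
  have xgG : (x, g) \in [seq (x, g) | x <- vs, g <- G x].
    by apply/allpairsPdep; exists x, g.
  have /Cs : (dir x', e *: g) \in [seq (dir x', e *: xg.2) |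
      xg <- [seq (x, g) | x <- vs, g <- G x], x' <- vs].
    by apply/allpairsP; exists ((x, g), x').
  rewrite /defect /= (fh x')//; [|exact: vsP|exact: dirx].
  rewrite (fh x (e *: g))//; [|exact: vsP|]; last first.
    by apply: faceZ; rewrite ?ltW//; exact: Gface.
  rewrite (fh x' (dir x' + e *: g))//; [|exact: vsP|exact: interior xvs _ _].
  by rewrite !pairingE => h1; rewrite -(ler_pM2l e0) mulr0; lra.
pose r := [seq f x | x <- vs]; pose Q := convex_hull [set` r].
have r0 : r != [::].
  by have [x /(map_f f)] := vsa 0; rewrite -/r; case: (r).
have QP : is_polytope Q by apply/polytopeP; exists r.
have Qface x a : x \in vs -> face P a x -> face Q a (f x).
  move=> xvs ax; split; first by apply: sub_convex_hull; exact: map_f.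
  by apply: convex_hull_le => _ /mapP[x' x'vs ->]; exact: fmax.
have hQ : support_fun Q = h.
  apply/funext => a; have [x xvs ax] := vsa a.
  by rewrite (support_faceE (Qface _ _ xvs ax)) (fh x)//; exact: vsP.
exists Q; split=> //; apply/additive_fle => // a b.
rewrite /additive_at hQ => /supportD_faceP[//|p [pa pb]].
have [x xvs [Px xm]] := vsa (a + b).
have := xm p pa.1; have := pa.2 x Px; have := pb.2 x Px.
rewrite !pairingE => h1 h2 h3.
rewrite (fh x (a + b))//; [|exact: vsP].
rewrite (fh x a)//; [|exact: vsP|].
  rewrite (fh x b)//; [by rewrite pairingE|exact: vsP|].
  by split=> // q /pb.2; lra.
by split=> // q /pa.2; lra.
Qed.

(** If the strict inequalities that hold for [P] hold for [Q], then
    [h_Q - e h_P] is a support function for small [e], so [P] is up to scaling a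
    Minkowski summand of [Q] and the normal fan of [Q] refines that of [P]. *)
Lemma secondary_cone_interior P Q (Cs : seq ('cV[R]_n * 'cV[R]_n)) :
  is_polytope P -> is_polytope Q -> (forall a b, fle P a b -> fle Q a b) ->
  (forall h, linear_on P h -> (forall ab, ab \in Cs -> 0 <= defect ab h) ->
    exists Q', [/\ is_polytope Q', forall a b, fle P a b -> fle Q' a b &
                   support_fun Q' = h]) ->
  (forall ab, ab \in Cs -> 0 < defect ab (support_fun P) ->
    0 < defect ab (support_fun Q)) <-> normal_fan P = normal_fan Q.
Proof.
move=> PP QP PQ CsP; split=> [CsQ|/(normal_fan_eqP PP QP) PQE [a b] abC].
  apply/normal_fan_eqP => // a b; split; first exact: PQ.
  have : \forall e \near 0^'+, forall ab, ab \in Cs ->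
      0 <= defect ab (support_fun Q) + e * - defect ab (support_fun P).
    apply: near_all => ab abC.
    have [P0|P0] := ltP 0 (defect ab (support_fun P)).
      by near=> e; apply: ltW; near: e; apply: near_pos; exact: CsQ.
    have -> : defect ab (support_fun P) = 0.
      by apply: le_anti; rewrite P0 defect_ge0.
    by near=> e; rewrite oppr0 mulr0 addr0 defect_ge0.
  move=> /near_exists[e e0 De].
  have [|ab abC|Q' [Q'P _ Q'E]] :=
    CsP (- e *: support_fun P + support_fun Q).
  - apply: linear_on_comb; last exact: support_linear_on.
    exact: support_linear_on.
  - by rewrite defect_linear mulNr addrC -mulrN De.
  move: a b; apply/additive_fle => // a b /defect_eq0 Qab; apply/defect_eq0.
  have := defect_ge0 (a, b) Q'P; rewrite Q'E defect_linear Qab addr0 mulNr.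
  rewrite oppr_ge0 pmulr_rle0// => h; apply: le_anti.
  by rewrite h defect_ge0.
move=> P0; rewrite lt_neqAle defect_ge0// andbT eq_sym;
  apply/eqP => /defect_eq0.
have /additive_fle h : forall c d, fle Q c d -> fle P c d by move=> c d /PQE.
by move=> /(h QP PP) /defect_eq0 P0'; rewrite P0' ltxx in P0.
Unshelve. all: by end_near. Qed.

End SecondaryCone.

(** * Homotheties and normalization *)

Section Normalization.
Variables (R : realType) (n : nat).
Implicit Types (a b c d : 'cV[R]_n) (x y p q u v w : 'rV[R]_n) (t e : R).
Implicit Types (P Q : set 'rV[R]_n) (h k : 'cV[R]_n -> R^o).

Lemma homothety_hull t v P : is_polytope P ->
  is_polytope [set t *: x + v | x in P].
Proof.
move=> /polytopeP[s s0 ->]; apply/polytopeP.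
exists [seq t *: x + v | x <- s]; first by case: s s0.
have affE x y r : t *: (r *: x + (1 - r) *: y) + v =
    r *: (t *: x + v) + (1 - r) *: (t *: y + v).
  have -> : v = r *: v + (1 - r) *: v by rewrite -scalerDl addrC subrK scale1r.
  by rewrite -?scalerDl; apply/rowP => i; rewrite !mxE; ring.
apply/seteqP; split=> [_ [x xs <-]|].
  move: x xs; apply: (@smallest_sub _ _ _
    [set x | convex_hull [set` [seq t *: x + v | x <- s]] (t *: x + v)]).
    apply/convex_setE => x y r /= xs ys r0 r1 A [cA sA].
    rewrite affE; move/convex_setE: (cA); apply=> //; [exact: xs|exact: ys].
  by move=> x /= xs; apply: sub_convex_hull; exact: map_f.
apply: smallest_sub => [|_ /mapP[x xs ->]]; last first.
  by exists x => //; exact: sub_convex_hull.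
apply/convex_setE => _ _ r [x xs <-] [y ys <-] r0 r1.
exists (r *: x + (1 - r) *: y); last exact: affE.
by move=> A [cA sA]; move/convex_setE: (cA); apply=> //; [exact: xs|exact: ys].
Qed.

Lemma support_homothety t v P a : 0 <= t -> is_polytope P ->
  support_fun [set t *: x + v | x in P] a = t * support_fun P a + pairing a v.
Proof.
move=> t0 PP; have [p pa] := face_neq0 a PP.
rewrite (support_faceE pa) -pairingZr -pairingDr; apply: support_faceE.
split=> [|_ [q Pq <-]]; first by exists p; case: pa.
by rewrite !pairingE lerD2r ler_wpM2l// pa.2.
Qed.

Lemma normal_fan_homothety t v P : 0 < t -> is_polytope P ->
  normal_fan [set t *: x + v | x in P] = normal_fan P.
Proof.
move=> t0 PP; have QP := homothety_hull t v PP.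
have add a b : additive_at [set t *: x + v | x in P] a b <-> additive_at P a b.
  rewrite /additive_at !support_homothety ?ltW// pairingDl; split=> h;
    last first.
    by rewrite h; ring.
  by apply: (mulfI (lt0r_neq0 t0)); lra.
apply/normal_fan_eqP => // a b.
by split; move: a b; apply/additive_fle => // a b /add.
Qed.

(** The opposite of the lowest corner of the bounding box, when [h] is a support
    function. *)
Definition corner h : 'rV[R]_n := \row_i h (- coordv R i).

(** The sum of the sides of the bounding box.  It is linear in [h], vanishes at
    points, and is positive on the other polytopes. *)
Definition width h : R := \sum_i (h (coordv R i) + h (- coordv R i)).

(** The support function of the homothetic copy of the polytope whose bounding
    box has the origin as lowest corner and sides of total length 1.  It depends
    continuously on the values of [h]. *)
Definition normalization h : 'cV[R]_n -> R^o :=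
  fun a => (h a + pairing a (corner h)) / width h.

Definition normalized h := corner h = 0 /\ width h = 1.

Lemma normalization_id h : normalized h -> normalization h = h.
Proof.
move=> [h0 h1]; apply/funext => a.
by rewrite /normalization h0 h1 pairing0r addr0 divr1.
Qed.

Lemma pairingN_coordv i x : pairing (- coordv R i) x = - x 0 i.
Proof. by rewrite pairingNl pairing_coordv. Qed.

Lemma width_ge0 P : is_polytope P -> 0 <= width (support_fun P).
Proof.
move=> PP; apply: sumr_ge0 => i _.
by have := support_leD PP (coordv R i) (- coordv R i); rewrite subrr support0.
Qed.

Lemma width_eq0 P : is_polytope P -> width (support_fun P) = 0 ->
  exists x, support_fun P = (fun a => pairing a x) /\ P = [set x].
Proof.
move=> PP /eqP; rewrite psumr_eq0 => [/allP w0|i _]; last first.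
  by have := support_leD PP (coordv R i) (- coordv R i); rewrite subrr support0.
have [x Px] := polytope_neq0 PP; exists x.
have PE : P = [set x].
  apply/seteqP; split=> [y Py|_ ->//]; apply/rowP => i.
  have := w0 i; rewrite mem_index_enum => /(_ isT)/= /eqP.
  have := support_ge (coordv R i) PP Px; have := support_ge (coordv R i) PP Py.
  have := support_ge (- coordv R i) PP Px; have :=
    support_ge (- coordv R i) PP Py.
  rewrite !pairingN_coordv !pairing_coordv; lra.
split=> //; apply/funext => a; apply: support_faceE.
by split=> // q; rewrite PE => ->.
Qed.

Lemma width_gt0 P : is_polytope P -> ~ is_point P -> 0 < width (support_fun P).
Proof.
move=> PP Px; rewrite lt_neqAle width_ge0// andbT eq_sym.
by apply/eqP => /(width_eq0 PP)[x [_ PE]]; apply: Px; exists x.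
Qed.

Lemma width_point x : width (fun a => pairing a x : R^o) = 0.
Proof. by rewrite /width big1// => i _; rewrite pairingNl subrr. Qed.

Lemma normalization_homothety t v P : 0 < t -> is_polytope P ->
  normalization (support_fun [set t *: x + v | x in P]) =
  normalization (support_fun P).
Proof.
move=> t0 PP; apply/funext => a; rewrite /normalization.
have -> : width (support_fun [set t *: x + v | x in P]) =
    t * width (support_fun P).
  rewrite /width mulr_sumr; apply: eq_bigr => i _.
  by rewrite !support_homothety ?ltW// pairingNl; ring.
have -> : corner (support_fun [set t *: x + v | x in P]) =
    t *: corner (support_fun P) - v.
  apply/rowP => i; rewrite !mxE support_homothety ?ltW//.
  by rewrite pairingN_coordv.
rewrite support_homothety ?ltW// !pairingE.
rewrite (_ : _ + _ + _ =
    t * (support_fun P a + pairing a (corner (support_fun P)))).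
  by rewrite -mulf_div divff ?mul1r// gt_eqF.
by ring.
Qed.

Lemma normal_form P : is_polytope P -> ~ is_point P -> exists Q,
  [/\ is_polytope Q, normal_fan Q = normal_fan P,
      support_fun Q = normalization (support_fun P),
        normalized (support_fun Q) &
      exists2 c : R, 0 < c & exists v, Q = [set c *: x + v | x in P]].
Proof.
move=> PP Px; have w0 := width_gt0 PP Px; have wV :
  0 < (width (support_fun P))^-1.
  by rewrite invr_gt0.
set w := width _ in w0 wV; set m := corner (support_fun P).
exists [set w^-1 *: x + w^-1 *: m | x in P].
have QP := homothety_hull w^-1 (w^-1 *: m) PP.
have QE a : support_fun [set w^-1 *: x + w^-1 *: m | x in P] a =
    (support_fun P a + pairing a m) / w.
  by rewrite support_homothety ?ltW// pairingZr -mulrDr mulrC.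
split=> //; first exact: normal_fan_homothety.
- by apply/funext => a; rewrite QE.
- split.
    apply/rowP => i; rewrite !mxE QE pairingN_coordv mxE subrr mul0r//.
  rewrite /width (eq_bigr (fun i => (support_fun P (coordv R i) +
      support_fun P (- coordv R i)) / w)).
    by rewrite -mulr_suml divff// gt_eqF.
  move=> i _; rewrite !QE pairingN_coordv pairing_coordv; field;
    exact: lt0r_neq0.
- by exists w^-1 => //; exists (w^-1 *: m).
Qed.

(** Each of [P] and [Q] is homothetic to the polytope with the common normalized
    support function. *)
Lemma normalization_inj P Q : is_polytope P -> is_polytope Q ->
  ~ is_point P -> ~ is_point Q ->
  normalization (support_fun P) = normalization (support_fun Q) ->
  exists2 c : R, 0 < c & exists v, Q = [set c *: x + v | x in P].
Proof.
move=> PP QP Px Qx /funeqP PQ.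
have p0 := width_gt0 PP Px; have q0 := width_gt0 QP Qx.
set p := width _ in p0; set q := width (support_fun Q) in q0.
exists (q / p); first by rewrite divr_gt0.
exists ((q / p) *: corner (support_fun P) - corner (support_fun Q)).
apply: support_inj => //; first exact: homothety_hull.
apply/funext => a; rewrite support_homothety// ?divr_ge0 ?ltW// !pairingE.
have := PQ a; rewrite /normalization -/p -/q => /(congr1 ( *%R q)).
rewrite [X in _ = X]mulrC divfK ?gt_eqF// => e.
apply: (addIr (pairing a (corner (support_fun Q)))); rewrite -e.
by field; exact: lt0r_neq0.
Qed.

Lemma normalized_nonpoint P : is_polytope P -> normalized (support_fun P) ->
  ~ is_point P.
Proof.
move=> PP [_ w1] [x PE].
suff : width (support_fun P) = 0 by rewrite w1 => /eqP; rewrite oner_eq0.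
rewrite -(width_point x); congr width; apply/funext => a; apply: support_faceE.
by rewrite PE; split=> // q ->.
Qed.

End Normalization.

(** * Charts of the closed cells *)

Section Chart.
Variables (R : realType) (n : nat).
Implicit Types (a b c d : 'cV[R]_n) (p q v w : 'rV[R]_n) (t e : R).
Implicit Types (P Q : set 'rV[R]_n) (h k : 'cV[R]_n -> R^o).

(** A chart identifies the normalized support functions of a secondary cone with
    the polyhedral body [L <= 1], through the affine map [phi]; the interior
    [L < 1] corresponds to the polytopes with exactly the given normal fan.  The
    span of the secondary cone has [n + 1] more dimensions than the body because
    of the translations and of scaling. *)
Record cell_chart (N : fan R n) m (L : seq 'cV[R]_m) (phi : 'rV[R]_m ->
  'cV[R]_n -> R^o) :
    Prop := CellChart {
  chart_span :
    span_dim (@support_fun R n @` secondary_cone N) (m + n + 1)%N;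
  chart_bounded : forall x, (forall l, l \in L -> pairing l x <= 0) -> x = 0;
  chart_polytope : forall x, (forall l, l \in L -> pairing l x <= 1) ->
    exists Q, [/\ secondary_cone N Q, support_fun Q = phi x &
                  normalized (phi x)];
  chart_surj : forall Q, secondary_cone N Q ->
    normalized (support_fun Q) ->
    exists2 x, forall l, l \in L -> pairing l x <= 1 & support_fun Q = phi x;
  chart_interior : forall x Q, secondary_cone N Q ->
    support_fun Q = phi x ->
    (forall l, l \in L -> pairing l x < 1) <-> N = normal_fan Q;
  chart_inj : injective phi;
  chart_affine : exists f : 'I_m -> 'cV[R]_n -> R,
    forall x a, phi x a = phi 0 a + \sum_i x 0 i * f i a }.

Section Construction.
Variable P : set 'rV[R]_n.
Hypotheses (PP : is_polytope P) (Pn : normalized (support_fun P)).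

Lemma secondary_coneP Q : secondary_cone (normal_fan P) Q <->
  is_polytope Q /\ forall a b, fle P a b -> fle Q a b.
Proof. by split=> -[QP /(refinesP PP QP)]. Qed.

Lemma corner_linear t h k : corner (t *: h + k) = t *: corner h + corner k.
Proof. by apply/rowP => i; rewrite !mxE. Qed.

Lemma width_linear t h k : width (t *: h + k) = t * width h + width k.
Proof.
rewrite /width mulr_sumr -big_split; apply: eq_bigr => i _ /=.
by rewrite !(fctE, scalrfctE) /GRing.scale/=; ring.
Qed.

Lemma functional_comb (f : ('cV[R]_n -> R^o) -> R) m (c : 'I_m -> R)
    (e : 'I_m -> 'cV[R]_n -> R^o) h :
  (forall t h k, f (t *: h + k) = t * f h + f k) ->
  f (h + \sum_i c i *: e i) = f h + \sum_i c i * f (e i).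
Proof.
move=> fl; have f0 : f 0 = 0 by have := fl 1 0 0; rewrite scaler0 addr0; lra.
rewrite -[h in f (h + _)]scale1r fl mul1r; congr (_ + _).
elim/big_rec2: _ => // i x y _ <-; exact: fl.
Qed.

Lemma normal_comb m (c : 'I_m -> R) (e : 'I_m -> 'cV[R]_n -> R^o) h :
  (forall i, corner (e i) = 0 /\ width (e i) = 0) ->
  corner (h + \sum_i c i *: e i) = corner h /\
  width (h + \sum_i c i *: e i) = width h.
Proof.
move=> en; split; last first.
  rewrite (functional_comb (f := @width R n)); last exact: width_linear.
  by rewrite big1 ?addr0// => i _; rewrite (en i).2 mulr0.
apply/rowP => j; rewrite [LHS]mxE [RHS]mxE.
rewrite (functional_comb (f := fun h => h (- coordv R j)))//.
rewrite big1 ?addr0// => i _; have [/matrixP/(_ 0 j) + _] := en i.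
by rewrite !mxE => ->; rewrite mulr0.
Qed.

Lemma linear_on_sum h m (c : 'I_m -> R) (e : 'I_m -> 'cV[R]_n -> R^o) :
  linear_on P h -> (forall i, linear_on P (e i)) ->
  linear_on P (h + \sum_i c i *: e i).
Proof.
move=> Ph Pe; rewrite addrC; elim/big_rec: _ => [|i x _ Px];
  first by rewrite add0r.
by rewrite -addrA; exact: linear_on_comb.
Qed.

Let S : set ('cV[R]_n -> R^o) := [set k | exists Q,
  [/\ secondary_cone (normal_fan P) Q, normalized (support_fun Q) &
      k = support_fun Q - support_fun P]].

Lemma normalized_difference k : S k -> corner k = 0 /\ width k = 0.
Proof.
move=> [Q [_ [h1 h2] ->]]; have [cP wP] := Pn.
rewrite addrC -scaleN1r corner_linear width_linear.
by rewrite h1 h2 cP wP scaler0 addr0 mulr1 addNr.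
Qed.

Let lin (j : 'I_n) : 'cV[R]_n -> R^o := fun a => pairing a (delta_mx 0 j).

Lemma lin_comb p : \sum_j p 0 j *: lin j = (fun a => pairing a p).
Proof.
apply/funext => a; rewrite fct_sumE [in RHS](row_sum_delta p) pairing_sumr.
by apply: eq_bigr => j _; rewrite scalrfctE pairingZr.
Qed.

(** A polytope of the secondary cone is a translate of a multiple of a normalized
    one.  So a basis consists of the support functions of [n] points, that of [P],
    and those of the normalized polytopes [Qe i] whose differences with [P] form a
    basis of the space of the differences. *)
Lemma span_dim_support m (e : 'I_m -> 'cV[R]_n -> R^o) :
  (forall i, S (e i)) -> independent e -> (forall k, S k -> in_span e k) ->
  span_dim (@support_fun R n @` secondary_cone (normal_fan P)) (m + n + 1)%N.
Proof.
move=> Se ie spane; have /choice[Qe QeP] := Se.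
pose b (i : 'I_(m + n + 1)) : 'cV[R]_n -> R^o :=
  match fintype.split i with
  | inl j => match fintype.split j with
             | inl i => support_fun (Qe i)
             | inr j => lin j
             end
  | inr _ => support_fun P
  end.
have [cP wP] := Pn.
have sumE (c : 'I_(m + n + 1) -> R) : \sum_i c i *: b i =
    (\sum_i c (lshift 1 (lshift n i)) *: support_fun (Qe i) +
     \sum_j c (lshift 1 (rshift m j)) *: lin j) +
    c (rshift (m + n) ord0) *: support_fun P.
  rewrite !big_split_ord /= big_ord1; congr (_ + _ + _).
  - by apply: eq_bigr => i _; rewrite /b (unsplitK (inl _)) (unsplitK (inl _)).
  - by apply: eq_bigr => j _; rewrite /b (unsplitK (inl _)) (unsplitK (inr _)).
  - by rewrite /b (unsplitK (inr _)).
have Qe_sum (c : 'I_m -> R) : \sum_i c i *: support_fun (Qe i) =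
    \sum_i c i *: e i + (\sum_i c i) *: support_fun P.
  rewrite scaler_suml -big_split; apply: eq_bigr => i _ /=.
  by have [_ _ ->] := QeP i; rewrite -scalerDr subrK.
exists b; split.
- move=> i; rewrite /b; case: (fintype.split i) => [j|_]; last first.
    by exists P => //; apply/secondary_coneP.
  case: (fintype.split j) => [k|k]; first by exists (Qe k) => //; case: (QeP k).
  have XP : is_polytope [set delta_mx 0 k : 'rV[R]_n].
    exists [set delta_mx 0 k]; split=> //; first by exists (delta_mx 0 k).
    apply/seteqP; split=> [_ ->|]; first exact: sub_gen_smallest.
    apply: smallest_sub => //; apply/convex_setE => x y t -> -> _ _.
    by rewrite -scalerDl addrC subrK scale1r.
  exists [set delta_mx 0 k].
    by apply/secondary_coneP; split=> // a a' _ x [-> _]; split=> // y ->.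
  apply/funext => a; apply: support_faceE; split=> // y -> //.
- move=> c; rewrite sumE Qe_sum; set c1 := fun i => c (lshift 1 (lshift n i)).
  set c2 := fun j => c (lshift 1 (rshift m j)).
  set c3 := c (rshift (m + n) ord0).
  have -> : \sum_j c2 j *: lin j = (fun a => pairing a (\row_j c2 j)).
    by rewrite -lin_comb; apply: eq_bigr => j _; rewrite mxE.
  move=> c0.
  have {}c0 : ((\sum_i c1 i + c3) *: support_fun P +
      (fun a => pairing a (\row_j c2 j) : R^o)) + \sum_i c1 i *: e i = 0.
    by rewrite -[RHS]c0 scalerDl; apply/funext => a; rewrite !fctE; ring.
  have [] := normal_comb c1 ((\sum_i c1 i + c3) *: support_fun P +
    (fun a => pairing a (\row_j c2 j) : R^o)) (fun i => normalized_difference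
      (Se i)).
  rewrite c0 corner_linear width_linear cP wP scaler0 add0r width_point addr0.
  rewrite (_ : width 0 = 0); last by rewrite /width big1// => i _;
    rewrite addr0.
  rewrite mulr1 => c2E /esym c3E.
  have c20 j : c2 j = 0.
    move/matrixP/(_ 0 j): c2E; rewrite !mxE pairingN_coordv mxE.
    by move/esym/eqP; rewrite oppr_eq0 => /eqP.
  have c10 : forall i, c1 i = 0.
    apply: ie; rewrite -[RHS]c0 c3E scale0r add0r.
    rewrite (_ : (fun a => _) = 0) ?add0r//; apply/funext => a.
    by rewrite (_ : \row_j c2 j = 0) ?pairing0r//; apply/rowP => j;
      rewrite !mxE.
  have c30 : c3 = 0 by rewrite -[RHS]c3E big1 ?add0r// => i _.
  move=> i; rewrite -(splitK i); case: (fintype.split i) => [j|j] /=.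
    rewrite -(splitK j); case: (fintype.split j) => [k|k] /=; first exact: c10.
    exact: c20.
  by rewrite (ord1 j).
move=> _ [Q /secondary_coneP[QP PQ] <-].
pose cf (c1 : 'I_m -> R) (c2 : 'I_n -> R) (c3 : R) (i : 'I_(m + n + 1)) :=
  match fintype.split i with
  | inl j => match fintype.split j with inl i => c1 i | inr j => c2 j end
  | inr _ => c3
  end.
have cfE (c1 : 'I_m -> R) p (c3 : R) : \sum_i cf c1 (fun j => p 0 j) c3 i *: b
  i =
    \sum_i c1 i *: e i + (\sum_i c1 i + c3) *: support_fun P +
    (fun a => pairing a p : R^o).
  rewrite sumE /cf (unsplitK (inr _)).
  under eq_bigr do rewrite (unsplitK (inl _)) (unsplitK (inl _)).
  under [X in _ + X + _]eq_bigr do rewrite (unsplitK (inl _)) (unsplitK (inr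
    _)).
  by rewrite Qe_sum lin_comb scalerDl; apply/funext => a; rewrite !fctE; ring.
have [Qx|Qx] := pselect (is_point Q).
  have [p ->] : exists p, support_fun Q = (fun a => pairing a p).
    have [p QE] := Qx; exists p; apply/funext => a; apply: support_faceE.
    by rewrite QE; split=> // q ->.
  exists (cf (fun=> 0) (fun j => p 0 j) 0); rewrite cfE.
  rewrite big1 => [|i _]; last by rewrite scale0r.
  by rewrite big1// addr0 scale0r !add0r.
have [Q' [Q'P Q'N Q'E Q'n _]] := normal_form QP Qx.
have [|c cE] := spane (support_fun Q' - support_fun P).
  exists Q'; split=> //; split=> //; rewrite Q'N.
  exact/refinesP.
have w0 := width_gt0 QP Qx; set w := width _ in w0.
exists (cf (fun i => w * c i) (fun j => (- corner (support_fun Q)) 0 j)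
  (w * (1 - \sum_i c i))).
rewrite cfE -mulr_sumr -mulrDr addrC [\sum_i c i + _]addrC subrK mulr1.
under eq_bigr do rewrite -scalerA; rewrite -scaler_sumr -cE -scalerDr subrK Q'E.
apply/funext => a; rewrite !fctE /normalization -/w /GRing.scale/=.
by rewrite mulrC divfK ?gt_eqF// pairingNr addrC addrK.
Qed.

(** The body is centred at [P]: [phi x] is the support function of [P] plus a
    combination of a basis [e] of the differences of normalized support
    functions.  A defect that is positive at [P] becomes, after division by its
    value there, an inequality [<l, x> <= 1]; the other defects vanish on the
    whole secondary cone.  The body is bounded because a direction of recession
    would be a support function of width 0, hence that of the origin. *)
Lemma cell_chart_normalized : exists m (L : seq 'cV[R]_m) phi,
  cell_chart (normal_fan P) L phi.
Proof.
have hP : linear_on P (support_fun P) by exact: support_linear_on.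
have Slin k : S k -> linear_on P k.
  move=> [Q [/secondary_coneP[QP PQ] _ ->]]; rewrite addrC -scaleN1r.
  by apply: linear_on_comb => //; exact: support_linear_on.
have [q [f fspan]] := linear_on_span PP.
have [m _ [e [Se ie spane]]] := span_dim_exists (fun k Sk => fspan k (Slin k
  Sk)).
have [Cs CsP] := secondary_cone_inequalities PP.
have elin i := Slin _ (Se i).
have /choice[Qe QeP] := Se.
pose D ab := defect ab (support_fun P).
pose l ab : 'cV[R]_m := \col_i (- defect ab (e i) / D ab).
pose L := [seq l ab | ab <- Cs & 0 < D ab].
pose phi (x : 'rV[R]_m) : 'cV[R]_n -> R^o :=
  support_fun P + \sum_i x 0 i *: e i.
have lE ab (x : 'rV_m) : 0 < D ab ->
    \sum_i x 0 i * defect ab (e i) = - D ab * pairing (l ab) x.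
  move=> D0; rewrite pairing_sum mulr_sumr; apply: eq_bigr => i _.
  by rewrite mxE; field; rewrite gt_eqF.
have D_e0 ab : D ab = 0 -> forall i, defect ab (e i) = 0.
  case: ab => a b /defect_eq0 Pab i.
  have [/secondary_coneP[QP PQ] _ ->] := QeP i.
  rewrite -scaleN1r addrC defect_linear (defect_eq0 _ _ _).2// mulr0 add0r.
  by apply/defect_eq0; exact: ((additive_fle PP QP).2 PQ).
have D_cases ab : D ab = 0 \/ 0 < D ab.
  by rewrite /D; have := defect_ge0 ab PP; rewrite le_eqVlt eq_sym =>
    /orP[/eqP|];
    [left|right].
have LP (Z : 'cV_m -> Prop) : (forall l, l \in L -> Z l) <->
    (forall ab, ab \in Cs -> 0 < D ab -> Z (l ab)).
  split=> [h ab abC D0|h _ /mapP[ab + ->]].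
    by apply: h; apply: map_f; rewrite mem_filter D0.
  by rewrite mem_filter => /andP[]; auto.
have dphi ab x : defect ab (phi x) = D ab + \sum_i x 0 i * defect ab (e i).
  by apply: functional_comb => t h k; exact: defect_linear.
have dphi0 ab x : D ab = 0 -> defect ab (phi x) = 0.
  by move=> D0; rewrite dphi D0 add0r big1// => i _; rewrite D_e0 ?mulr0.
have dphiL ab x : 0 < D ab -> defect ab (phi x) = D ab * (1 - pairing (l ab) x).
  by move=> D0; rewrite dphi lE//; ring.
have sum_n (x : 'I_m -> R) h := @normal_comb _ x e h
  (fun i => normalized_difference (Se i)).
have phin x : normalized (phi x).
  by have [h1 h2] := sum_n (fun i => x 0 i) (support_fun P);
    rewrite /normalized h1 h2.
exists m, L, phi; split.
- exact: span_dim_support Se ie spane.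
- move=> x /(LP (fun l => pairing l x <= 0)) xL.
  pose u : 'cV[R]_n -> R^o := 0 + \sum_i x 0 i *: e i.
  have [|ab abC|Q [QP _ Qu]] := CsP u.
  + by apply: linear_on_sum => //; exists (fun=> 0) => *; rewrite pairing0r.
  + rewrite (functional_comb (f := defect ab)); last exact: defect_linear.
    rewrite (_ : defect ab 0 = 0) ?add0r; last by rewrite /defect/= addr0 subrr.
    have [D0|D0] := D_cases ab; first by rewrite big1// => i _;
      rewrite D_e0 ?mulr0.
    by rewrite lE// mulNr oppr_ge0 pmulr_rle0// xL.
  have [c0 w0] := sum_n (fun i => x 0 i) 0.
  have w0' : width (support_fun Q) = 0.
    by rewrite Qu w0 /width big1// => i _; rewrite addr0.
  have [p [hQ _]] := width_eq0 QP w0'.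
  have p0 : p = 0.
    apply/rowP => i; move/matrixP/(_ 0 i): c0; rewrite -/u -Qu hQ !mxE.
    by rewrite pairingN_coordv => /eqP; rewrite oppr_eq0 => /eqP.
  apply/rowP => i; rewrite mxE; move: i; apply: ie.
  rewrite -[LHS]add0r -/u -Qu hQ p0; apply/funext => a; exact: pairing0r.
- move=> x /(LP (fun l => pairing l x <= 1)) xL.
  have [|ab abC|Q [QP PQ Qphi]] := CsP (phi x).
  + exact: linear_on_sum.
  + have [D0|D0] := D_cases ab; first by rewrite dphi0.
    by rewrite dphiL// pmulr_rge0// subr_ge0 xL.
  by exists Q; split=> //; apply/secondary_coneP.
- move=> Q QK Qn; have [|c cE] := spane (support_fun Q - support_fun P).
    by exists Q.
  have QE : support_fun Q = phi (\row_i c i).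
    rewrite /phi; under eq_bigr do rewrite mxE.
    by rewrite -cE addrC subrK.
  exists (\row_i c i) => //; apply/(LP (fun l => pairing l _ <= 1)) => ab abC
    D0.
  have [QP _] := QK; have := defect_ge0 ab QP.
  by rewrite QE dphiL// pmulr_rge0// subr_ge0.
- move=> x Q /secondary_coneP[QP PQ] QE.
  rewrite -(secondary_cone_interior PP QP PQ CsP).
  rewrite (LP (fun l => pairing l x < 1)); split=> h ab abC D0.
    by rewrite QE dphiL// mulr_gt0// subr_gt0 h.
  by have := h ab abC D0; rewrite QE dphiL// pmulr_rgt0// subr_gt0.
- move=> x y /addrI xy; apply/rowP => i; apply/eqP; rewrite -subr_eq0;
  apply/eqP.
  move: i; apply: ie; under eq_bigr do rewrite scalerBl.
  by rewrite sumrB xy subrr.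
- exists e => x a; rewrite /phi !fctE fct_sumE.
  rewrite [in RHS]big1 ?addr0 => [|i _]; last by rewrite mxE scale0r.
  by congr (_ + _); apply: eq_bigr => i _; rewrite scalrfctE.
Qed.

End Construction.

Lemma cell_chart_exists P : is_polytope P -> ~ is_point P ->
  exists m (L : seq 'cV[R]_m) phi, cell_chart (normal_fan P) L phi.
Proof.
move=> PP Px; have [Q [QP <- _ Qn _]] := normal_form PP Px.
exact: cell_chart_normalized.
Qed.

End Chart.

(** * Polyhedral bodies are balls *)

Section Ball.
Variables (R : realType) (m : nat).
Implicit Types (x y : 'rV[R]_m) (t : R).

(** The norm [`|x|] of row vectors is the sup norm; disks are Euclidean. *)
Definition enorm x : R := Num.sqrt (\sum_i x 0 i ^+ 2).

Lemma sum_sqr_ge0 x : 0 <= \sum_i x 0 i ^+ 2.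
Proof. by rewrite sumr_ge0// => i _; exact: sqr_ge0. Qed.

Lemma enorm_ge0 x : 0 <= enorm x. Proof. exact: sqrtr_ge0. Qed.

Lemma enormZ t x : 0 <= t -> enorm (t *: x) = t * enorm x.
Proof.
move=> t0; rewrite /enorm -[in RHS](ger0_norm t0) -sqrtr_sqr -sqrtrM ?sqr_ge0//.
by congr Num.sqrt; rewrite mulr_sumr; apply: eq_bigr => i _; rewrite mxE exprMn.
Qed.

Lemma enorm_eq0 x : enorm x = 0 -> x = 0.
Proof.
move=> /eqP; rewrite sqrtr_eq0 => le0; apply/rowP => i; rewrite mxE.
have : \sum_i x 0 i ^+ 2 == 0 by rewrite eq_le le0 sum_sqr_ge0.
rewrite psumr_eq0 => [|j _]; last exact: sqr_ge0.
move=> /allP/(_ i); rewrite mem_index_enum => /(_ isT)/=.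
by rewrite sqrf_eq0 => /eqP.
Qed.

Lemma enorm0 : enorm 0 = 0.
Proof. by rewrite /enorm big1 ?sqrtr0// => i _; rewrite mxE expr0n. Qed.

Lemma closed_diskP x : closed_disk x <-> enorm x <= 1.
Proof.
rewrite /closed_disk /= -[in enorm x <= 1]sqrtr1 ler_psqrt ?nnegrE//.
exact: sum_sqr_ge0.
Qed.

Lemma open_diskP x : open_disk x <-> enorm x < 1.
Proof. by rewrite /open_disk /= -[in enorm x < 1]sqrtr1 ltr_sqrt. Qed.

Lemma continuous_sumr (T : topologicalType) (I : Type) (r : seq I)
    (f : I -> T -> R) : (forall i, continuous (f i)) ->
  continuous (fun z : T => \sum_(i <- r) f i z).
Proof.
move=> fc x; elim: r => [|i r IH].
  have -> : (fun z : T => \sum_(j <- [::]) f j z) = fun=> 0.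
    by apply/funext => z; rewrite big_nil.
  exact: cst_continuous.
have -> : (fun z : T => \sum_(j <- i :: r) f j z) =
    (fun z => f i z + \sum_(j <- r) f j z).
  by apply/funext => z; rewrite big_cons.
by apply: cvgD; [exact: fc|exact: IH].
Qed.

Lemma pairing_continuous (l : 'cV[R]_m) : continuous (pairing l).
Proof.
have -> : pairing l = fun x => \sum_i x 0 i * l i 0.
  by apply/funext => x; exact: pairing_sum.
apply: continuous_sumr => i x.
exact: (cvgM (@coord_continuous _ _ _ 0 i x) (cvg_cst (l i 0))).
Qed.

Lemma enorm_continuous : continuous enorm.
Proof.
move=> x; apply: (@continuous_comp _ _ _ (fun x => \sum_i x 0 i ^+ 2) Num.sqrt).
  apply: continuous_sumr => i {}x.
  exact: (cvgM (@coord_continuous _ _ _ 0 i x) (@coord_continuous _ _ _ 0 i x)).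
exact: sqrt_continuous.
Qed.

Section Gauge.
Variable L : seq 'cV[R]_m.

(** The Minkowski gauge of the body [L <= 1]; it is explicit and continuous
    because the body is polyhedral. *)
Definition gauge x : R := \big[Num.max/0]_(l <- L) pairing l x.

Lemma gauge_ge0 x : 0 <= gauge x.
Proof. exact: bigmax_ge_id. Qed.

Lemma gauge_leP x t : 0 <= t ->
  gauge x <= t <-> forall l, l \in L -> pairing l x <= t.
Proof.
move=> t0; rewrite /gauge; elim: L => [|l s IH]; first by rewrite big_nil.
rewrite big_cons ge_max; split=> [/andP[lx /IH h] k|h].
  by rewrite in_cons => /predU1P[->|/h].
rewrite h ?mem_head//=; apply/IH => k ks; apply: h.
by rewrite in_cons ks orbT.
Qed.

Lemma gauge_ltP x t : 0 < t ->
  gauge x < t <-> forall l, l \in L -> pairing l x < t.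
Proof.
move=> t0; rewrite /gauge; elim: L => [|l s IH]; first by rewrite big_nil.
rewrite big_cons gt_max; split=> [/andP[lx /IH h] k|h].
  by rewrite in_cons => /predU1P[->|/h].
rewrite h ?mem_head//=; apply/IH => k ks; apply: h.
by rewrite in_cons ks orbT.
Qed.

Lemma gaugeZ t x : 0 <= t -> gauge (t *: x) = t * gauge x.
Proof.
move=> t0; rewrite /gauge; elim: L => [|l s IH];
  first by rewrite !big_nil mulr0.
by rewrite !big_cons IH pairingZr maxr_pMr.
Qed.

Lemma gauge_continuous : continuous gauge.
Proof.
rewrite /gauge; elim: L => [|l s IH] x.
  have -> : (fun x => \big[Num.max/0]_(k <- [::]) pairing k x) = fun=> 0.
    by apply/funext => z; rewrite big_nil.
  exact: cst_continuous.
have -> : (fun x => \big[Num.max/0]_(k <- l :: s) pairing k x) =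
    (pairing l \max (fun x => \big[Num.max/0]_(k <- s) pairing k x)).
  by apply/funext => z; rewrite big_cons.
by apply: continuous_max; [exact: pairing_continuous|exact: IH].
Qed.

Hypothesis bounded : forall x, (forall l, l \in L -> pairing l x <= 0) -> x = 0.

Lemma gauge_gt0 x : x != 0 -> 0 < gauge x.
Proof.
move=> x0; rewrite lt_neqAle gauge_ge0 andbT eq_sym; apply: contra_neq x0 => gx.
by apply: bounded; apply/gauge_leP; rewrite ?gx.
Qed.

Lemma gauge0 : gauge 0 = 0.
Proof. by rewrite -(scale0r 0) gaugeZ// mul0r. Qed.

(** Compactness of the unit sphere; this gives continuity of [radial] at 0. *)
Lemma gauge_norm : exists2 c, 0 < c & forall x, c * `|x| <= gauge x.
Proof.
pose S : set 'rV[R]_m := [set x | `|x| = 1].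
have [S0|/set0P S0] := eqVneq S set0.
  exists 1 => // x; have [->|x0] := eqVneq x 0;
    first by rewrite normr0 mulr0 gauge_ge0.
  suff : S (`|x|^-1 *: x) by rewrite S0.
  by rewrite /S /= normrZ normfV normr_id mulVf// normr_eq0.
have cS : compact S.
  apply: bounded_closed_compact.
    by exists 1; split=> // M M1 x /= ->; exact: ltW.
  apply: (@closed_comp _ _ (fun x : 'rV[R]_m => `|x|) [set 1]).
    by move=> x _; exact: norm_continuous.
  exact: closed_eq.
have [|z zS zmin] := @EVT_min_rV _ _ gauge S S0 cS.
  by apply: continuous_subspaceT; exact: gauge_continuous.
have z1 : `|z| = 1 by move: zS; rewrite inE.
exists (gauge z); first by apply: gauge_gt0; rewrite -normr_eq0 z1 oner_eq0.
move=> x; have [->|x0] := eqVneq x 0; first by rewrite normr0 mulr0 gauge_ge0.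
have nx0 : 0 < `|x| by rewrite normr_gt0.
have := zmin (`|x|^-1 *: x); rewrite inE /S /= normrZ normfV normr_id.
rewrite mulVf ?gt_eqF// gaugeZ ?invr_ge0// => /(_ erefl).
by rewrite ler_pdivlMl// mulrC.
Qed.

(** Rescaling each ray turns the Euclidean norm into the gauge, hence the disk
    into the body [L <= 1].  At the origin both ratios are [0 / 0 = 0]. *)
Definition radial x : 'rV[R]_m := (enorm x / gauge x) *: x.

Definition radial_inv x : 'rV[R]_m := (gauge x / enorm x) *: x.

Lemma radial0 : radial 0 = 0.
Proof. by rewrite /radial scaler0. Qed.

Lemma gauge_radial x : gauge (radial x) = enorm x.
Proof.
have [->|x0] := eqVneq x 0; first by rewrite radial0 gauge0 enorm0.
rewrite gaugeZ ?divr_ge0 ?enorm_ge0 ?gauge_ge0// divfK// gt_eqF//.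
exact: gauge_gt0.
Qed.

Lemma enorm_neq0 x : x != 0 -> enorm x != 0.
Proof. by apply: contra_neq => /enorm_eq0. Qed.

Lemma radialK : cancel radial radial_inv.
Proof.
move=> x; rewrite /radial_inv gauge_radial /radial.
have [->|x0] := eqVneq x 0; first by rewrite !scaler0.
rewrite enormZ ?divr_ge0 ?enorm_ge0 ?gauge_ge0// scalerA.
have := enorm_neq0 x0; have := gauge_gt0 x0.
move=> /lt0r_neq0 g0 e0; rewrite -[RHS]scale1r; congr (_ *: _); field.
by rewrite g0 e0.
Qed.

Lemma radial_invK : cancel radial_inv radial.
Proof.
move=> x; rewrite /radial /radial_inv.
have [->|x0] := eqVneq x 0; first by rewrite !scaler0.
rewrite enormZ ?gaugeZ ?divr_ge0 ?enorm_ge0 ?gauge_ge0// scalerA.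
have := enorm_neq0 x0; have := gauge_gt0 x0.
move=> /lt0r_neq0 g0 e0; rewrite -[RHS]scale1r; congr (_ *: _); field.
by rewrite e0 g0.
Qed.

Lemma radial_continuous : continuous radial.
Proof.
move=> x; have [->|x0] := eqVneq x 0; last first.
  have gx : gauge x != 0 by rewrite gt_eqF// gauge_gt0.
  exact: (cvgZ (cvgM (@enorm_continuous x) (cvgV gx (@gauge_continuous x)))
    cvg_id).
rewrite /continuous_at radial0; have [c c0 cg] := gauge_norm.
suff nr0 : `|radial y| @[y --> (0 : 'rV[R]_m)] --> (0 : R).
  exact: (norm_cvg0P (F := nbhs (0 : 'rV[R]_m)) radial).1 nr0.
apply: (@squeeze_cvgr _ (nbhs (0 : 'rV[R]_m)) _ R (fun=> 0)
  (fun x => c^-1 * enorm x)).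
- near=> y; rewrite normr_ge0 /=; have [->|y0] := eqVneq y 0.
    by rewrite radial0 normr0 mulr_ge0 ?enorm_ge0// invr_ge0 ltW.
  have g0 := gauge_gt0 y0.
  rewrite /radial normrZ ger0_norm ?divr_ge0 ?enorm_ge0 ?gauge_ge0//.
  rewrite [leLHS]mulrAC ler_pdivrMr// [c^-1 * _]mulrC -mulrA ler_wpM2l
    ?enorm_ge0// ler_pdivlMl//.
- exact: cvg_cst.
- rewrite -[X in _ --> X](mulr0 c^-1) -enorm0.
  exact: (cvgM (cvg_cst c^-1) (@enorm_continuous 0)).
Unshelve. all: by end_near. Qed.

Lemma radial_closed_disk x :
  closed_disk x <-> forall l, l \in L -> pairing l (radial x) <= 1.
Proof. by rewrite closed_diskP -gauge_radial; exact: gauge_leP. Qed.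

Lemma radial_open_disk x :
  open_disk x <-> forall l, l \in L -> pairing l (radial x) < 1.
Proof. by rewrite open_diskP -gauge_radial; exact: gauge_ltP. Qed.

End Gauge.

End Ball.

(** * Topology of the quotient *)

Section CompactEmbedding.
Variables (X Y : topologicalType).

(** The inverse is continuous because [f] maps closed subsets of [A], which are
    compact, to compact and hence closed sets. *)
Lemma compact_homeo_on (x0 : X) (A : set X) (f : X -> Y) :
  hausdorff_space Y -> compact A -> {within A, continuous f} ->
  {in A &, injective f} -> homeo_on A (f @` A) f.
Proof.
move=> hY cA fc fi; split=> //.
pose g y := xget x0 [set x | A x /\ f x = y].
have gf : {in A, cancel f g}.
  move=> x; rewrite inE => Ax; have := @xgetPex _ x0 [set z | A z /\ f z = f x].
  move=> [|Agx fgx]; first by exists x.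
  by apply: fi; rewrite ?inE.
exists g; split=> //; apply/continuousP => U oU; rewrite -[X in open X]setCK.
apply/closed_openC/closed_subspaceP; exists (f @` (A `&` ~` U)).
  apply: compact_closed => //; apply: continuous_compact.
    by apply: continuous_subspaceW fc => x [].
  by apply: compact_closedI => //; exact: open_closedC.
apply/seteqP; split=> [_ [[x [Ax Ux] <-] _]|y [Uy [x Ax fx]]].
  split; last by exists x.
  by move=> Ugx; apply: Ux; move: Ugx; rewrite /preimage /from_subspace/= gf
    ?inE.
split; last by exists x.
exists x => //; split=> // Ux; apply: Uy.
by rewrite /preimage /from_subspace /= -fx gf ?inE.
Qed.

End CompactEmbedding.

Lemma hausdorff_separated (R : realType) (X : topologicalType) :
  (forall x y : X, (forall f : X -> R, continuous f -> f x = f y) -> x = y) ->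
  hausdorff_space X.
Proof.
move=> sep x y xy; apply: sep => f fc.
apply: (@Rhausdorff R) => A B fxA fyB.
have [z [Az Bz]] := xy _ _ (fc x _ fxA) (fc y _ fyB).
by exists (f z).
Qed.

Section Quotient.
Variables (R : realType) (n : nat).
Implicit Types (a b : 'cV[R]_n) (P Q : polytopes R n) (N : fan R n).

Lemma polytopesP P : is_polytope (\val P) /\ ~ is_point (\val P).
Proof. by have := valP P; rewrite inE. Qed.

Definition to_polytopes (P : set 'rV[R]_n) (PP : is_polytope P)
    (Px : ~ is_point P) : polytopes R n :=
  exist _ P (mem_set (conj PP Px)).

Lemma support_eval_continuous a :
  continuous (fun P : polytopes R n => support_fun (\val P) a : R).
Proof.
move=> P.
have := @initial_continuous (polytopes R n) {ptws 'cV[R]_n -> R}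
  (fun P => support_fun (\val P)) P.
move=> h; exact: (cvg_comp _ _ h (@proj_continuous _ (fun=> R) a _)).
Qed.

Lemma continuous_polytopes (T : topologicalType) (f : T -> polytopes R n) :
  (forall a, continuous (fun x => support_fun (\val (f x)) a : R)) ->
  continuous f.
Proof.
move=> fa; apply: (@continuous_comp_initial _ T {ptws 'cV[R]_n -> R}
  (fun P : polytopes R n => support_fun (\val P))) => x.
apply/pointwise_cvgP => a; exact: fa.
Qed.

Lemma homothety_class_eq P Q : homothety_class P = homothety_class Q <->
  exists2 c : R, 0 < c & exists v, \val Q = [set c *: x + v | x in \val P].
Proof.
split=> [/eqquotP/asboolP//|h]; apply/eqquotP; exact/asboolP.
Qed.

Lemma homothety_class_normalization P Q :
  homothety_class P = homothety_class Q <->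
  normalization (support_fun (\val P)) = normalization (support_fun (\val Q)).
Proof.
have [PP Px] := polytopesP P; have [QP Qx] := polytopesP Q.
rewrite homothety_class_eq; split=> [[c c0 [v ->]]|].
  by rewrite normalization_homothety.
exact: normalization_inj.
Qed.

Lemma normal_fan_class P Q : homothety_class P = homothety_class Q ->
  normal_fan (\val P) = normal_fan (\val Q).
Proof.
move=> /homothety_class_eq[c c0 [v ->]].
by rewrite normal_fan_homothety//; case: (polytopesP P).
Qed.

Lemma Ptilde_continuous (T : topologicalType) (f : Ptilde R n -> T) :
  continuous (fun P => f (homothety_class P)) -> continuous f.
Proof.
move=> fc; apply/continuousP => U oU; apply/CW_openE => N _.
by apply: open_subspaceW; move/continuousP: fc; exact.
Qed.

Lemma homothety_class_surj (x : Ptilde R n) : exists P, homothety_class P = x.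
Proof. by exists (repr x); exact: reprK. Qed.

Lemma normalization_continuous a : continuous
  (fun P : polytopes R n => normalization (support_fun (\val P)) a : R).
Proof.
have corner_cont : continuous
    (fun P : polytopes R n => pairing a (corner (support_fun (\val P)))).
  under eq_fun do rewrite pairing_sum.
  apply: continuous_sumr => i P; under eq_fun do rewrite mxE.
  exact: (cvgM (@support_eval_continuous (- coordv R i) P) (cvg_cst (a i 0))).
have width_cont : continuous
    (fun P : polytopes R n => width (support_fun (\val P))).
  apply: continuous_sumr => i P.
  exact: (cvgD (@support_eval_continuous (coordv R i) P)
               (@support_eval_continuous (- coordv R i) P)).
move=> P; have [PP Px] := polytopesP P.
have w0 : width (support_fun (\val P)) != 0 by rewrite gt_eqF// width_gt0.
exact: (cvgM (cvgD (@support_eval_continuous a P) (corner_cont P))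
             (cvgV w0 (width_cont P))).
Qed.

(** The values of the normalized support function are continuous on the quotient
    and separate its points. *)
Lemma Ptilde_hausdorff : hausdorff_space (Ptilde R n).
Proof.
apply: (@hausdorff_separated R) => x y xy.
have [P PE] := homothety_class_surj x; have [Q QE] := homothety_class_surj y.
rewrite -PE -QE; apply/homothety_class_normalization/funext => a.
pose F (z : Ptilde R n) : R := normalization (support_fun (\val (repr z))) a.
have FE P' : F (homothety_class P') = normalization (support_fun (\val P')) a.
  rewrite /F; suff -> : normalization (support_fun (\val (repr (homothety_class
    P')))) =
    normalization (support_fun (\val P')) by [].
  by apply/homothety_class_normalization; exact: reprK.
rewrite -!FE PE QE; apply: (xy F); apply: Ptilde_continuous.
rewrite (_ : (fun P => _) = fun P => normalization (support_fun (\val P)) a).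
  exact: normalization_continuous.
by apply/funext => P'; exact: FE.
Qed.

End Quotient.

(** * Characteristic maps *)

Section Cells.
Variables (R : realType) (n : nat).
Implicit Types (a b : 'cV[R]_n) (P Q : polytopes R n) (N : fan R n).

Lemma closed_disk_compact m : compact (@closed_disk R m).
Proof.
apply: bounded_closed_compact.
  exists 1; split=> // M M1 x xd; apply: le_trans (ltW M1).
  have [->|/mx_norm_neq0[i xE]] := eqVneq `|x| 0; first exact: ler01.
  rewrite [`|x|]xE -ler_sqr ?nnegrE// real_normK ?num_real// expr1n ord1.
  by apply: le_trans xd; rewrite (bigD1 i.2)//= lerDl sumr_ge0// => j _;
    exact: sqr_ge0.
rewrite (_ : @closed_disk R m = @enorm R m @^-1` [set t | t <= 1]).
  apply: closed_comp; last exact: closed_le.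
  by move=> x _; exact: enorm_continuous.
by apply/seteqP; split=> x /closed_diskP.
Qed.

Lemma open_sub_closed_disk m : @open_disk R m `<=` @closed_disk R m.
Proof. by move=> x /open_diskP x1; apply/closed_diskP; exact: ltW. Qed.

(** The map is [radial], followed by the chart and by the choice of the polytope
    with the given support function.  The last map is continuous because the
    topology of polytopes is that of pointwise convergence of support
    functions.  Sets that are open for the quotient topology of the closed cell
    have open preimages, which is more than continuity. *)
Lemma cell_map N m (L : seq 'cV[R]_m) phi (P0 : polytopes R n) :
  cell_chart N L phi ->
  exists F : 'rV[R]_m -> Ptilde R n,
    [/\ forall U, open (@homothety_class R n @^-1` U :
      set (subspace (punctured_cone N))) ->
          open (F @^-1` U : set (subspace (@closed_disk R m))),
        {in @closed_disk R m &, injective F},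
        F @` @closed_disk R m = closed_cell N &
        F @` @open_disk R m = open_cell N].
Proof.
move=> [_ Lb Lpol Lsurj Lint phi_inj [f phiE]].
have rK := radialK Lb; have rVK := radial_invK Lb.
have diskP x := radial_closed_disk Lb x.
have odiskP x := radial_open_disk Lb x.
have /choice[pol polP] : forall x : 'rV[R]_m, exists P, closed_disk x ->
    secondary_cone N (\val P) /\ support_fun (\val P) = phi (radial L x).
  move=> x; have [/diskP/Lpol[Q [QN Qphi phin]]|nx] := pselect (closed_disk x).
    have Qx : ~ is_point Q by apply: normalized_nonpoint;
      [case: QN|rewrite Qphi].
    by exists (to_polytopes QN.1 Qx).
  by exists P0.
have phin x : closed_disk x -> normalized (phi (radial L x)).
  by move=> /diskP/Lpol[Q []].
have phi_cont a : continuous (fun x => phi (radial L x) a : R).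
  have sum_cont : continuous (fun x => \sum_i radial L x 0 i * f i a).
    apply: continuous_sumr => i x.
    have rc : (fun z => radial L z 0 i) @ x --> radial L x 0 i.
      exact: (continuous_comp (radial_continuous Lb (x:=x))
        (@coord_continuous _ _ _ 0 i (radial L x))).
    exact: (cvgM rc (cvg_cst (f i a))).
  rewrite (_ : (fun x => _) =
      (fun x => phi 0 a + \sum_i radial L x 0 i * f i a)).
    by move=> x; exact: (cvgD (cvg_cst (phi 0 a)) (sum_cont x)).
  by apply/funext => x; exact: phiE.
have pol_cont : {within @closed_disk R m, continuous pol}.
  apply: continuous_polytopes => a.
  apply: (@subspace_eq_continuous _ _ _ (fun x => phi (radial L x) a)).
    by move=> x; rewrite inE => /polP[_ ->].
  exact: continuous_subspaceT.
pose F x := homothety_class (pol x).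
have FN x Q : closed_disk x -> homothety_class Q = F x ->
    normalization (support_fun (\val Q)) = phi (radial L x).
  move=> xd /homothety_class_normalization ->.
  by have [_ ->] := polP x xd; rewrite normalization_id//; exact: phin.
have FK Q x : closed_disk x ->
    normalization (support_fun (\val Q)) = phi (radial L x) ->
    F x = homothety_class Q.
  move=> xd Qx; apply/esym/homothety_class_normalization; rewrite Qx.
  by have [_ ->] := polP x xd; rewrite normalization_id//; exact: phin.
exists F; split.
- move=> U /open_subspaceP[V oV VE]; rewrite open_subspaceP.
  have /continuousP/(_ _ oV)/open_subspaceP[W oW WE] := pol_cont.
  exists W => //; rewrite WE; apply/seteqP.
  split=> x [Ux xd]; split=> //.
    have : (V `&` punctured_cone N) (pol x) by split=> //; case: (polP x xd).
    by rewrite VE => -[].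
  have : (@homothety_class R n @^-1` U
      `&` punctured_cone N) (pol x) by split=> //; case: (polP x xd).
  by rewrite -VE => -[].
- move=> x y; rewrite !inE => xd yd xy; apply: (can_inj rK); apply: phi_inj.
  by rewrite -(FN x (pol x))// (FN y (pol x)).
- apply/seteqP; split=> [_ [x xd <-]|_ [Q QN <-]].
    by exists (pol x) => //=; case: (polP x xd).
  have [QP Qx] := polytopesP Q.
  have [Q' [Q'P Q'N Q'E Q'n _]] := normal_form QP Qx.
  have [|y yL yE] := Lsurj Q' _ Q'n; first by split=> //; rewrite Q'N; case: QN.
  have yd : closed_disk (radial_inv L y) by apply/diskP; rewrite rVK.
  by exists (radial_inv L y) => //; apply: FK => //; rewrite rVK -yE.
- apply/seteqP; split=> [_ [x xo <-]|_ [Q [_ QN] <-]].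
    have xd := open_sub_closed_disk xo; have [polN polphi] := polP x xd.
    exists (pol x) => //=; split; first by case: (polytopesP (pol x)).
    by apply/esym/(Lint _ _ polN polphi)/odiskP.
  have [QP Qx] := polytopesP Q.
  have [Q' [Q'P Q'N Q'E Q'n _]] := normal_form QP Qx.
  have Q'S : secondary_cone N Q'.
    by split=> //; rewrite Q'N QN => C CN; exists C.
  have [y yL yE] := Lsurj Q' Q'S Q'n.
  have yo : open_disk (radial_inv L y).
    by apply/odiskP; rewrite rVK; apply/(Lint _ _ Q'S yE); rewrite Q'N QN.
  exists (radial_inv L y) => //; apply: FK; first exact: open_sub_closed_disk.
  by rewrite rVK -yE.
Qed.

End Cells.

(** * The cell structure *)

Section Assembly.
Variables (R : realType) (n : nat).
Implicit Types (a b : 'cV[R]_n) (P Q : polytopes R n) (N : fan R n).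

Lemma normal_fan_point (P : set 'rV[R]_n) : is_polytope P ->
  is_point P <-> normal_fan P = [set setT].
Proof.
move=> PP; rewrite normal_fanE//; split=> [[x PE]|NE].
  have PT a : [set b | fle P a b] = setT.
    apply/seteqP; split=> // b _ y; rewrite PE => -[-> _].
    by split=> // q ->.
  apply/seteqP; split=> [C [a ->]|_ ->]; first exact: PT.
  by exists 0; rewrite PT.
have [x Px] := polytope_neq0 PP; exists x; apply/seteqP; split=> [y Py|_ -> //].
apply: (@const_on_eq _ _ P) Py Px => c; rewrite -[P]face0; apply: fle_const.
have : [set C | exists a, C = [set b | fle P a b]] [set b | fle P 0 b] by
  exists 0.
by rewrite NE => /= NE'; have : [set: 'cV[R]_n] c by []; rewrite -NE'.
Qed.

Lemma polytopal_normal_fan (P : set 'rV[R]_n) : is_polytope P ->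
  polytopal (normal_fan P).
Proof. by move=> PP; split; [exact: complete_normal_fan|exists P]. Qed.

Lemma cell_fansP N : cell_fans N <-> exists P, N = normal_fan (\val P).
Proof.
split=> [[[_ [P PP ->]] nT]|[P ->]].
  have Px : ~ is_point P by move/(normal_fan_point PP).
  by exists (to_polytopes PP Px).
have [PP Px] := polytopesP P; split; first exact: polytopal_normal_fan.
by move/(normal_fan_point PP).
Qed.

Lemma open_cellP P : open_cell (normal_fan (\val P)) (homothety_class P).
Proof. by exists P => //; case: (polytopesP P). Qed.

Lemma open_sub_closed_cell N : open_cell N `<=` closed_cell N.
Proof.
move=> _ [P [PP PN] <-]; exists P => //; split=> //; rewrite PN => C CN.
by exists C.
Qed.

Lemma open_cell_class N P : open_cell N (homothety_class P) ->
  normal_fan (\val P) = N.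
Proof. by move=> [Q [_ QN] /normal_fan_class <-]. Qed.

Lemma closed_cell_class N P : closed_cell N (homothety_class P) ->
  refines N (normal_fan (\val P)).
Proof. by move=> [Q [_ QN] /normal_fan_class <-]. Qed.

Lemma refines_trans N1 N2 N3 : refines N1 N2 -> refines N2 N3 -> refines N1 N3.
Proof.
move=> h1 h2 C /h1[C' /h2[C'' C''N sub'] sub]; exists C'' => //.
exact: subset_trans sub'.
Qed.

(** The last field says that the quotient topology of the closed cell is its
    topology as a subspace. *)
Record characteristic_map N m (F : 'rV[R]_m -> Ptilde R n) : Prop :=
    CharacteristicMap {
  char_continuous : {within @closed_disk R m, continuous F};
  char_inj : {in @closed_disk R m &, injective F};
  char_closed : F @` @closed_disk R m = closed_cell N;
  char_open : F @` @open_disk R m = open_cell N;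
  char_quotient : forall C, closed_in_cell N C -> closed C }.

(** A set that is closed in the closed cell for its quotient topology is the
    image of a compact subset of the disk. *)
Lemma characteristic_map_exists N m (L : seq 'cV[R]_m) phi : cell_fans N ->
  cell_chart N L phi -> exists F : 'rV[R]_m -> Ptilde R n,
    characteristic_map N F.
Proof.
move=> fN NL; have /cell_fansP[P0 _] := fN.
have [F [Fopen Finj Fclosed_cell Fopen_cell]] := cell_map P0 NL.
have Fc : {within @closed_disk R m, continuous F}.
  by apply/continuousP => U /CW_openE/(_ N fN)/Fopen.
exists F; split=> // C [Csub /closed_openC oC].
have /open_subspaceP[V oV VE] := Fopen (~` C) oC.
rewrite (_ : C = F @` (@closed_disk R m `&` ~` V)).
  apply: compact_closed; first exact: Ptilde_hausdorff.
  apply: continuous_compact.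
    by apply: continuous_subspaceW Fc => x [].
  apply: compact_closedI; first exact: closed_disk_compact.
  exact: open_closedC.
apply/seteqP; split=> [y Cy|_ [x [xd nV] <-]].
  have := Csub y Cy; rewrite -Fclosed_cell => -[x xd xy]; exists x => //.
  split=> // Vx; have : (V `&` @closed_disk R m) x by [].
  by rewrite VE => -[/=]; rewrite xy.
apply: contrapT => nC; apply: nV.
have : (F @^-1` (~` C) `&` @closed_disk R m) x by [].
by rewrite -VE => -[].
Qed.

Section Cell.
Variables (N : fan R n) (m : nat) (F : 'rV[R]_m -> Ptilde R n).
Hypothesis FN : characteristic_map N F.

Lemma closed_cell_closed : closed (closed_cell N).
Proof.
apply: compact_closed; first exact: Ptilde_hausdorff.
rewrite -(char_closed FN); apply: continuous_compact (char_continuous FN) _.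
exact: closed_disk_compact.
Qed.

Lemma closure_open_cell : closure (open_cell N) = closed_cell N.
Proof.
apply/seteqP; split.
  rewrite [X in _ `<=` X](closure_id _).1; last exact: closed_cell_closed.
  by apply: closure_subset; exact: open_sub_closed_cell.
rewrite -(char_closed FN) => _ [x xd <-] B FxB.
have /subspace_continuousP/(_ x xd)/(_ B FxB) := char_continuous FN.
move=> wF; have nF : \forall y \near x, closed_disk y -> B (F y) by exact: wF.
(* [x] is a limit of points [t *: x] of the open disk *)
have tx : (fun t : R => t *: x) @ 1^'- --> x.
  rewrite -[X in _ --> X](scale1r x).
  have t1 : (fun t : R => t) @ 1^'- --> (1 : R).
    exact: cvg_at_left_filter cvg_id.
  exact: (cvgZ t1 (cvg_cst x)).
have [t [[t0 t1] Bt]] : exists t : R, (0 < t /\ t < 1) /\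
    (closed_disk (t *: x) -> B (F (t *: x))).
  apply: (@filter_ex _ (1^'-)); near=> t; split; last first.
    by near: t; exact: tx nF.
  by split; near: t; [exact: nbhs_left_gt|exact: nbhs_left_lt].
have txo : open_disk (t *: x).
  apply/open_diskP; rewrite enormZ ?ltW//; move/closed_diskP: xd => x1.
  by apply: le_lt_trans t1; rewrite ger_pMr.
exists (F (t *: x)); split; last by apply: Bt; exact: open_sub_closed_disk.
by rewrite -(char_open FN); exists (t *: x).
Unshelve. all: by end_near. Qed.

Lemma homeo_on_closure : homeo_on (@closed_disk R m) (closure (open_cell N)) F.
Proof.
rewrite closure_open_cell -(char_closed FN); apply: compact_homeo_on.
- exact: 0.
- exact: Ptilde_hausdorff.
- exact: closed_disk_compact.
- exact: char_continuous FN.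
- exact: char_inj FN.
Qed.

Lemma closed_subspace_cell (C : set (Ptilde R n)) : cell_fans N ->
  C `<=` closed_cell N ->
  closed (C : set (subspace (closed_cell N))) <-> closed_in_cell N C.
Proof.
move=> fN Csub; split=> [/closed_subspaceP[V cV VE]|/(char_quotient FN) cC].
  have cC : closed C.
    by rewrite -(setIidl Csub) -VE; apply: closedI => //;
      exact: closed_cell_closed.
  by have /CW_closedE/(_ N fN) := cC; rewrite setIidl.
exact: closed_subspaceW.
Qed.

End Cell.

Lemma closed_cell_sub N N' : cell_fans N ->
  @closed_cell R n N `<=` closed_cell N' <-> refines N' N.
Proof.
move=> /cell_fansP[P ->]; split=> [sub|N'N _ [Q [QP NQ] <-]].
  by apply: closed_cell_class; apply: sub; apply: open_sub_closed_cell;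
    exact: open_cellP.
by exists Q => //; split=> //; exact: refines_trans N'N NQ.
Qed.

(** The fans of the proper faces of the cell of [N]. *)
Definition proper_coarsenings N : set (fan R n) :=
  [set N' | [/\ cell_fans N', refines N N' & N' <> N]].

Lemma finite_proper_coarsenings N : cell_fans N ->
  finite_set (proper_coarsenings N).
Proof.
move=> /cell_fansP[P ->]; have [PP _] := polytopesP P.
apply: sub_finite_set (finite_coarsenings PP) => N' [/cell_fansP[Q ->] PQ _].
by exists (\val Q) => //; split=> //; case: (polytopesP Q).
Qed.

Lemma closed_cell_boundary N :
  closed_cell N `\` open_cell N `<=` \bigcup_(N' in proper_coarsenings N)
    open_cell N'.
Proof.
move=> _ [[P [PP NP] <-] nP]; exists (normal_fan (\val P));
  last exact: open_cellP.
split=> //; first by apply/cell_fansP; exists P.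
by move=> PN; apply: nP; exists P.
Qed.

(** Some defect vanishes at the polytopes with fan [N'] and not at those with
    fan [N].  It vanishes on the whole secondary cone of [N'], whose span is thus
    a proper subspace of the span of the secondary cone of [N]. *)
Lemma span_dim_coarsening N N' d d' : cell_fans N -> proper_coarsenings N N' ->
  span_dim (@support_fun R n @` secondary_cone N) d ->
  span_dim (@support_fun R n @` secondary_cone N') d' -> (d' < d)%N.
Proof.
move=> /cell_fansP[P ->] [/cell_fansP[Q ->] PQ QP_neq] sd sd'.
have [PP _] := polytopesP P; have [QP _] := polytopesP Q.
have [[a b] Qab Pab] : exists2 ab, additive_at (\val Q) ab.1 ab.2 &
    ~ additive_at (\val P) ab.1 ab.2.
  apply: contrapT => nab; apply: QP_neq; apply/normal_fan_eqP => // a b.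
  split; move: a b; last exact/refinesP.
  apply/additive_fle => // a b ab; apply: contrapT => nPab.
  by apply: nab; exists (a, b).
apply: (@span_dim_lt _ _ _ _ _ _ (support_fun (\val P)) (defect (a, b)) sd sd').
- move=> _ [Z [ZP QZ] <-]; exists Z => //; split=> //.
  exact: refines_trans PQ QZ.
- by exists (\val P) => //; split=> // C CN; exists C.
- by move=> t u v; exact: defect_linear.
- move=> _ [Z [ZP QZ] <-]; apply/defect_eq0; move: Qab.
  by apply: (additive_fle QP ZP).2; exact/refinesP.
- by apply/eqP => /defect_eq0.
Qed.

Lemma union_of_cells_fan (A : set (set 'rV[R]_n)) :
  (forall P Q, A (\val P) -> normal_fan (\val P) = normal_fan (\val Q) ->
    A (\val Q)) ->
  union_of_cells (@cell_fans R n) (@open_cell R n) (homothety_image A).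
Proof.
move=> Afan; exists [set N | exists2 P : polytopes R n,
  A (\val P) & N = normal_fan (\val P)].
  by move=> _ [P _ ->]; apply/cell_fansP; exists P.
apply/seteqP; split=> [_ [P AP <-]|x [_ [P AP ->] [Q [_ QP] <-]]].
  by exists (normal_fan (\val P)); [exists P|exact: open_cellP].
by exists Q => //; apply: Afan AP _; rewrite QP.
Qed.

Lemma cells_in_fan (A : set (set 'rV[R]_n)) N :
  (forall P Q, A (\val P) -> normal_fan (\val P) = normal_fan (\val Q) ->
    A (\val Q)) ->
  cells_in (@cell_fans R n) (@open_cell R n) (homothety_image A) N ->
  exists2 P : polytopes R n, A (\val P) & N = normal_fan (\val P).
Proof.
move=> Afan [/cell_fansP[P ->] sub]; have [Q AQ QP] := sub _ (open_cellP P).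
by exists Q => //; apply: normal_fan_class.
Qed.

End Assembly.

Theorem proposition3p47 (R : realType) (n : nat) (n_gt0 : (0 < n)%N) :
  [/\ exists2 dim : fan R n -> nat,
        regular_CW R (@cell_fans R n) dim (@open_cell R n) &
        forall N, cell_fans N ->
          span_dim (@support_fun R n @` secondary_cone N) (dim N + n + 1)%N,
      forall N, cell_fans N ->
        closure (open_cell N) = closed_cell N /\
        forall C : set (Ptilde R n), C `<=` closed_cell N ->
          (closed (C : set (subspace (closed_cell N))) <-> closed_in_cell N C),
      forall N N', cell_fans N -> cell_fans N' ->
        (@closed_cell R n N `<=` closed_cell N' <-> refines N' N),
      subcomplex (@cell_fans R n) (@open_cell R n)
        (homothety_image (@rational_edges R n)) /\
      countable (cells_in (@cell_fans R n) (@open_cell R n)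
        (homothety_image (@rational_edges R n)))
    & union_of_cells (@cell_fans R n) (@open_cell R n)
        (homothety_image (@is_delzant R n)) /\
      ((1 < n)%N -> ~ subcomplex (@cell_fans R n) (@open_cell R n)
        (homothety_image (@is_delzant R n)))].
Proof.
have chart (N : fan R n) : cell_fans N -> exists m (L : seq 'cV[R]_m) phi,
  cell_chart N L phi.
  by move=> /cell_fansP[P ->]; case: (polytopesP P); exact: cell_chart_exists.
have /choice[dim dimP] : forall N : fan R n, exists m : nat, cell_fans N ->
    exists (L : seq 'cV[R]_m) phi, cell_chart N L phi.
  move=> N; have [/chart[m NL]|nN] := pselect (cell_fans N); first by exists m.
  by exists 0%N.
have span_dimP (N : fan R n) : cell_fans N ->
    span_dim (@support_fun R n @` secondary_cone N) (dim N + n + 1)%N.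
  by move=> /dimP[L [phi []]].
have charP (N : fan R n) : cell_fans N -> exists F : 'rV[R]_(dim N) ->
  Ptilde R n,
    characteristic_map N F.
  by move=> fN; have [L [phi]] := dimP N fN; exact: characteristic_map_exists.
have closureE (N : fan R n) : cell_fans N -> closure (open_cell N) =
  closed_cell N.
  by move=> /charP[F]; exact: closure_open_cell.
split.
- exists dim; last exact: span_dimP.
  split.
  + exact: Ptilde_hausdorff.
  + apply/seteqP; split=> // x _; have [P <-] := homothety_class_surj x.
    by exists (normal_fan (\val P)); [apply/cell_fansP;
      exists P|exact: open_cellP].
  + move=> N N' _ _ [x []]; have [P <-] := homothety_class_surj x.
    by move=> /open_cell_class <- /open_cell_class.
  + move=> N /charP[F FN]; exists F; last exact: char_open FN.
    exact: homeo_on_closure.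
  + move=> N fN; exists (proper_coarsenings N); split.
    * exact: finite_proper_coarsenings.
    * by move=> N' [].
    * move=> N' NN'; have [fN' _ _] := NN'.
      have := span_dim_coarsening fN NN' (span_dimP N fN) (span_dimP N' fN').
      by rewrite !ltn_add2r.
    * by rewrite closureE//; exact: closed_cell_boundary.
  + move=> C; rewrite CW_closedE; split=> h N fN; have := h N fN.
      by rewrite closureE//; have [F FN] := charP N fN;
        exact: char_quotient FN _.
    rewrite closureE// => /CW_closedE/(_ N fN).
    by rewrite -setIA setIid.
- move=> N fN; split; first exact: closureE.
  by have [F FN] := charP N fN => C; exact: (closed_subspace_cell FN fN).
- by move=> N N' fN _; exact: closed_cell_sub.
- have ratP (P Q : polytopes R n) : rational_edges (\val P) ->
      refines (normal_fan (\val P)) (normal_fan (\val Q)) ->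
        rational_edges (\val Q).
    have [PP _] := polytopesP P; have [QP _] := polytopesP Q.
    by move=> Prat /(refinesP PP QP) PQ; exact: rational_edges_refines PP QP PQ
      Prat.
  have ratN (P Q : polytopes R n) : rational_edges (\val P) ->
      normal_fan (\val P) = normal_fan (\val Q) -> rational_edges (\val Q).
    by move=> Prat PQ; apply: ratP Prat _; rewrite PQ => C CN; exists C.
  split; last first.
    apply: sub_countable (@countable_rational_fans R n); apply: subset_card_le.
    move=> N /(cells_in_fan ratN)[P Prat ->]; exists (\val P) => //.
    by split=> //; case: (polytopesP P).
  split; first exact: union_of_cells_fan.
  move=> N NA; have [P Prat NP] := cells_in_fan ratN NA.
  have fN : cell_fans N by case: NA.
  rewrite closureE// => _ [Q [_ NQ] <-]; exists Q => //=.
  by apply: ratP Prat _; rewrite -NP.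
- have delN (P Q : polytopes R n) : is_delzant (\val P) ->
      normal_fan (\val P) = normal_fan (\val Q) -> is_delzant (\val Q).
    by move=> Pdel PQ; apply: delzant_same_fan Pdel => //; case: (polytopesP Q).
  split; first exact: union_of_cells_fan.
  move=> n_gt1 [_ sub].
  (* the cube is Delzant, and its closed cell contains the class of a segment,
     which is not full-dimensional *)
  have nonpoint (P : set 'rV[R]_n) i : P 0 -> P (delta_mx 0 i) -> ~ is_point P.
    move=> P0 P1 [x PE]; have : delta_mx 0 i = 0 :> 'rV[R]_n.
      by move: P0 P1; rewrite PE => -> ->.
    by move=> /matrixP/(_ 0 i)/eqP; rewrite !mxE !eqxx oner_eq0.
  pose i0 := Ordinal n_gt0; pose i1 := Ordinal n_gt1.
  have cubeP := cube_polytope R n.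
  have segP := axis_segment_polytope R i0.
  have cube_np : ~ is_point (@cube R n).
    apply: (nonpoint _ i0) => i; rewrite mxE ?lexx ?ler01//.
    by rewrite eqxx; case: (i == i0); rewrite /= ?mulr1n ?mulr0n ?lexx ?ler01.
  have seg_np : ~ is_point (@axis_segment R n i0).
    by apply: (nonpoint _ i0); [exact: axis_segment0|exact: axis_segment1].
  pose C := to_polytopes cubeP cube_np; pose S := to_polytopes segP seg_np.
  have fC : cell_fans (normal_fan (@cube R n)) by apply/cell_fansP; exists C.
  have Cin : cells_in (@cell_fans R n) (@open_cell R n)
      (homothety_image (@is_delzant R n)) (normal_fan (@cube R n)).
    split=> // _ [Q [QP QN] <-]; exists Q => //.
    by apply: (delN C) => //; exact: cube_delzant.
  have : homothety_image (@is_delzant R n) (homothety_class S).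
    apply: sub Cin _ _; rewrite closureE//; exists S => //; split=> //.
    by apply/refinesP => // a b; exact: cube_refines_axis_segment.
  move=> [Q Qdel /homothety_class_eq[c c0 [v SE]]].
  have [_ /full_dimP Qfull _ _ _] := Qdel.
  have : coordv R i1 = 0.
    apply: Qfull => x y Qx Qy.
    have i10 : i1 != i0 by [].
    have := @axis_segment_const R n i0 i1 i10 (c *: x + v) (c *: y + v).
    rewrite !pairingE => /(_ _ _)/addIr h; apply: (mulfI (lt0r_neq0 c0));
      apply: h.
      by rewrite [axis_segment i0]SE; exists x.
    by rewrite [axis_segment i0]SE; exists y.
  by move=> /matrixP/(_ i1 0)/eqP; rewrite !mxE !eqxx oner_eq0.
Qed.
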